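(* Let $n\geq1$ and $\alpha\geq0$. Consider systems of smooth functions $w_1,\ldots,w_n:I\to\mathbb{C}\setminus\{0\}$ and $\theta:I\to\mathbb{R}$ or $\mathbb{R}/2\pi\mathbb{Z}$ on an open interval $I\subset\mathbb{R}$ satisfying $$(1)\qquad \frac{dw_j}{ds}=e^{i\theta(s)}\,\overline{w_1\cdots w_{j-1}w_{j+1}\cdots w_n},\quad j=1,\ldots,n,\qquad \frac{d\theta}{ds}=\alpha\,\mathrm{Im}\bigl(e^{-i\theta(s)}w_1\cdots w_n\bigr),$$ whose first integral $A$ (see context) satisfies $A<0$. Then any such solution on an interval $I$ can be extended to a unique largest open interval $I_{\max}$ in $\mathbb{R}$. Take $I=I_{\max}$. Then by changing variables from $s\in I_{\max}$ to $y=y(s)\in\mathbb{R}$, the submanifold $$L=\Bigl\{\bigl(x_1w_1(s),\ldots,x_nw_n(s)\bigr):s\in I,\ x_j\in\mathbb{R},\ \sum_{j=1}^nx_j^2=1\Bigr\}$$ may be rewritten explicitly in the form (2) below; conversely, every $L$ of the form (2) arises in this way from a solution of (1) with $\alpha\geq0$ and $A<0$. For given constants $\alpha\geq0$, $a_1,\ldots,a_n>0$ and $\psi_1,\ldots,\psi_n\in\mathbb{R}$, define $w_j(y)=e^{i\phi_j(y)}r_j(y)$ for $j=1,\ldots,n$ and $y\in\mathbb{R}$ by $$r_j(y)=\sqrt{\tfrac1{a_j}+y^2}\quad\text{and}\quad \phi_j(y)=\psi_j+\int_0^y\frac{dt}{(\frac1{a_j}+t^2)\sqrt{P(t)}},\qquad\text{where}\quad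 P(t)=\frac1{t^2}\Bigl(\prod_{k=1}^n(1+a_kt^2)e^{\alpha t^2}-1\Bigr).$$ Then $$(2)\qquad L=\Bigl\{\bigl(x_1w_1(y),\ldots,x_nw_n(y)\bigr): x_1,\ldots,x_n\in\mathbb{R},\ y\in\mathbb{R},\ \sum_{j=1}^nx_j^2=1\Bigr\}$$ is a closed, embedded Lagrangian submanifold of $\mathbb{C}^n$ diffeomorphic to $\mathcal{S}^{n-1}\times\mathbb{R}$ and satisfying $\alpha F^\perp=H$. If $\alpha>0$ it is a self-expander, and if $\alpha=0$ it is special Lagrangian (one of Lawlor's examples). It has Lagrangian angle $$\theta(y)=\sum_{j=1}^n\phi_j(y)+\arg\bigl(y+iP(y)^{-1/2}\bigr).$$
   Context: $\mathbb{C}^n$ has coordinates $z_j=x_j+iy_j$, the Euclidean metric, and symplectic form $\omega=\sum_jdx_j\wedge dy_j$. An $n$-dimensional submanifold $L$ is Lagrangian if $\omega|_L=0$; its Lagrangian angle $\theta$ (for a suitable orientation, modulo $2\pi$) is defined by $dz_1\wedge\cdots\wedge dz_n|_L=e^{i\theta}\mathrm{vol}_L$; $L$ is special Lagrangian if $\theta$ is constant. $H$ is the mean curvature vector, $F$ the position vector, $F^\perp$ its normal projection; $L$ is a self-expander if $H\equiv cF^\perp$ for a constant $c>0$. ''Closed'' means closed as a subset of $\mathbb{C}^n$. First integral: given a solution of (1), write $w_j=r_je^{i\phi_j}$ with $r_j>0$, $\phi=\sum_j\phi_j$, fix $s_0\in I$, and set $\alpha_j=r_j(s_0)^2$, $u(s)=2\int_{s_0}^sr_1\cdots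 r_n\cos(\phi-\theta)\,dt$, $Q(u)=\prod_{j=1}^n(\alpha_j+u)$. Then $r_j^2=\alpha_j+u$ and $Q(u)^{1/2}e^{\alpha u/2}\sin(\phi-\theta)$ is a constant, denoted $A$ (its sign is independent of $s_0$). $P$ is extended smoothly to $t=0$; $P>0$; and $\arg(y+iP(y)^{-1/2})\in(0,\pi)$. Empty products are $1$. *)

(* Defs.v *)
From HB Require Import structures.
From mathcomp Require Import all_boot all_order all_algebra.
From mathcomp Require Import all_classical all_reals all_analysis.
From mathcomp Require Export complex.
Set Implicit Arguments.
Unset Strict Implicit.
Unset Printing Implicit Defensive.
Import Order.TTheory GRing.Theory Num.Theory.
Import numFieldNormedType.Exports.
Local Open Scope classical_set_scope.
Local Open Scope ring_scope.
Local Open Scope complex_scope.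

Section smoothness.
Variable R : realType.

Fixpoint iter_derive (V W : normedModType R) (vs : seq V) (f : V -> W) : V -> W :=
  if vs is v :: vs' then iter_derive vs' (fun x => 'D_v f x) else f.

(* C^infty on an open set U: all iterated directional derivatives are Frechet
   differentiable at every point of U. *)
Definition smooth_on (V W : normedModType R) (U : set V) (f : V -> W) :=
  forall (vs : seq V) (x : V), U x -> differentiable (iter_derive vs f) x.

(* Smoothness on an arbitrary subset: locally the restriction of a smooth map
   of the ambient space. *)
Definition smooth_map (V W : normedModType R) (A : set V) (f : V -> W) :=
  forall p, A p -> exists (U : set V) (F : V -> W),
    [/\ open U, U p, smooth_on U F & forall q, (A `&` U) q -> f q = F q].

Definition diffeo_by (V W : normedModType R) (A : set V) (B : set W)
    (f : V -> W) (g : W -> V) :=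
  [/\ smooth_map A f, smooth_map B g,
      (forall x, A x -> B (f x) /\ g (f x) = x) &
      (forall y, B y -> A (g y) /\ f (g y) = y)].

Definition diffeomorphic (V W : normedModType R) (A : set V) (B : set W) :=
  exists f g, diffeo_by A B f g.

End smoothness.

Section submanifolds.
Variables (R : realType) (N : nat).
Implicit Types L : set 'rV[R]_N.

(* A diffeomorphism from an open V of R^m onto a relatively open part of L. *)
Definition local_param (m : nat) L (V : set 'rV[R]_m)
    (X : 'rV[R]_m -> 'rV[R]_N) :=
  open V /\ exists (W : set 'rV[R]_N) (Y : 'rV[R]_N -> 'rV[R]_m),
    open W /\ diffeo_by V (L `&` W) X Y.

Definition embedded_submanifold (m : nat) L :=
  forall p, L p -> exists (V : set 'rV[R]_m) X q,
    [/\ local_param L V X, V q & X q = p].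

Section chart.
Variables (m : nat) (X : 'rV[R]_m -> 'rV[R]_N) (q : 'rV[R]_m).

(* Row i of jacobian X q is the i-th coordinate vector of the chart. *)
Definition gram : 'M[R]_m := jacobian X q *m (jacobian X q)^T.

Definition normal_proj (v : 'rV[R]_N) : 'rV[R]_N :=
  v - v *m (jacobian X q)^T *m invmx gram *m jacobian X q.

Definition second_partial (i j : 'I_m) : 'rV[R]_N :=
  'D_(delta_mx 0 i) (fun q' => 'D_(delta_mx 0 j) X q') q.

(* Trace of the second fundamental form, not divided by m. *)
Definition mean_curvature : 'rV[R]_N :=
  \sum_(i < m) \sum_(j < m)
    invmx gram i j *: normal_proj (second_partial i j).

End chart.

(* H = c F^perp; both sides do not depend on the local parametrization. *)
Definition mean_curvature_eq (m : nat) L (c : R) :=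
  forall (V : set 'rV[R]_m) X q, local_param L V X -> V q ->
    mean_curvature X q = c *: normal_proj X q (X q).

Definition self_expander (m : nat) L :=
  exists c : R, 0 < c /\ mean_curvature_eq m L c.

(* An orientation, given as an atlas O of positively oriented charts. *)
Definition oriented_atlas (m : nat) L
    (O : set 'rV[R]_m -> ('rV[R]_m -> 'rV[R]_N) -> Prop) :=
  [/\ (forall V X, O V X -> local_param L V X),
      (forall p, L p -> exists V X q, [/\ O V X, V q & X q = p]) &
      (forall V X V' X' q q', O V X -> O V' X' -> V q -> V' q' ->
         X q = X' q' ->
         exists M : 'M[R]_m, 0 < \det M /\ jacobian X q = M *m jacobian X' q')].

End submanifolds.

Section lagrangian.
Variables (R : realType) (n : nat).
Implicit Types L : set 'rV[R]_(n + n).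

(* C^n is R^(n + n), with coordinates (x_1, .., x_n, y_1, .., y_n). *)
Definition realify (z : 'rV[R[i]]_n) : 'rV[R]_(n + n) :=
  row_mx (map_mx (@complex.Re R) z) (map_mx (@complex.Im R) z).

Definition omega (u v : 'rV[R]_(n + n)) : R :=
  \sum_(j < n) (u 0 (lshift n j) * v 0 (rshift n j)
              - u 0 (rshift n j) * v 0 (lshift n j)).

(* (dz_1 /\ .. /\ dz_n)(v_1, .., v_n), where v_i is row i of M. *)
Definition dz_form (M : 'M[R]_(n, n + n)) : R[i] :=
  \det (\matrix_(i < n, j < n) (M i (lshift n j) +i* M i (rshift n j))).

Definition cis (t : R) : R[i] := cos t +i* sin t.

Definition lagrangian L :=
  embedded_submanifold n L /\
  forall (V : set 'rV[R]_n) X q, local_param L V X -> V q ->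
    forall i j, omega (row i (jacobian X q)) (row j (jacobian X q)) = 0.

(* theta is a real representative of a function on L defined modulo 2 pi. *)
Definition lagrangian_angle L (theta : 'rV[R]_(n + n) -> R) :=
  exists O, @oriented_atlas R (n + n) n L O /\
    forall V X q, O V X -> V q ->
      dz_form (jacobian X q) =
      cis (theta (X q)) * (Num.sqrt (\det (gram X q)))%:C.

Definition special_lagrangian L :=
  lagrangian L /\ exists c : R, lagrangian_angle L (fun=> c).

Definition unit_sphere : set 'rV[R]_n := [set x | \sum_(j < n) x 0 j ^+ 2 = 1].

(* S^(n-1) x R inside R^n x R. *)
Definition sphere_line : set 'rV[R]_(n + 1) := [set p | unit_sphere (lsubmx p)].

Definition sweep_point (w : 'I_n -> R -> R[i]) (x : 'rV[R]_n) (s : R) :=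
  realify (\row_j ((x 0 j)%:C * w j s)).

Definition sweep (I : set R) (w : 'I_n -> R -> R[i]) : set 'rV[R]_(n + n) :=
  [set p | exists x s, [/\ unit_sphere x, I s & p = sweep_point w x s]].

End lagrangian.

(* int_a^b f, for a and b in any order. *)
Definition oriented_integral (R : realType) (f : R -> R) (a b : R) : R :=
  if a <= b then \int[lebesgue_measure]_(t in `[a, b]) f t
  else - \int[lebesgue_measure]_(t in `[b, a]) f t.

(* An angle function, with values in R or in R/2piZ; a function theta to R/2piZ
   is represented by the function e^(i theta) to the unit circle. *)
Inductive angle_fun (R : realType) :=
  | RealAngle of R -> R
  | CircleAngle of R -> R[i].

Section system.
Variables (R : realType) (n : nat) (alpha : R).
Implicit Types (I : set R) (w : 'I_n -> R -> R[i]) (th : angle_fun R).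

Definition open_interval I := [/\ open I, is_interval I & I !=set0].

Definition smoothC I (f : R -> R[i]) :=
  smooth_on I (fun s => complex.Re (f s)) /\
  smooth_on I (fun s => complex.Im (f s)).

Definition is_deriveC (s : R) (f : R -> R[i]) (d : R[i]) :=
  is_derive s 1 (fun t => complex.Re (f t)) (complex.Re d) /\
  is_derive s 1 (fun t => complex.Im (f t)) (complex.Im d).

Definition exp_angle th (s : R) : R[i] :=
  match th with RealAngle t => cis (t s) | CircleAngle e => e s end.

Definition smooth_angle I th :=
  match th with
  | RealAngle t => smooth_on I t
  | CircleAngle e =>
      smoothC I e /\
      forall s, I s -> complex.Re (e s) ^+ 2 + complex.Im (e s) ^+ 2 = 1
  end.

(* d(theta)/ds = d at s; on the circle, d(e^(i theta))/ds = i d e^(i theta). *)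
Definition is_derive_angle (s : R) th (d : R) :=
  match th with
  | RealAngle t => is_derive s 1 t d
  | CircleAngle e => is_deriveC s e ((0 +i* d) * e s)
  end.

Definition eq_angle_on I th th' :=
  match th, th' with
  | RealAngle t, RealAngle t' => forall s, I s -> t s = t' s
  | CircleAngle e, CircleAngle e' => forall s, I s -> e s = e' s
  | _, _ => False
  end.

(* The values of w and th outside I are irrelevant. *)
Definition solution I w th :=
  [/\ open_interval I,
      (forall j, smoothC I (w j)) /\ smooth_angle I th,
      (forall j s, I s -> w j s != 0),
      (forall j s, I s ->
         is_deriveC s (w j)
           (exp_angle th s * conjc (\prod_(k < n | k != j) w k s))) &
      (forall s, I s ->
         is_derive_angle s th
           (alpha * complex.Im ((exp_angle th s)^-1 * \prod_(k < n) w k s)))].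

(* Only the values of phi and theta modulo 2 pi at the points of I enter. *)
Definition first_integral I w th (s0 A : R) :=
  I s0 /\
  exists (r phi : 'I_n -> R -> R) (theta : R -> R),
    [/\ (forall j s, I s -> 0 < r j s /\ w j s = (r j s)%:C * cis (phi j s)),
        (forall s, I s -> exp_angle th s = cis (theta s)) &
        let phis s := \sum_(j < n) phi j s in
        let u s := 2 * oriented_integral
          (fun t => (\prod_(j < n) r j t) * cos (phis t - theta t)) s0 s in
        let Q v := \prod_(j < n) (r j s0 ^+ 2 + v) in
        forall s, I s ->
          Num.sqrt (Q (u s)) * expR (alpha * u s / 2) * sin (phis s - theta s)
          = A].

Definition negative_first_integral I w th :=
  exists s0 A, first_integral I w th s0 A /\ A < 0.

Definition extension I w th J w' th' :=
  [/\ I `<=` J, solution J w' th',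
      (forall j s, I s -> w j s = w' j s) & eq_angle_on I th th'].

Definition largest_extension I w th J w' th' :=
  extension I w th J w' th' /\
  forall K w2 th2, extension I w th K w2 th2 ->
    [/\ K `<=` J, (forall j s, K s -> w2 j s = w' j s) &
        eq_angle_on K th2 th'].

End system.

Section explicit_family.
Variables (R : realType) (n : nat) (alpha : R) (a psi : 'I_n -> R).

(* At t = 0, the value of the smooth extension. *)
Definition P_fun (t : R) : R :=
  if t == 0 then \sum_(k < n) a k + alpha
  else (\prod_(k < n) (1 + a k * t ^+ 2) * expR (alpha * t ^+ 2) - 1) / t ^+ 2.

Definition r_fun (j : 'I_n) (y : R) : R := Num.sqrt ((a j)^-1 + y ^+ 2).

Definition phi_fun (j : 'I_n) (y : R) : R :=
  psi j + oriented_integral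
    (fun t => (((a j)^-1 + t ^+ 2) * Num.sqrt (P_fun t))^-1) 0 y.

Definition w_fun (j : 'I_n) (y : R) : R[i] :=
  cis (phi_fun j y) * (r_fun j y)%:C.

(* For Im z > 0, the argument of z in ]0, pi[. *)
Definition upper_arg (z : R[i]) : R :=
  acos (complex.Re z / Num.sqrt (complex.Re z ^+ 2 + complex.Im z ^+ 2)).

Definition theta_fun (y : R) : R :=
  \sum_(j < n) phi_fun j y + upper_arg (y +i* (Num.sqrt (P_fun y))^-1).

Definition L_fun : set 'rV[R]_(n + n) := sweep setT w_fun.

(* A diffeomorphism y from I onto the real line takes w to w_fun. *)
Definition change_of_variables (I : set R) (w : 'I_n -> R -> R[i]) (y : R -> R) :=
  [/\ smooth_on I y, set_bij I setT y, (forall s, I s -> derive1 y s != 0) &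
      (forall j s, I s -> w j s = w_fun j (y s))].

End explicit_family.

(* Main.v *)
Require Import Defs.
From HB Require Import structures.
From mathcomp Require Import all_boot all_order all_algebra.
From mathcomp Require Import all_classical all_reals all_analysis.
From mathcomp Require Import ring lra.
Set Implicit Arguments.
Unset Strict Implicit.
Unset Printing Implicit Defensive.
Import Order.TTheory GRing.Theory Num.Theory.
Import numFieldNormedType.Exports.
Local Open Scope classical_set_scope.
Local Open Scope ring_scope.

(** Write N(v) = prod (1 + a_k v) e^(alpha v), so that t^2 P(t) = N(t^2) - 1, and
p = P^(-1/2).  As N is 1 at 0 with a smooth difference quotient, P is smooth, and
P >= a_k.  The curves satisfy dw_j/dy = w_j (y + i p) / r_j^2, and everything rests
on the identity ([profile_identity])
    p - y p' = (y^2 + p^2) p (alpha + sum_k 1 / r_k^2),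
obtained by differentiating y^2 + p^2 = N(y^2) p^2.

Let V = e^(-i theta) w_1 ... w_n.  By the system, all |w_j|^2 have derivative
2 Re V, and theta has derivative alpha Im V.  The identity gives d theta/dy =
- alpha p for the angle of the explicit curves ([is_derive_theta]), and their V is a
positive multiple of y - i p ([cis_theta_prod_w]).  Hence they solve the system
once y moves with a suitable velocity, over the open interval of times that is
the range of an increasing function of y ([time_inverse]).  Conversely, a solution
with A < 0 has Im V < 0, and the intermediate value theorem finds an explicit curve
through its initial data ([explicit_curve_through]).  The first integrals |w_j|^2 -
|w_k|^2 and A force the solution to stay on that curve ([solution_is_explicit]).
The same holds for every extension of it, so the explicit solution over the whole
interval is the largest one ([largest_explicit]).

As P >= a_j, the phase phi_j stays within pi / 2 of psi_j ([phi_range]).  So x and y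
are recovered from (x_j w_j(y)) by functions that are smooth on open subsets of
C^n ([smooth_upto_height], [smooth_upto_sphere_coord]).  This gives an injective
parametrization of L by the sphere times the line, with smooth local inverses, and
charts as graphs over coordinate hyperplanes ([local_param_graph_chart],
[diffeomorphic_L]).  L is closed because |y| is at most the norm of the point.

In any chart, x and y are functions of the parameters ([chart_factors]).  The
symplectic products of w_m and its derivatives are omega(w, w') = p and
omega(w, w'') = p', for every m.  With the derivatives of sum x_m^2 = 1, this shows
that L is Lagrangian ([omega_tangent]) and computes its second fundamental form,
a cubic form ([symplectic_first_second]).  The complex structure maps the tangent
space of a Lagrangian submanifold onto its normal space, so H = alpha F^perp means
that the trace of the cubic form is the symplectic product with alpha times the
position vector, which is - alpha p dy.  The products of the differentials of x_m and y
in the inverse metric follow from the relations between the rows and columns of a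
Lagrangian frame ([lagrangian_frame_relations]), and the identity for p - y p' turns
the trace into the required value ([cubic_trace], [mean_curvature_position]).

For a graph chart, dz_1 ... dz_n of the frame is a real multiple of
(y + i p) w_1 ... w_n ([graph_frame_angle]), the argument of which is theta.  When
alpha = 0, theta is constant because its derivative is - alpha p. *)

(** * Smooth functions, graded by the order of differentiation *)

Section graded_smoothness.
Variable R : realType.
Implicit Types (V W : normedModType R) (k : nat).

(** [smooth_on] cut off at a finite order, so that closure properties can be
proved by induction on the order. *)
Definition smooth_upto k V W (U : set V) (f : V -> W) :=
  forall (vs : seq V) (x : V), (size vs <= k)%N -> U x ->
    differentiable (iter_derive vs f) x.

Lemma smooth_onP V W (U : set V) (f : V -> W) :
  smooth_on U f <-> forall k, smooth_upto k U f.
Proof.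
split=> [h k vs x _|h vs x]; first exact: h.
exact: (h (size vs)).
Qed.

Lemma smooth_uptoW k l V W (U : set V) (f : V -> W) :
  (k <= l)%N -> smooth_upto l U f -> smooth_upto k U f.
Proof. by move=> kl h vs x vk; apply: h; exact: leq_trans kl. Qed.

Lemma smooth_upto_sub k V W (U U' : set V) (f : V -> W) :
  U `<=` U' -> smooth_upto k U' f -> smooth_upto k U f.
Proof. by move=> UU' h vs x vk Ux; apply: h => //; exact: UU'. Qed.

Lemma smooth_upto_diff k V W (U : set V) (f : V -> W) x :
  smooth_upto k U f -> U x -> differentiable f x.
Proof. by move=> h; exact: (h [::]). Qed.

Lemma smooth_upto_derivable k V W (U : set V) (f : V -> W) x v :
  smooth_upto k U f -> U x -> derivable f x v.
Proof. by move=> h Ux; apply: diff_derivable; exact: smooth_upto_diff h Ux. Qed.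

Lemma smooth_upto_derive k V W (U : set V) (f : V -> W) v :
  smooth_upto k.+1 U f -> smooth_upto k U (fun x => 'D_v f x).
Proof. by move=> h vs x vk; exact: (h (v :: vs)). Qed.

Lemma smooth_uptoS k V W (U : set V) (f : V -> W) :
  (forall x, U x -> differentiable f x) ->
  (forall v, smooth_upto k U (fun x => 'D_v f x)) -> smooth_upto k.+1 U f.
Proof. by move=> h0 h [|v vs] x //=; [move=> _; exact: h0|exact: h]. Qed.

(** Near x, the function g is f plus a function that vanishes, whose
differential is 0. *)
Lemma near_eq_differentiable V W (f g : V -> W) x :
  (\forall z \near x, f z = g z) -> differentiable f x -> differentiable g x.
Proof.
move=> fg df; pose h := g - f.
have hx : h x = 0 by rewrite /h /GRing.add /= -(nbhs_singleton fg) subrr.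
have hE : h \o shift x = cst (h x) + \0 +o_ 0 id.
  apply/eqaddoP => e e0; rewrite hx.
  move: fg; rewrite (near_shift 0) subr0; apply: filterS => z /= E.
  have hz : h (z + x) = 0 by rewrite /h /GRing.add /= -E subrr.
  rewrite [X in `|X|](_ : _ = h (z + x) - (0 + 0)) // hz.
  by rewrite addr0 subrr normr0 mulr_ge0 // ltW.
have hc : continuous (\0 : V -> W) by exact: cst_continuous.
have dh : differentiable h x.
  by apply/diff_locallyP; rewrite (diff_unique hc hE).
rewrite (_ : g = f + h); first exact: differentiableD.
by apply/funext => z; rewrite /h /GRing.add /=; rewrite addrC subrK.
Qed.

Lemma smooth_upto_eq k V W (U : set V) (f g : V -> W) : open U ->
  (forall x, U x -> f x = g x) -> smooth_upto k U f -> smooth_upto k U g.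
Proof.
move=> oU; have near_eq (f' g' : V -> W) x : U x ->
    (forall x, U x -> f' x = g' x) -> \forall z \near x, f' z = g' z.
  move=> Ux fg; have : nbhs x U by exact: open_nbhs_nbhs.
  by apply: filterS => z /fg.
elim: k f g => [|k IH] f g fg sf.
  case=> [|//] x _ Ux; apply: (near_eq_differentiable (near_eq _ _ _ Ux fg)).
  exact: smooth_upto_diff sf Ux.
apply: smooth_uptoS => [x Ux|v].
  apply: (near_eq_differentiable (near_eq _ _ _ Ux fg)).
  exact: smooth_upto_diff sf Ux.
apply: IH (smooth_upto_derive v sf) => x Ux.
exact: near_eq_derive (near_eq _ _ _ Ux fg).
Qed.

(** The induction step of the closure properties: a formula for the directional
derivatives exhibits them in the previous class. *)
Lemma smooth_uptoS_is_derive k V W (U : set V) (f : V -> W) (df : V -> V -> W) :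
  open U -> (forall x, U x -> differentiable f x) ->
  (forall v x, U x -> is_derive x v f (df v x)) ->
  (forall v, smooth_upto k U (df v)) -> smooth_upto k.+1 U f.
Proof.
move=> oU Df dfE sdf; apply: smooth_uptoS => // v.
apply: smooth_upto_eq (sdf v) => // x Ux.
by have [_ ->] := dfE v x Ux.
Qed.

Lemma smooth_upto_cst k V W (U : set V) (c : W) : smooth_upto k U (fun=> c).
Proof.
elim: k c => [|k IH] c.
  by case=> [|//] x _ _; exact: differentiable_cst.
apply: smooth_uptoS => [x _|v]; first exact: differentiable_cst.
suff -> : (fun x => 'D_v (fun=> c) x) = (fun=> 0) :> (V -> W) by [].
by apply/funext => x; rewrite (derive_cst c).
Qed.

Lemma smooth_uptoD k V W (U : set V) (f g : V -> W) : open U ->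
  smooth_upto k U f -> smooth_upto k U g -> smooth_upto k U (fun x => f x + g x).
Proof.
move=> oU; elim: k f g => [|k IH] f g sf sg.
  case=> [|//] x _ Ux; apply: differentiableD.
    exact: smooth_upto_diff sf Ux.
  exact: smooth_upto_diff sg Ux.
apply: (@smooth_uptoS_is_derive _ _ _ _ _ (fun v x => 'D_v f x + 'D_v g x)) => //.
- move=> x Ux; apply: differentiableD.
    exact: smooth_upto_diff sf Ux.
  exact: smooth_upto_diff sg Ux.
- move=> v x Ux; apply: is_deriveD; apply: derivableP.
    exact: smooth_upto_derivable sf Ux.
  exact: smooth_upto_derivable sg Ux.
- by move=> v; apply: IH; exact: smooth_upto_derive.
Qed.

Lemma smooth_uptoZl k V W (U : set V) (f : V -> R) (c : W) : open U ->
  smooth_upto k U f -> smooth_upto k U (fun x => f x *: c).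
Proof.
move=> oU; elim: k f => [|k IH] f sf.
  case=> [|//] x _ Ux; apply: differentiableZl.
  exact: smooth_upto_diff sf Ux.
apply: (@smooth_uptoS_is_derive _ _ _ _ _ (fun v x => 'D_v f x *: c)) => //.
- move=> x Ux; apply: differentiableZl.
  exact: smooth_upto_diff sf Ux.
- move=> v x Ux; have df := smooth_upto_diff sf Ux.
  have dfc : differentiable (fun x => f x *: c) x by exact: differentiableZl.
  apply: DeriveDef; first exact: diff_derivable.
  by rewrite !deriveE // diffZl.
- by move=> v; apply: IH; exact: smooth_upto_derive.
Qed.

Lemma smooth_uptoM k V (U : set V) (f g : V -> R) : open U ->
  smooth_upto k U f -> smooth_upto k U g -> smooth_upto k U (fun x => f x * g x).
Proof.
move=> oU; elim: k f g => [|k IH] f g sf sg.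
  case=> [|//] x _ Ux; apply: differentiableM.
    exact: smooth_upto_diff sf Ux.
  exact: smooth_upto_diff sg Ux.
apply: (@smooth_uptoS_is_derive _ _ _ _ _
    (fun v x => f x * 'D_v g x + g x * 'D_v f x)) => //.
- move=> x Ux; apply: differentiableM.
    exact: smooth_upto_diff sf Ux.
  exact: smooth_upto_diff sg Ux.
- move=> v x Ux; apply: is_deriveM; apply: derivableP.
    exact: smooth_upto_derivable sf Ux.
  exact: smooth_upto_derivable sg Ux.
- move=> v; apply: smooth_uptoD => //; apply: IH.
  + exact: smooth_uptoW (leqnSn _) sf.
  + exact: smooth_upto_derive.
  + exact: smooth_uptoW (leqnSn _) sg.
  + exact: smooth_upto_derive.
Qed.

Lemma smooth_uptoN k V (U : set V) (f : V -> R) : open U ->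
  smooth_upto k U f -> smooth_upto k U (fun x => - f x).
Proof.
move=> oU sf.
apply: (@smooth_upto_eq _ _ _ _ (fun x => -1 * f x)) => // [x _|].
  by rewrite mulN1r.
by apply: smooth_uptoM => //; exact: smooth_upto_cst.
Qed.

Lemma smooth_uptoB k V (U : set V) (f g : V -> R) : open U ->
  smooth_upto k U f -> smooth_upto k U g -> smooth_upto k U (fun x => f x - g x).
Proof. by move=> oU sf sg; apply: smooth_uptoD => //; exact: smooth_uptoN. Qed.

Lemma smooth_upto_sum k V W (U : set V) (I : Type) (s : seq I) (P : pred I)
  (f : I -> V -> W) : open U -> (forall i, smooth_upto k U (f i)) ->
  smooth_upto k U (fun x => \sum_(i <- s | P i) f i x).
Proof.
move=> oU sf; elim: s => [|i s IH].
  refine (@smooth_upto_eq k V W U (fun=> 0) _ oU _ (smooth_upto_cst 0)) => x _.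
  by rewrite big_nil.
case: (boolP (P i)) => Pi.
  apply: smooth_upto_eq (smooth_uptoD oU (sf i) IH) => // x _.
  by rewrite big_cons Pi.
by apply: smooth_upto_eq IH => // x _; rewrite big_cons (negbTE Pi).
Qed.

Lemma smooth_upto_prod k V (U : set V) (I : Type) (s : seq I) (P : pred I)
  (f : I -> V -> R) : open U -> (forall i, smooth_upto k U (f i)) ->
  smooth_upto k U (fun x => \prod_(i <- s | P i) f i x).
Proof.
move=> oU sf; elim: s => [|i s IH].
  refine (@smooth_upto_eq k V R U (fun=> 1) _ oU _ (smooth_upto_cst (1 : R))) => x _.
  by rewrite big_nil.
case: (boolP (P i)) => Pi.
  apply: smooth_upto_eq (smooth_uptoM oU (sf i) IH) => // x _.
  by rewrite big_cons Pi.
by apply: smooth_upto_eq IH => // x _; rewrite big_cons (negbTE Pi).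
Qed.

Lemma is_derive_along_line V (g : V -> R) (x v : V) (dg : R) :
  is_derive x v g dg <-> is_derive (0 : R) 1 (fun h : R => g (h *: v + x)) dg.
Proof.
have E : 'D_1 (fun h : R => g (h *: v + x)) 0 = 'D_v g x.
  rewrite /derive; apply: (f_equal (fun F : R -> R => lim (F @ 0^'))).
  by apply/funext => h /=; rewrite addr0 scale0r add0r [_%:A]mulr1.
split=> -[d d'].
  apply: DeriveDef; first exact: (proj1 (derivable1P g x v) d).
  by rewrite E.
apply: DeriveDef; first exact: (proj2 (derivable1P g x v) d).
by rewrite -E.
Qed.

Lemma is_derive_comp1 V (f : R -> R) (g : V -> R) (x v : V) (df dg : R) :
  is_derive (g x) 1 f df -> is_derive x v g dg ->
  is_derive x v (fun q => f (g q)) (df * dg).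
Proof.
move=> f1 /is_derive_along_line g1; apply/is_derive_along_line.
have fl : is_derive (g (0 *: v + x)) 1 f df by rewrite scale0r add0r.
exact: (is_derive1_comp (g := fun h : R => g (h *: v + x)) fl g1).
Qed.

Lemma smooth_upto_comp k V (U : set V) (U' : set R) (f : R -> R) (g : V -> R) :
  open U -> open U' -> (forall x, U x -> U' (g x)) ->
  smooth_upto k U' f -> smooth_upto k U g -> smooth_upto k U (fun x => f (g x)).
Proof.
move=> oU oU' UU'; have dfg (l : nat) (f' : R -> R) x : U x ->
    smooth_upto l U' f' -> smooth_upto l U g -> differentiable (f' \o g) x.
  move=> Ux sf sg; apply: differentiable_comp.
    exact: smooth_upto_diff sg Ux.
  by apply: smooth_upto_diff sf _; exact: UU'.
elim: k f => [|k IH] f sf sg.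
  case=> [|//] x _ Ux; exact: dfg sg.
apply: (@smooth_uptoS_is_derive _ _ _ _ _
    (fun v x => 'D_1 f (g x) * 'D_v g x)) => //.
- move=> x Ux; exact: dfg sg.
- move=> v x Ux; apply: is_derive_comp1; apply: derivableP.
    by apply: smooth_upto_derivable sf _; exact: UU'.
  exact: smooth_upto_derivable sg Ux.
- move=> v; apply: smooth_uptoM => //; last exact: smooth_upto_derive.
  apply: (IH (fun z => 'D_1 f z)); first exact: smooth_upto_derive.
  exact: smooth_uptoW (leqnSn _) sg.
Qed.

Lemma derive_line (f : R -> R) x v : derivable f x 1 -> 'D_v f x = v * 'D_1 f x.
Proof.
move=> df; have df' : differentiable f x by exact/derivable1_diffP.
by rewrite !deriveE // -[v in LHS]mulr1 [LHS]linearZ.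
Qed.

Lemma smooth_upto_line k (U : set R) (f g : R -> R) : open U ->
  (forall x, U x -> is_derive x 1 f (g x)) -> smooth_upto k U g ->
  smooth_upto k.+1 U f.
Proof.
move=> oU fg sg.
apply: (@smooth_uptoS_is_derive k R R U f (fun v x => v * g x)) => //.
- by move=> x /fg [df _]; exact/derivable1_diffP.
- move=> v x Ux; have [df E] := fg _ Ux.
  have E' : 'D_v f x = v * g x by rewrite (derive_line v df) E.
  apply: DeriveDef E'.
  apply: diff_derivable.
  exact: (proj1 (derivable1_diffP _ _) df).
- by move=> v; apply: smooth_uptoM => //; exact: smooth_upto_cst.
Qed.

(** Smoothness by bootstrapping: along a differential equation, each order of
smoothness of the unknown gives the next one. *)
Lemma smooth_on_bootstrap (U : set R) (f g : R -> R) : open U ->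
  (forall x, U x -> is_derive x 1 f (g x)) ->
  (forall k, smooth_upto k U f -> smooth_upto k U g) -> smooth_on U f.
Proof.
move=> oU fg h; apply/smooth_onP; elim=> [|k IH].
  by case=> [|//] x _ /fg[df _]; exact/derivable1_diffP.
by apply: smooth_upto_line (h _ IH).
Qed.

Lemma smooth_upto_id k (U : set R) : open U -> smooth_upto k U id.
Proof.
move=> oU; apply: smooth_uptoW (leqnSn k) _.
by apply: (@smooth_upto_line _ _ _ (fun=> 1)) => //; exact: smooth_upto_cst.
Qed.

End graded_smoothness.

(** * Calculus in one variable *)

Section one_variable.
Variable R : realType.
Implicit Types (f g F : R -> R) (k : nat).

Lemma is_derive_continuous f (x d : R) : is_derive x 1 f d -> {for x, continuous f}.
Proof.
by move=> [df _]; exact/differentiable_continuous/(proj1 (derivable1_diffP _ _)).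
Qed.

Lemma within_continuous f (D : set R) :
  (forall x, D x -> {for x, continuous f}) -> {within D, continuous f}.
Proof.
by move=> cf; apply/continuous_in_subspaceT => x /[!inE] Dx; exact: cf.
Qed.

Lemma is_interval_cc (D : set R) (a b x : R) : is_interval D -> D a -> D b ->
  a <= x <= b -> D x.
Proof. by move=> iD Da Db; exact: iD. Qed.

(** Taking the interval as a set makes the mean value theorem apply to domains of
solutions and to ranges of monotone functions alike. *)
Lemma interval_MVT f f' (D : set R) (a b : R) : is_interval D -> D a -> D b -> a < b ->
  (forall x : R, D x -> is_derive x 1 f (f' x)) ->
  exists2 c, D c & f b - f a = f' c * (b - a).
Proof.
move=> iD Da Db ab df.
have Dab x : x \in `[a, b] -> D x.
  by rewrite in_itv /=; exact: is_interval_cc.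
have [|x xab|c cab ->] := @MVT R f f' a b ab.
- by move=> x xab; apply: df; apply: Dab; exact: subset_itv_oo_cc xab.
- move: xab; apply: within_continuous => z zab.
  by apply: is_derive_continuous (df z _); apply: Dab.
- by exists c => //; apply: Dab; exact: subset_itv_oo_cc cab.
Qed.

Lemma derive0_constant f (D : set R) (a b : R) : is_interval D -> D a -> D b ->
  (forall x : R, D x -> is_derive x 1 f 0) -> f a = f b.
Proof.
move=> iD; wlog ab : a b / a < b => [h Da Db df|Da Db df].
  have [ab|ab|-> //] := ltgtP a b; first exact: h.
  by apply/esym; exact: h.
have [c _] := interval_MVT iD Da Db ab df.
by rewrite mul0r => /eqP; rewrite subr_eq0 => /eqP.
Qed.

Lemma derive_gt0_increasing f f' : (forall x : R, is_derive x 1 f (f' x)) ->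
  (forall x, 0 < f' x) -> {homo f : x y / x < y}.
Proof.
move=> df f'0 x y xy.
have iT : is_interval (@setT R) by [].
have [//|//|c _ E] := @interval_MVT f f' setT x y iT _ _ xy.
by rewrite -subr_gt0 E mulr_gt0 // subr_gt0.
Qed.

(** * Elementary functions are smooth *)

Lemma is_derive_inv (x : R) : x != 0 -> is_derive x 1 (@GRing.inv R) (- (x^-1 * x^-1)).
Proof.
move=> x0; have := @is_deriveV R id x 1 1 x0 (is_derive_id _ _).
by rewrite -exprVn expr2 /GRing.scale /= mulr1.
Qed.

Lemma open_neq0 : open [set x : R | x != 0].
Proof.
rewrite (_ : [set _ | _] = ~` [set 0]); first exact/closed_openC/closed_eq.
by apply/seteqP; split=> x /= /eqP.
Qed.

Lemma smooth_upto_inv k : smooth_upto k [set x : R | x != 0] (@GRing.inv R).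
Proof.
move: k; apply/smooth_onP; apply: (smooth_on_bootstrap open_neq0).
  exact: is_derive_inv.
move=> l sl; apply: smooth_uptoN; first exact: open_neq0.
by apply: smooth_uptoM => //; exact: open_neq0.
Qed.

Lemma smooth_upto_exp k : smooth_upto k setT (@expR R).
Proof.
move: k; apply/smooth_onP; exact: (smooth_on_bootstrap openT (g := @expR R)).
Qed.

Lemma smooth_upto_cos_sin k : smooth_upto k setT (@cos R) /\ smooth_upto k setT (@sin R).
Proof.
elim: k => [|k [cs sn]].
  split; case=> [|//] x _ _; apply/derivable1_diffP; first exact: derivable_cos.
  exact: derivable_sin.
split; last exact: (smooth_upto_line openT (g := @cos R)).
apply: (smooth_upto_line openT (g := fun x => - sin x)).
by apply: smooth_uptoN => //; exact: openT.
Qed.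

Lemma open_gt0 : open [set x : R | 0 < x].
Proof. exact: open_gt. Qed.

Lemma smooth_upto_sqrt1 k : smooth_upto k [set x : R | 0 < x] (@Num.sqrt R).
Proof.
move: k; apply/smooth_onP; apply: (smooth_on_bootstrap open_gt0) => l sl.
apply: (smooth_upto_comp (U' := [set x : R | x != 0])).
- exact: open_gt0.
- exact: open_neq0.
- by move=> x /= x0; rewrite mulf_neq0 // gt_eqF // sqrtr_gt0.
- exact: smooth_upto_inv.
- by apply: (smooth_uptoM open_gt0) => //; exact: smooth_upto_cst.
Qed.

Section composites.
Variables (V : normedModType R) (U : set V).
Hypothesis oU : open U.
Implicit Type h : V -> R.

Lemma smooth_uptoV k h : (forall x, U x -> h x != 0) -> smooth_upto k U h ->
  smooth_upto k U (fun x => (h x)^-1).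
Proof.
move=> h0; apply: (smooth_upto_comp oU open_neq0) => //.
exact: smooth_upto_inv.
Qed.

Lemma smooth_upto_div k h1 h2 : (forall x, U x -> h2 x != 0) ->
  smooth_upto k U h1 -> smooth_upto k U h2 -> smooth_upto k U (fun x => h1 x / h2 x).
Proof. by move=> h0 s1 s2; apply: smooth_uptoM => //; exact: smooth_uptoV. Qed.

Lemma smooth_upto_sqrt k h : (forall x, U x -> 0 < h x) -> smooth_upto k U h ->
  smooth_upto k U (fun x => Num.sqrt (h x)).
Proof.
move=> h0; apply: (smooth_upto_comp oU open_gt0) => //.
exact: smooth_upto_sqrt1.
Qed.

Lemma smooth_upto_line_comp k f h : smooth_upto k setT f -> smooth_upto k U h ->
  smooth_upto k U (fun x => f (h x)).
Proof. exact: (smooth_upto_comp oU openT). Qed.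

Lemma smooth_uptoX k h m : smooth_upto k U h -> smooth_upto k U (fun x => h x ^+ m).
Proof.
move=> sh; elim: m => [|m IH]; first exact: smooth_upto_cst.
apply: (smooth_upto_eq oU) (smooth_uptoM oU sh IH) => x _.
by rewrite exprS.
Qed.

End composites.

(** The inverse g satisfies g' = 1 / f'(g), so that its smoothness follows by
bootstrapping; the range is open because f is increasing and continuous. *)
Lemma smooth_inverse f f' : (forall x : R, is_derive x 1 f (f' x)) ->
  (forall x, 0 < f' x) -> (forall k, smooth_upto k setT f') ->
  exists g, [/\ forall x, g (f x) = x,
    open (range f), is_interval (range f),
    forall t, range f t -> f (g t) = t /\ is_derive t 1 g (f' (g t))^-1 &
    forall k, smooth_upto k (range f) g].
Proof.
move=> df f'0 sf'; have inc := derive_gt0_increasing df f'0.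
have cf : continuous f by move=> x; exact: is_derive_continuous (df x).
have finj : injective f.
  move=> x y; have [/inc|/inc|//] := ltgtP x y; first by move/lt_eqF=> /eqP.
  by move/gt_eqF=> /eqP.
pose g t := xget 0 [set x | f x = t].
have gK x : g (f x) = x.
  by apply: finj; rewrite /g; case: xgetP => [y _ //|/(_ x) nE]; case: nE.
have fK t : range f t -> f (g t) = t by case=> x _ <-; rewrite gK.
have itv : is_interval (range f).
  apply/connected_intervalP/connected_continuous_connected.
    by apply/connected_intervalP.
  exact: continuous_subspaceT.
have op : open (range f).
  rewrite openE => t [x _ <-]; rewrite /interior.
  have xl : f (x - 1) < f x by apply: inc; rewrite ltrBlDr ltrDl.
  have xr : f x < f (x + 1) by apply: inc; rewrite ltrDl.
  have : \forall z \near f x, f (x - 1) < z < f (x + 1).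
    by near=> z; apply/andP; split; near: z; [exact: lt_nbhsr|exact: lt_nbhsl].
  apply: filterS => z /andP[z1 z2].
  by apply: (is_interval_cc itv (a := f (x - 1)) (b := f (x + 1)));
    [exists (x - 1)|exists (x + 1)|rewrite !ltW].
have dg t : range f t -> is_derive t 1 g (f' (g t))^-1.
  case=> x _ <-; rewrite gK; apply: is_derive_inverse.
  - by near=> z; exact: gK.
  - by near=> z; exact: cf.
  - by rewrite gt_eqF.
exists g; split => //.
  by move=> t rt; split; [exact: fK|exact: dg].
apply/smooth_onP.
apply: (@smooth_on_bootstrap _ _ g (fun t => (f' (g t))^-1) op dg) => k sg.
apply: (smooth_uptoV op) => [t _|]; first by rewrite gt_eqF.
exact: (smooth_upto_line_comp op).
Unshelve. all: by end_near.
Qed.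

(** * Oriented integrals *)

(** The fundamental theorem of calculus; exchanging the bounds changes the sign of
both sides. *)
Lemma oriented_integral_primitive f F (D : set R) (a b : R) : is_interval D -> D a -> D b ->
  (forall x : R, D x -> is_derive x 1 F (f x)) ->
  (forall x, D x -> {for x, continuous f}) ->
  oriented_integral f a b = F b - F a.
Proof.
move=> iD + + dF cf; have main c d : D c -> D d -> c < d ->
    \int[lebesgue_measure]_(t in `[c, d]) f t = F d - F c.
  move=> Dc Dd cd.
  have Dcd x : x \in `[c, d] -> D x.
    by rewrite in_itv /=; exact: is_interval_cc.
  have cF x : x \in `[c, d] -> {for x, continuous F}.
    by move=> /Dcd /dF; exact: is_derive_continuous.
  rewrite /Rintegral (continuous_FTC2 cd (F := F)) //.
  - by apply: within_continuous => x xcd; apply: cf; exact: Dcd.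
  - split.
    + by move=> x xcd; have [] := dF x (Dcd _ (subset_itv_oo_cc xcd)).
    + apply: cvg_at_right_filter; apply: cF.
      by rewrite in_itv /= lexx ltW.
    + apply: cvg_at_left_filter; apply: cF.
      by rewrite in_itv /= lexx ltW.
  - move=> x xcd; rewrite derive1E.
    by have [] := dF x (Dcd _ (subset_itv_oo_cc xcd)).
move=> Da Db; rewrite /oriented_integral; have [ab|ab|<-] := ltgtP a b.
- exact: main.
- by rewrite main // opprB.
- by rewrite set_itv1 Rintegral_set1 subrr.
Qed.

(** Integrals in both orientations are differences of integrals from one point
to the left of c and x. *)
Lemma is_derive_oriented_integral f (c x : R) : continuous f ->
  is_derive x 1 (fun y => oriented_integral f c y) (f x).
Proof.
move=> cf; pose a := Num.min c x - 1.
have ac : a < c by rewrite /a ltrBlDr (@le_lt_trans _ _ c) ?ge_min ?lexx // ltrDl.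
have ax : a < x by rewrite /a ltrBlDr (@le_lt_trans _ _ x) ?ge_min ?lexx ?orbT // ltrDl.
have intf u v : lebesgue_measure.-integrable `[u, v] (EFin \o f).
  apply: continuous_compact_integrable; first exact: segment_compact.
  exact: continuous_subspaceT.
pose F y := \int[lebesgue_measure]_(t in `[a, y]) f t.
have dF : is_derive x 1 F (f x).
  have [] := @continuous_FTC1_closed R f a x (x + 1) _ (intf _ _) ax (cf x).
    by rewrite ltrDl.
  by move=> d1 d2; apply: (DeriveDef d1); rewrite -derive1E d2.
have split_at u v : a < u -> u <= v ->
    \int[lebesgue_measure]_(t in `[u, v]) f t = F v - F u.
  move=> au uv; rewrite /F Rintegral_itvB ?bnd_simp // ?ltW //.
  rewrite Rintegral_itv_obnd_cbnd //.
  apply: integrableS (intf u v) => //.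
  exact: subset_itv_oc_cc.
have near_eq : \forall y \near x, F y - F c = oriented_integral f c y.
  have : \forall y \near x, a < y by exact: lt_nbhsr.
  apply: filterS => y ay; rewrite /oriented_integral.
  have [cy|yc] := leP c y; first by rewrite split_at.
  by rewrite split_at // ?ltW // opprB.
apply: near_eq_is_derive near_eq _.
by rewrite -[f x]subr0; apply: is_deriveB.
Qed.

Lemma oriented_integral_id f (c : R) : oriented_integral f c c = 0.
Proof. by rewrite /oriented_integral lexx set_itv1 Rintegral_set1. Qed.

End one_variable.

(** * The difference quotient of the exponential *)

Section exponential_quotient.
Variable R : realType.

(** The coefficients of the m-th formal derivative of the series of
x^n / (n + 1)!; all are dominated by those of the exponential. *)
Let c (m : nat) : R^nat := iter m (@pseries_diffs R) (fun n => (n.+1)`!%:R^-1).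

Let c_bounds m n : 0 <= c m n <= n`!%:R^-1.
Proof.
elim: m n => [|m IH] n /=.
  rewrite /c /= invr_ge0 ler0n /= lef_pV2 ?posrE ?ltr0n ?fact_gt0 //.
  by rewrite ler_nat factS leq_pmull.
rewrite /c /= /pseries_diffs -/(c m n.+1) mulr_ge0 ?(proj1 (andP (IH _))) //=.
have /andP[_] := IH n.+1; rewrite -(ler_pM2l (ltr0Sn R n)) => /le_trans; apply.
by rewrite factS natrM invfM mulVKf.
Qed.

Let c_cvg m (x : R) : 0 < x -> cvgn (pseries (c m) x).
Proof.
move=> x0; rewrite /pseries.
apply: (@series_le_cvg _ _ (exp_coeff x)) => [n|n|n|].
- by rewrite mulr_ge0 ?exprn_ge0 ?(ltW x0) //; have /andP[] := c_bounds m n.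
- by rewrite exp_coeff_ge0 // ltW.
- rewrite exp_coeffE ler_wpM2r ?exprn_ge0 ?(ltW x0) //.
  by have /andP[] := c_bounds m n.
- exact: is_cvg_series_exp_coeff.
Qed.

Let f m (x : R) : R := limn (pseries (c m) x).

Let is_derive_f m (x : R) : is_derive x 1 (f m) (f m.+1 x).
Proof.
have x1 : 0 < `|x| + 1 by rewrite ltr_pwDr.
have xl : `|x| < `|(`|x| + 1)| by rewrite [ltRHS]gtr0_norm // ltrDl.
have cS l : c l.+1 = pseries_diffs (c l) by [].
have c1 := @c_cvg m.+1 _ x1; have c2 := @c_cvg m.+2 _ x1.
rewrite /f !cS in c1 c2 *.
exact: (pseries_snd_diffs (@c_cvg m _ x1) c1 c2 xl).
Qed.

Let smooth_f k m : smooth_upto k setT (f m).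
Proof.
elim: k m => [|k IH] m.
  case=> [|//] x _ _; have [df _] := is_derive_f m x.
  exact/derivable1_diffP.
exact: (smooth_upto_line openT (fun x _ => is_derive_f m x)).
Qed.

(** The quotient (e^x - 1) / x is the sum of an everywhere convergent power
series, which takes the place of the quotient at the origin. *)
Lemma exp_difference_quotient :
  exists E : R -> R, (forall k, smooth_upto k setT E) /\ forall x, expR x = 1 + x * E x.
Proof.
exists (f 0%N); split=> // x.
have [->|x0] := eqVneq x 0; first by rewrite expR0 mul0r addr0.
have cx : cvgn (pseries (c 0) x).
  apply: (@is_cvg_pseries_inside _ _ (`|x| + 1)).
    by apply: c_cvg; rewrite ltr_pwDr.
  by rewrite [ltRHS]gtr0_norm ?ltr_pwDr // ltrDl.
have h : (series (exp_coeff x) n.+1 @[n --> \oo]) --> 1 + x * f 0 x.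
  rewrite (_ : (fun n => _) = (fun n => 1 + x * pseries (c 0) x n)).
    by apply: cvgD; [exact: cvg_cst|apply: cvgMr; exact: cx].
  apply/funext => n; rewrite /pseries /series /= big_nat_recl //.
  rewrite {1}exp_coeffE /= fact0 invr1 expr0 mulr1; congr (_ + _).
  rewrite big_distrr; apply: eq_bigr => i _ /=.
  by rewrite exp_coeffE /c /= exprS mulrCA.
by rewrite /expR; apply/cvg_lim => //; rewrite -cvg_shiftS; exact: h.
Qed.

End exponential_quotient.

(** * Coordinates and directional derivatives *)

Section coordinates.
Variables (R : realType) (V : normedModType R) (U : set V).
Hypothesis oU : open U.

Lemma smooth_upto_coord k m n (X : V -> 'M[R]_(m, n)) i j :
  smooth_upto k U X -> smooth_upto k U (fun x => X x i j).
Proof.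
elim: k X => [|k IH] X sX.
  case=> [|//] x _ Ux.
  apply: (@differentiable_comp _ _ _ _ X (fun N : 'M[R]_(m, n) => N i j)).
    exact: smooth_upto_diff sX Ux.
  exact: differentiable_coord.
apply: smooth_uptoS => [x Ux|v].
  apply: (@differentiable_comp _ _ _ _ X (fun N : 'M[R]_(m, n) => N i j)).
    exact: smooth_upto_diff sX Ux.
  exact: differentiable_coord.
apply: (smooth_upto_eq oU) (IH _ (smooth_upto_derive v sX)) => x Ux.
by rewrite derive_mx ?mxE //; exact: smooth_upto_derivable sX Ux.
Qed.

Lemma smooth_upto_mx k m n (X : V -> 'M[R]_(m, n)) :
  (forall i j, smooth_upto k U (fun x => X x i j)) -> smooth_upto k U X.
Proof.
move=> sX.
apply: (smooth_upto_eq oU (f := fun x => \sum_i \sum_j X x i j *: delta_mx i j)).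
  by move=> x _; rewrite -matrix_sum_delta.
apply: smooth_upto_sum => // i; apply: smooth_upto_sum => // j.
exact: smooth_uptoZl.
Qed.

End coordinates.

Lemma smooth_upto_proj (R : realType) k m n (U : set 'M[R]_(m, n)) i j : open U ->
  smooth_upto k U (fun M : 'M[R]_(m, n) => M i j).
Proof.
move=> oU; elim: k => [|k IH].
  by case=> [|//] x _ _; exact: differentiable_coord.
have idD (v x : 'M[R]_(m, n)) : is_derive x v (fun M : 'M[R]_(m, n) => M i j) (v i j).
  have dx : derivable (id : 'M[R]_(m, n) -> _) x v by exact: derivable_id.
  have D : derivable (fun M : 'M[R]_(m, n) => M i j) x v.
    exact: (proj1 (derivable_mxP id x v) dx).
  apply: (DeriveDef D).
  by have := derive_mx dx; rewrite derive_id => /matrixP/(_ i j); rewrite mxE => <-.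
apply: (@smooth_uptoS_is_derive R k 'M[R]_(m, n) R U (fun M => M i j)
    (fun v _ => v i j) oU).
- by move=> x _; exact: differentiable_coord.
- by move=> v; exact: smooth_upto_cst.
Qed.

Section directional_calculus.
Variables (R : realType) (V : normedModType R).
Implicit Types (f g : V -> R) (x v : V).

Lemma is_derive_unique f x v (d e : R) : is_derive x v f d -> is_derive x v f e -> d = e.
Proof. by move=> [_ <-] [_ <-]. Qed.

Lemma is_deriveDf f g x v (d e : R) : is_derive x v f d -> is_derive x v g e ->
  is_derive x v (fun q => f q + g q) (d + e).
Proof. exact: is_deriveD. Qed.

Lemma is_deriveBf f g x v (d e : R) : is_derive x v f d -> is_derive x v g e ->
  is_derive x v (fun q => f q - g q) (d - e).
Proof. exact: is_deriveB. Qed.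

Lemma is_deriveNf f x v (d : R) : is_derive x v f d ->
  is_derive x v (fun q => - f q) (- d).
Proof. exact: is_deriveN. Qed.

Lemma is_deriveMf f g x v (d e : R) : is_derive x v f d -> is_derive x v g e ->
  is_derive x v (fun q => f q * g q) (d * g x + f x * e).
Proof.
move=> df dg; apply: is_derive_eq (is_deriveM df dg) _.
by rewrite /GRing.scale /= addrC mulrC [f x * e]mulrC mulrC [e * _]mulrC.
Qed.

Lemma is_deriveCf x v (c : R) : is_derive x v (fun=> c) 0.
Proof. exact: is_derive_cst. Qed.

Lemma is_deriveVf f x v (d : R) : f x != 0 -> is_derive x v f d ->
  is_derive x v (fun q => (f q)^-1) (- (d / f x ^+ 2)).
Proof.
move=> fx0 df; apply: is_derive_eq (is_derive_comp1 (is_derive_inv fx0) df) _.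
by field.
Qed.

Lemma is_derive_sumf (I : Type) (s : seq I) (h : I -> V -> R) x v (d : I -> R) :
  (forall i, is_derive x v (h i) (d i)) ->
  is_derive x v (fun q => \sum_(i <- s) h i q) (\sum_(i <- s) d i).
Proof.
move=> dh; elim: s => [|i s IH].
  rewrite big_nil (_ : (fun _ => _) = fun=> 0); first exact: is_deriveCf.
  by apply/funext => q; rewrite big_nil.
rewrite big_cons (_ : (fun _ => _) = fun q => h i q + \sum_(j <- s) h j q).
  exact: is_deriveDf.
by apply/funext => q; rewrite big_cons.
Qed.

Lemma is_derive_prodf (I : Type) (s : seq I) (h : I -> V -> R) x v (d : I -> R) :
  (forall i, h i x != 0) -> (forall i, is_derive x v (h i) (d i)) ->
  is_derive x v (fun q => \prod_(i <- s) h i q)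
    (\prod_(i <- s) h i x * \sum_(i <- s) d i / h i x).
Proof.
move=> h0 dh; elim: s => [|i s IH].
  rewrite big_nil (_ : (fun _ => _) = fun=> 1).
    by rewrite big_nil mulr0; exact: is_deriveCf.
  by apply/funext => q; rewrite big_nil.
rewrite !big_cons (_ : (fun _ => _) = fun q => h i q * \prod_(j <- s) h j q).
  apply: is_derive_eq (is_deriveMf (dh i) IH) _.
  by field; exact: h0.
by apply/funext => q; rewrite big_cons.
Qed.

Lemma is_derive_expf f x v (d : R) : is_derive x v f d ->
  is_derive x v (fun q => expR (f q)) (expR (f x) * d).
Proof. by move=> df; apply: is_derive_comp1 df. Qed.

Lemma is_derive_cosf f x v (d : R) : is_derive x v f d ->
  is_derive x v (fun q => cos (f q)) (- sin (f x) * d).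
Proof. by move=> df; apply: is_derive_comp1 df. Qed.

Lemma is_derive_sinf f x v (d : R) : is_derive x v f d ->
  is_derive x v (fun q => sin (f q)) (cos (f x) * d).
Proof. by move=> df; apply: is_derive_comp1 df. Qed.

Lemma is_derive_sqrtf f x v (d : R) : 0 < f x -> is_derive x v f d ->
  is_derive x v (fun q => Num.sqrt (f q)) (d / (2 * Num.sqrt (f x))).
Proof.
move=> f0 df; have ds := is_derive1_sqrt f0.
by apply: is_derive_eq (is_derive_comp1 ds df) _; rewrite mulrC.
Qed.

End directional_calculus.

(** * The function P and the key identity *)

Section profile.
Variables (R : realType) (n : nat) (alpha : R) (a : 'I_n -> R).
Hypotheses (n_gt0 : (0 < n)%N) (alpha_ge0 : 0 <= alpha) (a_gt0 : forall j, 0 < a j).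
Implicit Types (y v : R) (j : 'I_n).

(** The numerator of P(t) is N(t^2) - 1. *)
Definition profile_N v := \prod_(k < n) (1 + a k * v) * expR (alpha * v).

(** The logarithmic derivative of [profile_N] at y^2. *)
Definition profile_Lambda y := alpha + \sum_(k < n) ((a k)^-1 + y ^+ 2)^-1.

Local Notation P := (P_fun alpha a).

(** The functions equal to 1 at the origin, with smooth difference quotient
there, are closed under products, so that the numerator of [P_fun] is divisible
by its denominator among smooth functions. *)
Lemma profile_N_quotient :
  exists q : R -> R, (forall k, smooth_upto k setT q) /\
    forall v, profile_N v = 1 + v * q v.
Proof.
have prodq (s : seq 'I_n) : exists q : R -> R, (forall k, smooth_upto k setT q) /\
    forall v, \prod_(k <- s) (1 + a k * v) = 1 + v * q v.
  elim: s => [|i s [q [sq qE]]].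
    exists (fun=> 0); split=> [k|v]; first exact: smooth_upto_cst.
    by rewrite big_nil mulr0 addr0.
  exists (fun v => q v + a i + v * (a i * q v)); split=> [k|v].
    apply: (smooth_uptoD openT); first apply: (smooth_uptoD openT) => //.
      exact: smooth_upto_cst.
    apply: (smooth_uptoM openT); first exact: (smooth_upto_id openT).
    by apply: (smooth_uptoM openT) => //; exact: smooth_upto_cst.
  by rewrite big_cons qE; ring.
have [q [sq qE]] := prodq (index_enum 'I_n).
have [E [sE EE]] := exp_difference_quotient R.
exists (fun v => q v + alpha * E (alpha * v) + v * (q v * (alpha * E (alpha * v)))).
have sE' k : smooth_upto k setT (fun v => alpha * E (alpha * v)).
  apply: (smooth_uptoM openT); first exact: smooth_upto_cst.
  apply: (smooth_upto_line_comp openT) => //.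
  apply: (smooth_uptoM openT); first exact: smooth_upto_cst.
  exact: (smooth_upto_id openT).
split=> [k|v].
  apply: (smooth_uptoD openT); first by apply: (smooth_uptoD openT).
  apply: (smooth_uptoM openT); first exact: (smooth_upto_id openT).
  exact: (smooth_uptoM openT).
by rewrite /profile_N qE EE; ring.
Qed.

Lemma onePaM_gt0 j v : 0 <= v -> 0 < 1 + a j * v.
Proof. by move=> v0; rewrite ltr_pwDl // mulr_ge0 // ltW. Qed.

Lemma profile_N_gt0 v : (forall j, 0 < 1 + a j * v) -> 0 < profile_N v.
Proof. by move=> h; rewrite mulr_gt0 ?expR_gt0 // prodr_gt0. Qed.

Lemma is_derive_profile_N v : (forall j, 0 < 1 + a j * v) ->
  is_derive v 1 profile_N
    (profile_N v * (alpha + \sum_(k < n) a k / (1 + a k * v))).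
Proof.
move=> h.
have dlin b c : is_derive v 1 (fun v => c + b * v) b.
  apply: is_derive_eq
    (is_deriveDf (is_deriveCf v 1 c) (is_deriveMf (is_deriveCf v 1 b) (is_derive_id v 1))) _.
  by rewrite mul0r !add0r mulr1.
have dprod : is_derive v 1 (fun v => \prod_(k < n) (1 + a k * v)) _ :=
  @is_derive_prodf R R 'I_n (index_enum 'I_n) (fun k v => 1 + a k * v) v 1 a
    (fun k => lt0r_neq0 (h k)) (fun k => dlin (a k) 1).
have dexp : is_derive v 1 (fun v => expR (alpha * v)) (expR (alpha * v) * alpha).
  apply: is_derive_expf; have := dlin alpha 0.
  by rewrite (_ : (fun _ => _) = fun v => alpha * v) //; apply/funext => z; rewrite add0r.
apply: is_derive_eq (is_deriveMf dprod dexp) _.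
by rewrite /profile_N; ring.
Qed.

Lemma profile_N_derive0 q : (forall k, smooth_upto k setT q) ->
  (forall v, profile_N v = 1 + v * q v) -> q 0 = \sum_(k < n) a k + alpha.
Proof.
move=> sq qE.
have dq : is_derive (0 : R) 1 q ('D_1 q 0).
  by apply: derivableP; exact: (@smooth_upto_derivable R 0 R R setT q 0 1 (sq 0%N)).
have h0 j : 0 < 1 + a j * 0 by rewrite mulr0 addr0.
have := is_derive_profile_N h0.
rewrite (_ : profile_N = fun v => 1 + v * q v); last exact/funext.
have D := is_deriveDf (is_deriveCf (0 : R) (1 : R) (1 : R)) (is_deriveMf (is_derive_id (0 : R) (1 : R)) dq).
move=> /is_derive_unique -/(_ _ D).
rewrite !mul0r !addr0 !add0r mul1r mul1r => <-; rewrite addrC; congr (_ + _).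
by apply: eq_bigr => k _; rewrite mulr0 addr0 divr1.
Qed.

Lemma P_fun_quotient : exists q : R -> R,
  [/\ forall k, smooth_upto k setT q, forall v, profile_N v = 1 + v * q v &
      forall y, P y = q (y ^+ 2)].
Proof.
have [q [sq qE]] := profile_N_quotient; exists q; split=> // y.
rewrite /P_fun; case: eqP => [->|/eqP y0].
  by rewrite expr0n /= (profile_N_derive0 sq qE).
rewrite -[_ * expR _]/(profile_N (y ^+ 2)) qE; field.
by [].
Qed.

Lemma P_funE y : profile_N (y ^+ 2) = 1 + y ^+ 2 * P y.
Proof. by have [q [_ qE ->]] := P_fun_quotient. Qed.

Lemma P_fun0 : P 0 = profile_Lambda 0.
Proof.
rewrite /P_fun eqxx /profile_Lambda addrC; congr (_ + _).
by apply: eq_bigr => k _; rewrite expr0n addr0 invrK.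
Qed.

Lemma smooth_upto_P k : smooth_upto k setT P.
Proof.
have [q [sq _ qE]] := P_fun_quotient.
rewrite (_ : P = fun y => q (y ^+ 2)); last exact/funext.
apply: (smooth_upto_line_comp openT) => //.
by apply: (smooth_uptoX openT); exact: (smooth_upto_id openT).
Qed.

Lemma profile_N_ge j v : 0 <= v -> 1 + a j * v <= profile_N v.
Proof.
move=> v0; rewrite /profile_N (bigD1 j) //= -mulrA ler_peMr //.
  by rewrite ltW // onePaM_gt0.
rewrite -[leLHS]mulr1 ler_pM //; last first.
  by rewrite -expR0 ler_expR mulr_ge0.
apply: (big_ind (fun z => 1 <= z)) => // [x z x1 z1|k _].
  by rewrite -[leLHS]mulr1 ler_pM.
by rewrite lerDl mulr_ge0 // ltW.
Qed.

(** Keeping one factor of the product in the numerator of P. *)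
Lemma P_fun_ge j y : a j <= P y.
Proof.
have [->|y0] := eqVneq y 0.
  rewrite /P_fun eqxx (bigD1 j) //= -addrA lerDl addr_ge0 // sumr_ge0 // => k _.
  exact: ltW.
have y2 : 0 < y ^+ 2 by rewrite exprn_even_gt0.
have := profile_N_ge j (ltW y2); rewrite P_funE lerD2l mulrC.
by rewrite ler_pM2l.
Qed.

Lemma P_fun_gt0 y : 0 < P y.
Proof. exact: lt_le_trans (a_gt0 (Ordinal n_gt0)) (P_fun_ge _ _). Qed.

(** [profile_p y] is the imaginary part of the number y + i P(y)^(-1/2), whose
argument enters the Lagrangian angle. *)
Definition profile_p y := (Num.sqrt (P y))^-1.
Definition profile_dp y := 'D_1 profile_p y.

Local Notation p := profile_p.
Local Notation dp := profile_dp.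
Local Notation Lambda := profile_Lambda.

Lemma profile_p_gt0 y : 0 < p y.
Proof. by rewrite invr_gt0 sqrtr_gt0 P_fun_gt0. Qed.

Lemma profile_p_sqr y : p y ^+ 2 * P y = 1.
Proof.
by rewrite exprVn sqr_sqrtr ?(ltW (P_fun_gt0 y)) // mulVf // gt_eqF // P_fun_gt0.
Qed.

Lemma smooth_upto_p k : smooth_upto k setT p.
Proof.
apply: (smooth_uptoV openT) => [y _|]; first by rewrite gt_eqF // sqrtr_gt0 P_fun_gt0.
apply: (smooth_upto_sqrt openT) => [y _|]; first exact: P_fun_gt0.
exact: smooth_upto_P.
Qed.

Lemma is_derive_p y : is_derive y 1 p (dp y).
Proof. by apply: derivableP; exact: (@smooth_upto_derivable R 0 R R setT p y 1 (@smooth_upto_p 0)). Qed.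

Lemma profile_N_p y : profile_N (y ^+ 2) * p y ^+ 2 = y ^+ 2 + p y ^+ 2.
Proof. by rewrite P_funE; have := profile_p_sqr y; nra. Qed.

(** The square of [r_fun]. *)
Definition rsq j y := (a j)^-1 + y ^+ 2.

Lemma rsq_gt0 j y : 0 < rsq j y.
Proof. by rewrite ltr_pwDl ?invr_gt0 // sqr_ge0. Qed.

Lemma rsq_neq0 j y : rsq j y != 0.
Proof. by rewrite gt_eqF // rsq_gt0. Qed.

Lemma rsqE j y : rsq j y = (1 + a j * y ^+ 2) / a j.
Proof. by rewrite /rsq; field; rewrite gt_eqF. Qed.

Lemma is_derive_sqr (y : R) : is_derive y 1 (fun y => y ^+ 2) (2 * y).
Proof.
have := is_deriveMf (is_derive_id y 1) (is_derive_id y 1).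
rewrite (_ : (fun q => id q * id q) = fun y => y ^+ 2).
  by move/is_derive_eq; apply; rewrite /=; ring.
by apply/funext => z; rewrite expr2.
Qed.

Lemma is_derive_rsq j y : is_derive y 1 (rsq j) (2 * y).
Proof.
apply: is_derive_eq (is_deriveDf (is_deriveCf y 1 (a j)^-1) (is_derive_sqr y)) _.
by rewrite add0r.
Qed.

(** The identity behind the derivative of the angle and the mean curvature of L.
It results from differentiating y^2 + p^2 = N(y^2) p^2, where N has logarithmic
derivative [profile_Lambda].  At y = 0 the derivative says nothing, and the
identity is the choice of the value P(0). *)
Lemma profile_identity y :
  p y - y * dp y = (y ^+ 2 + p y ^+ 2) * p y * Lambda y.
Proof.
have p0 := profile_p_gt0 y.
have [y0|yn0] := eqVneq y 0.
  have := profile_p_sqr y; rewrite y0 P_fun0 => e.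
  by rewrite expr0n /= add0r mul0r subr0 mulrAC e mul1r.
have h j : 0 < 1 + a j * y ^+ 2 by rewrite onePaM_gt0 // sqr_ge0.
have LE : alpha + \sum_(k < n) a k / (1 + a k * y ^+ 2) = Lambda y.
  congr (_ + _); apply: eq_bigr => k _.
  by rewrite -/(rsq k y) rsqE invf_div.
have dN := @is_derive_comp1 R R profile_N (fun z => z ^+ 2) y 1 _ _
  (is_derive_profile_N h) (is_derive_sqr y).
have dp2 := is_deriveMf (is_derive_p y) (is_derive_p y).
have dL := is_deriveMf dN dp2.
have dR := is_deriveDf (is_derive_sqr y) dp2.
rewrite LE in dL.
rewrite (_ : (fun q => profile_N (q ^+ 2) * (p q * p q)) = (fun q => q ^+ 2 + p q * p q)) in dL;
  last by apply/funext => z; rewrite -expr2 profile_N_p.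
have /= E := is_derive_unique dL dR.
have NE := profile_N_p y.
apply: (mulfI yn0); apply: (mulIf (lt0r_neq0 p0)).
move: E NE; set N := profile_N _; set q := p y; set d := dp y; set L := Lambda y.
move=> E NE.
have E1 : N * L * y * q ^+ 2 = y + q * d - N * q * d.
  apply: (mulfI (_ : 2 != 0 :> R)); first by rewrite pnatr_eq0.
  by move: E; rewrite expr2; lra.
rewrite -NE -[RHS]/(y * (N * q ^+ 2 * q * L) * q).
transitivity (q ^+ 2 * (N * L * y * q ^+ 2)); last by ring.
rewrite E1; transitivity (q ^+ 2 * y + q ^+ 3 * d - q * d * (N * q ^+ 2)); last by ring.
by rewrite NE; ring.
Qed.

End profile.

(** * Moduli and phases of the curves *)

Local Open Scope complex_scope.

Section curves.
Variables (R : realType) (n : nat) (alpha : R) (a psi : 'I_n -> R).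
Hypotheses (n_gt0 : (0 < n)%N) (alpha_ge0 : 0 <= alpha) (a_gt0 : forall j, 0 < a j).
Implicit Types (y : R) (j : 'I_n).

Local Notation P := (P_fun alpha a).
Local Notation p := (profile_p alpha a).
Local Notation dp := (profile_dp alpha a).
Local Notation Lambda := (profile_Lambda alpha a).
Local Notation rsq := (rsq a).
Local Notation phi := (phi_fun alpha a psi).
Local Notation theta := (theta_fun alpha a psi).
Local Notation w := (w_fun alpha a psi).

Let p_gt0 := profile_p_gt0 n_gt0 alpha_ge0 a_gt0.
Let rsq_gt0 := rsq_gt0 a_gt0.
Let rsq_neq0 := rsq_neq0 a_gt0.
Let is_derive_p := is_derive_p n_gt0 alpha_ge0 a_gt0.

Lemma is_derive_phi j y : is_derive y 1 (phi j) (p y / rsq j y).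
Proof.
have sf : smooth_upto 0 setT
    (fun t : R => (((a j)^-1 + t ^+ 2) * Num.sqrt (P t))^-1).
  apply: (smooth_uptoV openT) => [t _|].
    by rewrite mulf_neq0 ?gt_eqF ?rsq_gt0 // sqrtr_gt0 P_fun_gt0.
  apply: (smooth_uptoM openT).
    apply: (smooth_uptoD openT); first exact: smooth_upto_cst.
    by apply: (smooth_uptoX openT); exact: (smooth_upto_id openT).
  apply: (smooth_upto_sqrt openT) => [t _|]; first exact: P_fun_gt0.
  exact: smooth_upto_P.
have cf : continuous (fun t : R => (((a j)^-1 + t ^+ 2) * Num.sqrt (P t))^-1).
  move=> t; apply: differentiable_continuous.
  exact: smooth_upto_diff sf _.
apply: is_derive_eq
  (is_deriveDf (is_deriveCf y 1 (psi j)) (is_derive_oriented_integral 0 y cf)) _.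
by rewrite add0r invfM mulrC.
Qed.

Lemma phi_fun0 j : phi j 0 = psi j.
Proof. by rewrite /phi_fun oriented_integral_id addr0. Qed.

Lemma smooth_upto_rsq k j : smooth_upto k setT (rsq j).
Proof.
apply: (smooth_uptoD openT); first exact: smooth_upto_cst.
by apply: (smooth_uptoX openT); exact: (smooth_upto_id openT).
Qed.

Lemma smooth_upto_dphi k j : smooth_upto k setT (fun y => p y / rsq j y).
Proof.
apply: (smooth_upto_div openT) => [y _||]; first exact: rsq_neq0.
  exact: smooth_upto_p.
exact: smooth_upto_rsq.
Qed.

Lemma smooth_upto_phi k j : smooth_upto k setT (phi j).
Proof.
apply: (smooth_uptoW (leqnSn k)).
exact: (smooth_upto_line openT (fun y _ => is_derive_phi j y) (smooth_upto_dphi j)).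
Qed.

Lemma phi_increasing j : {homo phi j : x y / x < y}.
Proof.
apply: derive_gt0_increasing (is_derive_phi j) _ => y.
by rewrite divr_gt0 ?rsq_gt0.
Qed.

(** Since P >= a_j, the phases turn more slowly than they do along a straight
line, for which they are arctangents. *)
Lemma phi_increment_le_atan j x y : x <= y ->
  phi j y - phi j x <= atan (Num.sqrt (a j) * y) - atan (Num.sqrt (a j) * x).
Proof.
rewrite le_eqVlt => /orP[/eqP ->|xy]; first by rewrite !subrr.
set s := Num.sqrt (a j); have s0 : 0 < s by rewrite sqrtr_gt0.
have s2 : s ^+ 2 = a j by rewrite sqr_sqrtr // ltW.
have D (z : R) : is_derive z 1 (fun z => atan (s * z) - phi j z)
    (s / (1 + a j * z ^+ 2) - p z / rsq j z).
  apply: is_deriveBf; last exact: is_derive_phi.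
  have ds : is_derive z 1 (fun z => s * z) s.
    apply: is_derive_eq (is_deriveMf (is_deriveCf z 1 s) (is_derive_id z 1)) _.
    by rewrite mul0r add0r mulr1.
  apply: is_derive_eq (is_derive_comp1 (is_derive1_atan (s * z)) ds) _.
  by rewrite exprMn s2 mulrC.
have iT : is_interval (@setT R) by [].
have [c _ E] := interval_MVT iT I I xy (fun z _ => D z).
suff : 0 <= s / (1 + a j * c ^+ 2) - p c / rsq j c.
  move=> h; have : 0 <= (s / (1 + a j * c ^+ 2) - p c / rsq j c) * (y - x).
    by rewrite mulr_ge0 // subr_ge0 ltW.
  by rewrite -E; lra.
rewrite subr_ge0 rsqE // invf_div mulrA ler_pM2r ?invr_gt0 ?onePaM_gt0 ?sqr_ge0 //.
rewrite -s2 expr2 mulrA ler_piMl ?(ltW s0) // ler_pdivrMl ?sqrtr_gt0 ?P_fun_gt0 //.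
rewrite mulr1 /s ler_sqrt; first exact: P_fun_ge.
by rewrite ltW // P_fun_gt0.
Qed.

(** Each w_j e^(- i psi_j) stays in the open right half-plane, so that the sign of
x_j and the phase phi_j can be read off from x_j w_j. *)
Lemma phi_range j y : - (pi / 2) < phi j y - psi j < pi / 2.
Proof.
rewrite -(phi_fun0 j); have [y0|y0] := leP 0 y.
  have le := phi_increment_le_atan j y0; rewrite mulr0 atan0 subr0 in le.
  have := atan_ltpi2 (Num.sqrt (a j) * y).
  have : phi j 0 <= phi j y.
    by move: y0; rewrite le_eqVlt => /orP[/eqP<- //|/phi_increasing/ltW].
  by have := @pi_gt0 R; lra.
have le := phi_increment_le_atan j (ltW y0); rewrite mulr0 atan0 sub0r in le.
have := atan_gtNpi2 (Num.sqrt (a j) * y).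
have := phi_increasing j y0.
by have := @pi_gt0 R; lra.
Qed.

Definition wre j y := r_fun a j y * cos (phi j y).
Definition wim j y := r_fun a j y * sin (phi j y).

Lemma w_funE j y : w j y = wre j y +i* wim j y.
Proof.
rewrite /w_fun /cis /wre /wim; apply/eqP; rewrite eq_complex /=.
by rewrite !mulr0 subr0 add0r ![_ * r_fun _ _ _]mulrC !eqxx.
Qed.

Lemma r_fun_gt0 j y : 0 < r_fun a j y.
Proof. by rewrite sqrtr_gt0 rsq_gt0. Qed.

Lemma r_fun_sqr j y : r_fun a j y ^+ 2 = rsq j y.
Proof. by rewrite sqr_sqrtr // ltW // rsq_gt0. Qed.

Lemma w_normsq j y : wre j y ^+ 2 + wim j y ^+ 2 = rsq j y.
Proof. by rewrite !exprMn -mulrDr cos2Dsin2 mulr1 r_fun_sqr. Qed.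

Lemma is_derive_r j y : is_derive y 1 (r_fun a j) (y / r_fun a j y).
Proof.
apply: is_derive_eq (is_derive_sqrtf (rsq_gt0 j y) (is_derive_rsq a j y)) _.
by rewrite -/(r_fun a j y); field; rewrite gt_eqF ?r_fun_gt0.
Qed.

(** The curves satisfy w' = w (y + i p) / r^2, with the coefficients
(y + i p) / r^2 split into real and imaginary parts. *)
Definition c_re j y := y / rsq j y.
Definition c_im j y := p y / rsq j y.

Lemma is_derive_wre j y :
  is_derive y 1 (wre j) (c_re j y * wre j y - c_im j y * wim j y).
Proof.
apply: is_derive_eq
  (is_deriveMf (is_derive_r j y) (is_derive_cosf (is_derive_phi j y))) _.
rewrite /wre /wim /c_re /c_im -r_fun_sqr.
by field; rewrite gt_eqF ?r_fun_gt0.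
Qed.

Lemma is_derive_wim j y :
  is_derive y 1 (wim j) (c_re j y * wim j y + c_im j y * wre j y).
Proof.
apply: is_derive_eq
  (is_deriveMf (is_derive_r j y) (is_derive_sinf (is_derive_phi j y))) _.
rewrite /wre /wim /c_re /c_im -r_fun_sqr.
by field; rewrite gt_eqF ?r_fun_gt0.
Qed.

Lemma smooth_upto_r k j : smooth_upto k setT (r_fun a j).
Proof.
apply: (smooth_upto_sqrt openT) => [y _|]; first exact: rsq_gt0.
exact: smooth_upto_rsq.
Qed.

Lemma smooth_upto_wre k j : smooth_upto k setT (wre j).
Proof.
apply: (smooth_uptoM openT); first exact: smooth_upto_r.
apply: (smooth_upto_line_comp openT); first by have [] := smooth_upto_cos_sin R k.
exact: smooth_upto_phi.
Qed.

Lemma smooth_upto_wim k j : smooth_upto k setT (wim j).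
Proof.
apply: (smooth_uptoM openT); first exact: smooth_upto_r.
apply: (smooth_upto_line_comp openT); first by have [] := smooth_upto_cos_sin R k.
exact: smooth_upto_phi.
Qed.

(** * The Lagrangian angle *)

(** The modulus of y + i p. *)
Definition profile_m y := Num.sqrt (y ^+ 2 + p y ^+ 2).
Local Notation m := profile_m.

Lemma profile_m_sqr y : m y ^+ 2 = y ^+ 2 + p y ^+ 2.
Proof. by rewrite sqr_sqrtr // addr_ge0 // sqr_ge0. Qed.

Lemma profile_m_gt0 y : 0 < m y.
Proof. by rewrite sqrtr_gt0 ltr_wpDl ?sqr_ge0 // exprn_gt0. Qed.

Let cos_arg_bound y : -1 < y / m y < 1.
Proof.
have m0 := profile_m_gt0 y; have p0 := p_gt0 y; have := profile_m_sqr y => E.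
by rewrite ltr_pdivlMr // ltr_pdivrMr //; apply/andP; split; nra.
Qed.

Let sin_arg y : Num.sqrt (1 - (y / m y) ^+ 2) = p y / m y.
Proof.
have m0 := profile_m_gt0 y.
rewrite (_ : 1 - _ = (p y / m y) ^+ 2); last first.
  by rewrite !exprMn exprVn profile_m_sqr; field; rewrite -profile_m_sqr expf_neq0 // gt_eqF.
by rewrite sqrtr_sqr ger0_norm // divr_ge0 // ltW.
Qed.

Lemma upper_argE y : upper_arg (y +i* (Num.sqrt (P y))^-1) = acos (y / m y).
Proof. by []. Qed.

(** The argument of y + i p has derivative (y p' - p) / (y^2 + p^2), which is
- p Lambda by [profile_identity]; the sum of the phases has derivative
p (Lambda - alpha). *)
Lemma is_derive_theta y : is_derive y 1 theta (- (alpha * p y)).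
Proof.
have m0 := profile_m_gt0 y; have mN0 := lt0r_neq0 m0; have pN0 := lt0r_neq0 (p_gt0 y).
have dm : is_derive y 1 m ((y + p y * dp y) / m y).
  have d2 := is_deriveDf (is_derive_sqr y) (is_deriveMf (is_derive_p y) (is_derive_p y)).
  have m2 : 0 < y ^+ 2 + p y * p y by rewrite -expr2 -profile_m_sqr exprn_gt0.
  have := @is_derive_sqrtf R R (fun q => q ^+ 2 + p q * p q) y 1 _ m2 d2.
  rewrite (_ : (fun q => _) = m); last by apply/funext => z; rewrite /profile_m expr2.
  by move/is_derive_eq; apply; rewrite -expr2 -/(m y); field.
have dq := is_deriveMf (is_derive_id y 1) (is_deriveVf mN0 dm).
have dacos := @is_derive_comp1 R R (@acos R) (fun q => q / m q) y 1 _ _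
  (is_derive1_acos (cos_arg_bound y)) dq.
have dsum := is_derive_sumf (index_enum 'I_n) (fun j => is_derive_phi j y).
apply: is_derive_eq (is_deriveDf dsum dacos) _.
rewrite sin_arg -mulr_sumr /=.
have S : \sum_(i < n) (rsq i y)^-1 = Lambda y - alpha by rewrite /profile_Lambda [alpha + _]addrC addrK.
rewrite S; have key := profile_identity n_gt0 alpha_ge0 a_gt0 y.
rewrite -profile_m_sqr in key.
have E : Lambda y = (p y - y * dp y) / (m y ^+ 2 * p y).
  by rewrite key; field; rewrite pN0.
have p2 : p y ^+ 2 = m y ^+ 2 - y ^+ 2 by rewrite profile_m_sqr addrC addKr.
rewrite E; apply/eqP; rewrite -subr_eq0; apply/eqP.
transitivity ((m y ^+ 2 - y ^+ 2 - p y ^+ 2) * (- (p y * m y ^+ 2)^-1)).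
  by field; rewrite mN0 pN0.
by rewrite -p2 subrr mul0r.
Qed.

Lemma cis_theta y :
  cis (theta y) * (m y)%:C = cis (\sum_(j < n) phi j y) * (y +i* p y).
Proof.
have /andP[b1 b2] := cos_arg_bound y; have mN0 := lt0r_neq0 (profile_m_gt0 y).
have cE : cos (acos (y / m y)) = y / m y by apply: acosK; rewrite in_itv /= !ltW.
have sE : sin (acos (y / m y)) = p y / m y by rewrite sin_acos ?ltW // sin_arg.
rewrite /theta_fun upper_argE /cis cosD sinD cE sE.
set S := \sum_(j < n) _; apply/eqP; rewrite eq_complex /=; apply/andP; split; apply/eqP; by field.
Qed.

End curves.

(** * Complex-valued functions of a real variable *)

Section complex_calculus.
Variable R : realType.
Implicit Types (f g : R -> R[i]) (s : R) (z : R[i]).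

Lemma complex_eqP (z1 z2 : R[i]) :
  complex.Re z1 = complex.Re z2 -> complex.Im z1 = complex.Im z2 -> z1 = z2.
Proof. by case: z1 z2 => [x1 y1] [x2 y2] /= -> ->. Qed.

Lemma cReM z1 z2 : complex.Re (z1 * z2) =
  complex.Re z1 * complex.Re z2 - complex.Im z1 * complex.Im z2.
Proof. by case: z1 z2 => [x1 y1] [x2 y2]. Qed.

Lemma cImM z1 z2 : complex.Im (z1 * z2) =
  complex.Re z1 * complex.Im z2 + complex.Im z1 * complex.Re z2.
Proof. by case: z1 z2 => [x1 y1] [x2 y2]. Qed.

Lemma cReB z1 z2 : complex.Re (z1 - z2) = complex.Re z1 - complex.Re z2.
Proof. by case: z1 z2 => [x1 y1] [x2 y2]. Qed.

Lemma cImB z1 z2 : complex.Im (z1 - z2) = complex.Im z1 - complex.Im z2.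
Proof. by case: z1 z2 => [x1 y1] [x2 y2]. Qed.

Lemma cReD z1 z2 : complex.Re (z1 + z2) = complex.Re z1 + complex.Re z2.
Proof. by case: z1 z2 => [x1 y1] [x2 y2]. Qed.

Lemma cImD z1 z2 : complex.Im (z1 + z2) = complex.Im z1 + complex.Im z2.
Proof. by case: z1 z2 => [x1 y1] [x2 y2]. Qed.

Lemma cRe_conj z : complex.Re (conjc z) = complex.Re z.
Proof. by case: z. Qed.

Lemma cIm_conj z : complex.Im (conjc z) = - complex.Im z.
Proof. by case: z. Qed.

Lemma conjcM z1 z2 : conjc (z1 * z2) = conjc z1 * conjc z2.
Proof. by case: z1 z2 => [x1 y1] [x2 y2]; apply: complex_eqP => /=; ring. Qed.

Lemma conjc_invol z : conjc (conjc z) = z.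
Proof. by case: z => x y; apply: complex_eqP => //=; rewrite opprK. Qed.

(** Real-valued, unlike the norm of R[i]. *)
Definition normsq z := complex.Re z ^+ 2 + complex.Im z ^+ 2.

Lemma mulcJ z : z * conjc z = (normsq z)%:C.
Proof. by case: z => x y; apply: complex_eqP; rewrite /normsq /=; ring. Qed.

Lemma normsqM z1 z2 : normsq (z1 * z2) = normsq z1 * normsq z2.
Proof. by rewrite /normsq cReM cImM; ring. Qed.

Lemma normsq_conj z : normsq (conjc z) = normsq z.
Proof. by rewrite /normsq cRe_conj cIm_conj sqrrN. Qed.

Lemma normsq_eq0 z : normsq z = 0 -> z = 0.
Proof.
case: z => x y /eqP; rewrite /normsq /= paddr_eq0 ?sqr_ge0 // !sqrf_eq0.
by move=> /andP[/eqP -> /eqP ->].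
Qed.

Lemma normsq_gt0 z : z != 0 -> 0 < normsq z.
Proof.
move=> z0; rewrite lt_neqAle addr_ge0 ?sqr_ge0 // andbT eq_sym.
by apply: contraNneq z0 => /normsq_eq0 ->.
Qed.

Lemma normsq_prod (I : Type) (r : seq I) (F : I -> R[i]) :
  normsq (\prod_(i <- r) F i) = \prod_(i <- r) normsq (F i).
Proof.
elim: r => [|i r IH]; first by rewrite !big_nil /normsq /= expr0n addr0 expr1n.
by rewrite !big_cons normsqM IH.
Qed.

Lemma normsq_cis t : normsq (cis t) = 1 :> R.
Proof. by rewrite /normsq /= cos2Dsin2. Qed.

Lemma unit_inv_conj z : normsq z = 1 -> z^-1 = conjc z.
Proof.
move=> z1; have z0 : z != 0.
  by apply/eqP => z0; move: z1; rewrite z0 /normsq /= expr0n addr0 => /esym/eqP; rewrite oner_eq0.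
by apply: (mulfI z0); rewrite mulfV // mulcJ z1.
Qed.

Lemma cisD (t u : R) : cis (t + u) = cis t * cis u.
Proof. by apply: complex_eqP; rewrite ?cReM ?cImM /= ?cosD ?sinD //; ring. Qed.

Lemma cis_sum (I : Type) (r : seq I) (F : I -> R) :
  cis (\sum_(i <- r) F i) = \prod_(i <- r) cis (F i).
Proof.
elim: r => [|i r IH]; last by rewrite !big_cons cisD IH.
by rewrite !big_nil /cis cos0 sin0.
Qed.

Lemma is_deriveC_M f g s (d e : R[i]) : is_deriveC s f d -> is_deriveC s g e ->
  is_deriveC s (fun t => f t * g t) (d * g s + f s * e).
Proof.
move=> [f1 f2] [g1 g2]; split.
  rewrite (_ : (fun t => complex.Re _) = fun t =>
    complex.Re (f t) * complex.Re (g t) - complex.Im (f t) * complex.Im (g t)).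
    apply: is_derive_eq (is_deriveBf (is_deriveMf f1 g1) (is_deriveMf f2 g2)) _.
    by rewrite cReD !cReM; ring.
  by apply/funext => t; rewrite cReM.
rewrite (_ : (fun t => complex.Im _) = fun t =>
  complex.Re (f t) * complex.Im (g t) + complex.Im (f t) * complex.Re (g t)).
  apply: is_derive_eq (is_deriveDf (is_deriveMf f1 g2) (is_deriveMf f2 g1)) _.
  by rewrite cImD !cImM; ring.
by apply/funext => t; rewrite cImM.
Qed.

Lemma is_deriveC_conj f s (d : R[i]) : is_deriveC s f d ->
  is_deriveC s (fun t => conjc (f t)) (conjc d).
Proof.
move=> [f1 f2]; split.
  rewrite (_ : (fun t => _) = fun t => complex.Re (f t)) ?cRe_conj //.
  by apply/funext => t; rewrite cRe_conj.
rewrite (_ : (fun t => _) = fun t => - complex.Im (f t)) ?cIm_conj.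
  exact: is_deriveNf.
by apply/funext => t; rewrite cIm_conj.
Qed.

Lemma is_deriveC_prod (I : Type) (r : seq I) (F : I -> R -> R[i]) s (d : I -> R[i]) :
  (forall i, F i s != 0) -> (forall i, is_deriveC s (F i) (d i)) ->
  is_deriveC s (fun t => \prod_(i <- r) F i t)
    (\prod_(i <- r) F i s * \sum_(i <- r) d i / F i s).
Proof.
move=> F0 dF; elim: r => [|i r IH].
  rewrite !big_nil mulr0.
  rewrite (_ : (fun t => _) = fun=> 1); last by apply/funext => t; rewrite big_nil.
  by split; exact: is_deriveCf.
rewrite !big_cons (_ : (fun t => _) = fun t => F i t * \prod_(j <- r) F j t).
  suff -> : F i s * \prod_(j <- r) F j s * (d i / F i s + \sum_(j <- r) d j / F j s) =
     d i * \prod_(j <- r) F j s + F i s * (\prod_(j <- r) F j s * \sum_(j <- r) d j / F j s).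
    exact: is_deriveC_M.
  by field; exact: F0.
by apply/funext => t; rewrite big_cons.
Qed.

Lemma is_derive_normsq f s (d : R[i]) : is_deriveC s f d ->
  is_derive s 1 (fun t => normsq (f t)) (2 * complex.Re (conjc (f s) * d)).
Proof.
move=> [f1 f2].
have := is_deriveDf (is_deriveMf f1 f1) (is_deriveMf f2 f2).
rewrite (_ : (fun q => _) = fun t => normsq (f t)).
  by move/is_derive_eq; apply; rewrite cReM cRe_conj cIm_conj /=; ring.
by apply/funext => t; rewrite /normsq !expr2.
Qed.

End complex_calculus.

(** * The explicit solutions of the system *)

Section standard_solution.
Variables (R : realType) (n : nat) (alpha : R) (a psi : 'I_n -> R).
Hypotheses (n_gt0 : (0 < n)%N) (alpha_ge0 : 0 <= alpha) (a_gt0 : forall j, 0 < a j).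
Implicit Types (y s c : R) (j : 'I_n).

Local Notation P := (P_fun alpha a).
Local Notation p := (profile_p alpha a).
Local Notation m := (profile_m alpha a).
Local Notation N := (profile_N alpha a).
Local Notation rsq := (rsq a).
Local Notation phi := (phi_fun alpha a psi).
Local Notation theta := (theta_fun alpha a psi).
Local Notation w := (w_fun alpha a psi).

Let p_gt0 := profile_p_gt0 n_gt0 alpha_ge0 a_gt0.
Let rsq_gt0 := rsq_gt0 a_gt0.
Let m_gt0 := profile_m_gt0 n_gt0 alpha_ge0 a_gt0.

(** The opposite of the first integral A. *)
Definition radius_product := \prod_(j < n) r_fun a j 0.

Lemma radius_product_gt0 : 0 < radius_product.
Proof. by apply: prodr_gt0 => j _; exact: r_fun_gt0. Qed.

(** The velocity dy/ds of the explicit solutions. *)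
Definition speed y := radius_product * expR (- (alpha * y ^+ 2 / 2)) / p y.

Lemma speed_gt0 y : 0 < speed y.
Proof. by rewrite divr_gt0 // mulr_gt0 ?expR_gt0 // radius_product_gt0. Qed.

Lemma expR_half_sqr (x : R) : expR (x / 2) ^+ 2 = expR x.
Proof. by rewrite expr2 -expRD; congr expR; field. Qed.

(** Each r_j^2 is (1 + a_j y^2) / a_j, so the product is that of the numerator of P. *)
Lemma prod_rsq y : \prod_(j < n) rsq j y =
  radius_product ^+ 2 * expR (- (alpha * y ^+ 2)) * N (y ^+ 2).
Proof.
have -> : radius_product ^+ 2 * expR (- (alpha * y ^+ 2)) * N (y ^+ 2) =
  radius_product ^+ 2 * \prod_(j < n) (1 + a j * y ^+ 2) *
  (expR (alpha * y ^+ 2) / expR (alpha * y ^+ 2)).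
  by rewrite /N expRN; ring.
rewrite divff ?gt_eqF ?expR_gt0 // mulr1 /radius_product expr2 -!big_split /=.
apply: eq_bigr => j _; rewrite -expr2 r_fun_sqr // /rsq expr0n addr0.
by field; rewrite gt_eqF.
Qed.

Lemma prod_r_speed y : \prod_(j < n) r_fun a j y = speed y * m y.
Proof.
have h1 : 0 < \prod_(j < n) r_fun a j y by apply: prodr_gt0 => j _; exact: r_fun_gt0.
have h2 : 0 < speed y * m y by rewrite mulr_gt0 // speed_gt0.
apply/eqP; rewrite -(eqrXn2 (n := 2)) // ?ltW //; apply/eqP.
rewrite expr2 -big_split /= (eq_bigr (fun j => rsq j y)); last first.
  by move=> j _; rewrite -expr2 r_fun_sqr.
rewrite prod_rsq exprMn profile_m_sqr -(profile_N_p n_gt0 alpha_ge0 a_gt0) /speed.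
rewrite !exprMn -[in LHS]expR_half_sqr mulNr.
by field; rewrite gt_eqF.
Qed.

Lemma smooth_upto_speed k : smooth_upto k setT speed.
Proof.
apply: (smooth_upto_div openT) => [y _||]; first by rewrite gt_eqF.
  apply: (smooth_uptoM openT); first exact: smooth_upto_cst.
  apply: (smooth_upto_line_comp openT); first exact: smooth_upto_exp.
  apply: (smooth_uptoN openT); apply: (smooth_uptoM openT); last exact: smooth_upto_cst.
  apply: (smooth_uptoM openT); first exact: smooth_upto_cst.
  by apply: (smooth_uptoX openT); exact: (smooth_upto_id openT).
exact: smooth_upto_p.
Qed.

(** The time s at which the explicit solution reaches y, if it is at 0 at time c. *)
Definition time c y := c + oriented_integral (fun t => (speed t)^-1) 0 y.

Lemma is_derive_time c y : is_derive y 1 (time c) (speed y)^-1.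
Proof.
have cs : continuous (fun t => (speed t)^-1).
  move=> t; apply: differentiable_continuous.
  apply: (@smooth_upto_diff R 0%N R R setT) => //.
  apply: (smooth_uptoV openT) => [z _|]; first by rewrite gt_eqF // speed_gt0.
  exact: smooth_upto_speed.
apply: is_derive_eq
  (is_deriveDf (is_deriveCf y 1 c) (is_derive_oriented_integral 0 y cs)) _.
by rewrite add0r.
Qed.

Lemma time_inverse c : exists Y : R -> R,
  [/\ open_interval (range (time c)), set_bij (range (time c)) setT Y,
      forall y, Y (time c y) = y,
      forall s, range (time c) s -> is_derive s 1 Y (speed (Y s)) &
      forall k, smooth_upto k (range (time c)) Y].
Proof.
have st k : smooth_upto k setT (fun y => (speed y)^-1).
  apply: (smooth_uptoV openT) => [z _|]; first by rewrite gt_eqF // speed_gt0.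
  exact: smooth_upto_speed.
have [|Y [YK oJ iJ JY sY]] := smooth_inverse (is_derive_time c) _ st.
  by move=> y; rewrite invr_gt0 speed_gt0.
exists Y; split=> //.
- by split=> //; exists (time c 0); exists 0.
- split=> //.
  + by move=> s t; rewrite !inE => -[x _ <-] [z _ <-]; rewrite !YK => ->.
  + by move=> y _; exists (time c y); rewrite ?YK //; exists y.
- by move=> s Js; have [_] := JY s Js; rewrite invrK.
Qed.

(** The logarithmic derivative of w_j with respect to s. *)
Definition kappa j y : R[i] := (speed y)%:C * (c_re a j y +i* c_im alpha a j y).

Lemma w_normsqC j y : normsq (w j y) = rsq j y.
Proof. by rewrite w_funE; exact: w_normsq. Qed.

Lemma w_neq0 j y : w j y != 0.
Proof.
by apply/eqP => w0; have := rsq_gt0 j y; rewrite -w_normsqC w0 /normsq /= expr0n addr0 ltxx.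
Qed.

Lemma prod_w y : \prod_(k < n) w k y = cis (\sum_(k < n) phi k y) * (speed y * m y)%:C.
Proof.
rewrite /w big_split /= -cis_sum -prod_r_speed; congr (_ * _).
by rewrite rmorph_prod.
Qed.

(** Along a solution, twice the real part of this product is the derivative of
all |w_j|^2, and alpha times its imaginary part that of theta. *)
Lemma cis_theta_prod_w y :
  conjc (cis (theta y)) * \prod_(k < n) w k y = (speed y)%:C * (y -i* p y).
Proof.
have mN0 : (m y)%:C != 0 by apply/eqP => -[] /eqP; rewrite gt_eqF.
apply: (mulfI mN0).
have T := cis_theta psi n_gt0 alpha_ge0 a_gt0 y.
have T' : conjc (cis (theta y)) * (m y)%:C =
    conjc (cis (\sum_(j < n) phi j y)) * (y -i* p y).
  by rewrite -[(m y)%:C]conjc_real -rmorphM T rmorphM.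
have C1 := mulcJ (cis (\sum_(j < n) phi j y)); rewrite normsq_cis in C1.
rewrite prod_w (rmorphM (real_complex R)); move: T' C1; rewrite -/(cis _).
set ct := conjc (cis (theta y)); set cS := cis (\sum_(j < n) phi j y).
set sp := (speed y)%:C; set mm := (m y)%:C => T' C1.
transitivity ((ct * mm) * cS * sp * mm); first by ring.
rewrite {}T'; move: C1; set cc := conjc cS; set z := Complex _ (- p y) => C1.
transitivity ((cS * cc) * z * sp * mm); first by ring.
by rewrite C1 rmorph1; ring.
Qed.

Lemma is_deriveC_w j y : is_deriveC y (w j) (w j y * (c_re a j y +i* c_im alpha a j y)).
Proof.
have Re_w : (fun t => complex.Re (w j t)) = wre alpha a psi j.
  by apply/funext => t; rewrite w_funE.
have Im_w : (fun t => complex.Im (w j t)) = wim alpha a psi j.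
  by apply/funext => t; rewrite w_funE.
split; rewrite ?Re_w ?Im_w w_funE.
  apply: is_derive_eq (is_derive_wre psi n_gt0 alpha_ge0 a_gt0 j y) _.
  by rewrite cReM /=; ring.
apply: is_derive_eq (is_derive_wim psi n_gt0 alpha_ge0 a_gt0 j y) _.
by rewrite cImM /=; ring.
Qed.

Lemma is_deriveC_comp f (g : R -> R) s (d : R[i]) (e : R) :
  is_deriveC (g s) f d -> is_derive s 1 g e ->
  is_deriveC s (fun t => f (g t)) (d * e%:C).
Proof.
move=> [f1 f2] dg; split.
  apply: is_derive_eq (@is_derive_comp1 R R (fun t => complex.Re (f t)) g s 1 _ _ f1 dg) _.
  by rewrite cReM /= mulr0 subr0.
apply: is_derive_eq (@is_derive_comp1 R R (fun t => complex.Im (f t)) g s 1 _ _ f2 dg) _.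
by rewrite cImM /= mulr0 add0r.
Qed.

(** With V = e^(-i theta) w_1 ... w_n, the system becomes the family of linear
equations dw_j/ds = w_j conj(V) / |w_j|^2. *)
Lemma system_rhs (z : 'I_n -> R[i]) (e : R[i]) j : normsq e = 1 -> z j != 0 ->
  e * conjc (\prod_(k < n | k != j) z k) =
  z j * (conjc (conjc e * \prod_(k < n) z k) / (normsq (z j))%:C).
Proof.
move=> e1 z0; rewrite [\prod_(k < n) z k](bigD1 j) //=.
have nz : (normsq (z j))%:C != 0 by apply/eqP => -[] /eqP; rewrite gt_eqF // normsq_gt0.
apply: (mulfI nz); rewrite -mulcJ !conjcM conjc_invol.
have cz : conjc (z j) != 0 by rewrite conjc_eq0.
by rewrite /=; field; rewrite z0 cz.
Qed.

Lemma system_rhs_w j y :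
  cis (theta y) * conjc (\prod_(k < n | k != j) w k y) = w j y * kappa j y.
Proof.
rewrite (system_rhs (z := fun k => w k y)) ?normsq_cis ?w_neq0 //.
rewrite cis_theta_prod_w w_normsqC; congr (_ * _); rewrite conjcM /kappa -mulrA.
congr (_ * _); first exact: conjc_real.
rewrite /c_re /c_im /= opprK -fmorphV; apply: complex_eqP; rewrite ?cReM ?cImM /=; ring.
Qed.

End standard_solution.

(** * First integrals *)

Section first_integrals.
Variables (R : realType) (n : nat) (alpha : R) (K : set R).
Variables (z : 'I_n -> R -> R[i]) (th : angle_fun R).
Hypothesis sol : solution alpha K z th.

Let e := exp_angle th.

(** The product V = e^(-i theta) w_1 ... w_n, in which the system takes a form that
is the same for all j. *)
Definition twisted_product s : R[i] := conjc (e s) * \prod_(k < n) z k s.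
Local Notation V := twisted_product.

Lemma exp_angle_unit s : K s -> normsq (e s) = 1.
Proof.
have [_ [_ st] _ _ _] := sol; rewrite /e; case: th st => [t|c] /= st Ks.
  exact: normsq_cis.
by have [_ /(_ _ Ks)] := st.
Qed.

Lemma is_deriveC_exp_angle s (d : R) :
  is_derive_angle s th d -> is_deriveC s e ((0 +i* d) * e s).
Proof.
rewrite /e; case: th => [t|c] //= dt; split.
  by apply: is_derive_eq (is_derive_cosf dt) _; rewrite cReM /=; ring.
by apply: is_derive_eq (is_derive_sinf dt) _; rewrite cImM /=; ring.
Qed.

Lemma twisted_product_inv s : K s -> (e s)^-1 * \prod_(k < n) z k s = V s.
Proof. by move=> Ks; rewrite unit_inv_conj // exp_angle_unit. Qed.

Lemma is_deriveC_solution j s : K s ->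
  is_deriveC s (z j) (z j s * (conjc (V s) / (normsq (z j s))%:C)).
Proof.
move=> Ks; have [_ _ z0 dz _] := sol.
rewrite -(system_rhs (z := fun k => z k s) (e := e s)) ?exp_angle_unit ?z0 //.
exact: dz.
Qed.

(** The derivative does not depend on j, so the differences of the |w_j|^2 are
first integrals. *)
Lemma is_derive_modulus j s : K s ->
  is_derive s 1 (fun t => normsq (z j t)) (2 * complex.Re (V s)).
Proof.
move=> Ks; have [_ _ z0 _ _] := sol.
apply: is_derive_eq (is_derive_normsq (is_deriveC_solution j Ks)) _.
have n0 : (normsq (z j s))%:C != 0.
  by apply/eqP => -[] /eqP; rewrite gt_eqF // normsq_gt0 // z0.
rewrite mulrA [conjc _ * z j s]mulrC mulcJ mulrCA mulfV // mulr1.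
by rewrite cRe_conj.
Qed.

Lemma is_deriveC_twisted_product s : K s ->
  is_derive s 1 (fun t => complex.Re (V t))
    (alpha * complex.Im (V s) ^+ 2 + normsq (V s) * \sum_(j < n) (normsq (z j s))^-1) /\
  is_derive s 1 (fun t => complex.Im (V t)) (- (alpha * complex.Re (V s) * complex.Im (V s))).
Proof.
move=> Ks; have [_ _ z0 _ dth] := sol.
have de := is_deriveC_exp_angle (dth s Ks).
rewrite twisted_product_inv // in de.
have dp := is_deriveC_prod (index_enum 'I_n) (fun j => z0 j s Ks)
  (fun j => is_deriveC_solution j Ks).
have [d1 d2] := is_deriveC_M (is_deriveC_conj de) dp.
have E : conjc ((0 +i* (alpha * complex.Im (V s))) * e s) * \prod_(k < n) z k s +
    conjc (e s) * (\prod_(k < n) z k s *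
      \sum_(j < n) (z j s * (conjc (V s) / (normsq (z j s))%:C)) / z j s) =
    (0 -i* (alpha * complex.Im (V s))) * V s +
    (normsq (V s))%:C * (\sum_(j < n) (normsq (z j s))^-1)%:C.
  rewrite conjcM -mulcJ rmorph_sum /= -/(V s); congr (_ + _).
    by rewrite mulrA.
  rewrite mulrA -/(V s) -mulrA; congr (_ * _); rewrite mulr_sumr.
  apply: eq_bigr => j _; rewrite [z j s * _]mulrC -mulrA mulfV ?z0 // mulr1.
  by rewrite (fmorphV (real_complex R)).
split.
  apply: is_derive_eq d1 _; rewrite E cReD !cReM /=; ring.
by apply: is_derive_eq d2 _; rewrite E cImD !cImM /=; ring.
Qed.

End first_integrals.

(** * Every solution runs along an explicit one *)

Section classification.
Variables (R : realType) (n : nat) (alpha : R) (a psi : 'I_n -> R).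
Hypotheses (n_gt0 : (0 < n)%N) (alpha_ge0 : 0 <= alpha) (a_gt0 : forall j, 0 < a j).
Implicit Types (y s c v t : R) (j : 'I_n).

Local Notation p := (profile_p alpha a).
Local Notation dp := (profile_dp alpha a).
Local Notation Lambda := (profile_Lambda alpha a).
Local Notation N := (profile_N alpha a).
Local Notation rsq := (rsq a).
Local Notation theta := (theta_fun alpha a psi).
Local Notation w := (w_fun alpha a psi).
Local Notation speed := (speed alpha a).
Local Notation time := (time alpha a).

Let p_gt0 := profile_p_gt0 n_gt0 alpha_ge0 a_gt0.
Let rsq_gt0 := rsq_gt0 a_gt0.

Lemma profile_Lambda_gt0 y : 0 < Lambda y.
Proof.
rewrite ltr_wpDl // (bigD1 (Ordinal n_gt0)) //= ltr_pwDl ?invr_gt0 ?rsq_gt0 //.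
by rewrite sumr_ge0 // => j _; rewrite invr_ge0 ltW // rsq_gt0.
Qed.

(** Minus the cotangent of the argument of V along the explicit curves.  As it
increases from -oo to +oo, it recovers y from V. *)
Definition slope y := y / p y.

Lemma is_derive_slope y :
  is_derive y 1 slope (N (y ^+ 2) * p y * Lambda y).
Proof.
have pN0 := lt0r_neq0 (p_gt0 y).
apply: is_derive_eq
  (is_deriveMf (is_derive_id y 1) (is_deriveVf pN0 (is_derive_p n_gt0 alpha_ge0 a_gt0 y))) _.
have key := profile_identity n_gt0 alpha_ge0 a_gt0 y.
rewrite -(profile_N_p n_gt0 alpha_ge0 a_gt0) in key.
transitivity ((p y - y * dp y) / p y ^+ 2); first by field.
by rewrite key; field.
Qed.

Lemma slope_sqr y : 1 + slope y ^+ 2 = N (y ^+ 2).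
Proof.
have pN0 := lt0r_neq0 (p_gt0 y).
apply: (mulIf (expf_neq0 2 pN0)); rewrite (profile_N_p n_gt0 alpha_ge0 a_gt0).
by rewrite /slope; field.
Qed.

(** The slope is onto because P is bounded below by a positive constant. *)
Lemma slope_inverse : exists g : R -> R, (forall y, g (slope y) = y) /\
  forall t, slope (g t) = t /\ is_derive t 1 g (N (g t ^+ 2) * p (g t) * Lambda (g t))^-1.
Proof.
have h0 y : 0 < N (y ^+ 2) * p y * Lambda y.
  rewrite mulr_gt0 ?profile_Lambda_gt0 // mulr_gt0 // profile_N_gt0 // => j.
  by rewrite onePaM_gt0 // sqr_ge0.
have sm k : smooth_upto k setT (fun y => N (y ^+ 2) * p y * Lambda y).
  have ss : smooth_upto k setT slope.
    apply: (smooth_upto_div openT) => [y _||]; first by rewrite gt_eqF.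
      exact: (smooth_upto_id openT).
    exact: smooth_upto_p.
  apply: (smooth_uptoM openT); first apply: (smooth_uptoM openT).
  - apply: (smooth_upto_eq openT (f := fun y => 1 + slope y ^+ 2)).
      by move=> y _; exact: slope_sqr.
    apply: (smooth_uptoD openT); first exact: smooth_upto_cst.
    exact: (smooth_uptoX openT).
  - exact: smooth_upto_p.
  - apply: (smooth_uptoD openT); first exact: smooth_upto_cst.
    apply: (smooth_upto_sum _ _ openT) => j.
    apply: (smooth_uptoV openT) => [y _|]; first by rewrite gt_eqF // rsq_gt0.
    exact: smooth_upto_rsq.
have [g [gK _ itv fK _]] := smooth_inverse is_derive_slope h0 sm.
exists g; split=> // t; apply: fK.
pose j := Ordinal n_gt0; pose q := Num.sqrt (a j).
have q0 : 0 < q by rewrite sqrtr_gt0.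
have slope_ge y : 0 <= y -> q * y <= slope y.
  move=> y0; rewrite /slope mulrC ler_wpM2l // /profile_p invrK ler_sqrt.
    exact: P_fun_ge.
  by rewrite ltW // P_fun_gt0.
have slopeN y : slope (- y) = - slope y.
  by rewrite /slope /profile_p /P_fun oppr_eq0 sqrrN mulNr.
have t1 : `|t| <= slope (`|t| / q).
  apply: le_trans (slope_ge _ _); last by rewrite divr_ge0 // ltW.
  by rewrite mulrCA mulfV ?mulr1 // gt_eqF.
apply: (is_interval_cc itv (a := slope (- (`|t| / q))) (b := slope (`|t| / q))).
- by exists (- (`|t| / q)).
- by exists (`|t| / q).
- rewrite slopeN; apply/andP; split; last exact: le_trans (ler_norm _) t1.
  by rewrite lerNl (le_trans _ t1) // -normrN ler_norm.
Qed.

Lemma profile_N_increasing u v : 0 <= u -> u < v -> N u < N v.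
Proof.
move=> u0 uv; have iD : is_interval [set x : R | 0 <= x].
  by move=> x1 x2 /= h1 _ x3 /andP[h2 _]; exact: le_trans h2.
have h x j : 0 <= x -> 0 < 1 + a j * x by exact: onePaM_gt0.
have v0 : 0 <= v by rewrite (le_trans u0) // ltW.
have [c c0 E] := interval_MVT iD u0 v0 uv
    (fun x h0 => is_derive_profile_N alpha (fun j => h x j h0)).
rewrite -subr_gt0 E mulr_gt0 ?subr_gt0 // mulr_gt0 ?profile_N_gt0 //; first by move=> j; exact: h.
rewrite ltr_wpDl // (bigD1 (Ordinal n_gt0)) //= ltr_pwDl ?divr_gt0 ?h //.
by rewrite sumr_ge0 // => j _; rewrite divr_ge0 ?ltW ?h.
Qed.

Lemma profile_N_inj u v : 0 <= u -> 0 <= v -> N u = N v -> u = v.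
Proof.
move=> u0 v0 E; have [uv|uv|//] := ltgtP u v.
  by have := profile_N_increasing u0 uv; rewrite E ltxx.
by have := profile_N_increasing v0 uv; rewrite E ltxx.
Qed.

Lemma profile_N_lt1 v : (forall j, 0 < 1 + a j * v) -> v < 0 -> N v < 1.
Proof.
move=> h v0; rewrite /profile_N (bigD1 (Ordinal n_gt0)) //= -mulrA.
have le1 : expR (alpha * v) <= 1 by rewrite -expR0 ler_expR mulr_ge0_le0 // ltW.
have lt1 j : 1 + a j * v < 1 by rewrite gtrDl pmulr_rlt0.
apply: le_lt_trans (lt1 (Ordinal n_gt0)).
rewrite ler_piMr ?(ltW (h _)) // mulr_ile1 ?expR_ge0 ?prodr_ile1 ?prodr_ge0 //.
  by move=> k _; rewrite ltW.
by move=> k _; rewrite !ltW.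
Qed.

(** The first integrals make |w_j|^2 - 1 / a_j independent of j, and express Im V
and |V| in terms of this number v.  So v is y^2, where y is the point whose
[slope] is that of V.  This y is then found to move with the velocity [speed],
and the w_j to solve the same linear equations as the explicit curves. *)
Lemma solution_is_explicit (K : set R) (z : 'I_n -> R -> R[i]) (th : angle_fun R) s0 y0 c :
  solution alpha K z th -> K s0 -> (forall j, z j s0 = w j y0) ->
  exp_angle th s0 = cis (theta y0) -> time c y0 = s0 ->
  exists y : R -> R, forall s, K s ->
    [/\ time c (y s) = s, forall j, z j s = w j (y s) &
        exp_angle th s = cis (theta (y s))].
Proof.
move=> sol Ks0 z0E e0E ty0.
have [[_ iK _] _ zN0 _ _] := sol.
pose V := twisted_product z th; pose X s := complex.Re (V s); pose Y s := complex.Im (V s).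
pose rho j s := normsq (z j s).
pose k0 := radius_product a.
have k0_gt0 : 0 < k0 by exact: radius_product_gt0.
have rho_gt0 j s : K s -> 0 < rho j s by move=> Ks; rewrite normsq_gt0 // zN0.
have V0 : V s0 = (speed y0)%:C * (y0 -i* p y0).
  rewrite /V /twisted_product e0E -(cis_theta_prod_w psi n_gt0 alpha_ge0 a_gt0).
  by congr (_ * _); apply: eq_bigr.
have X0 : X s0 = speed y0 * y0 by rewrite /X V0 cReM /= mul0r subr0.
have Y0 : Y s0 = - (speed y0 * p y0) by rewrite /Y V0 cImM /= mul0r addr0 mulrN.
pose j0 := Ordinal n_gt0; pose v s := rho j0 s - (a j0)^-1.
have rhoE j s : K s -> rho j s = (a j)^-1 + v s.
  move=> Ks; have D t : K t -> is_derive t 1 (fun t => rho j t - rho j0 t) 0.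
    move=> Kt; apply: is_derive_eq
      (is_deriveBf (is_derive_modulus sol j Kt) (is_derive_modulus sol j0 Kt)) _.
    exact: subrr.
  have := derive0_constant iK Ks Ks0 D.
  rewrite /v /rho !z0E !w_normsqC // => E.
  apply/eqP; rewrite -subr_eq0; apply/eqP.
  transitivity (normsq (z j s) - normsq (z j0 s) - (a j)^-1 + (a j0)^-1); first by ring.
  by rewrite E /rsq; ring.
have dv s : K s -> is_derive s 1 v (2 * X s).
  move=> Ks; apply: is_derive_eq
    (is_deriveBf (is_derive_modulus sol j0 Ks) (is_deriveCf s 1 (a j0)^-1)) _.
  by rewrite subr0.
have v0 : v s0 = y0 ^+ 2 by rewrite /v /rho z0E w_normsqC // addrC addKr.
have dX s (Ks : K s) := proj1 (is_deriveC_twisted_product sol Ks).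
have dY s (Ks : K s) := proj2 (is_deriveC_twisted_product sol Ks).
(* Im V e^(alpha v / 2) is the first integral A *)
have YE s : K s -> Y s = - (k0 * expR (- (alpha * v s / 2))).
  move=> Ks; have D t : K t -> is_derive t 1 (fun t => Y t * expR (alpha * v t / 2)) 0.
    move=> Kt.
    have d1 : is_derive t 1 (fun t => alpha * v t / 2) (alpha * X t).
      apply: is_derive_eq (is_deriveMf (is_deriveMf (is_deriveCf t 1 alpha) (dv t Kt))
        (is_deriveCf t 1 2^-1)) _.
      by field.
    apply: is_derive_eq (is_deriveMf (dY t Kt) (is_derive_expf d1)) _.
    by rewrite -/(X t) -/(Y t); ring.
  have := derive0_constant iK Ks Ks0 D.
  rewrite Y0 v0 /speed expRN -/k0 => E.
  apply: (mulIf (lt0r_neq0 (expR_gt0 (alpha * v s / 2)))); rewrite E expRN.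
  have := p_gt0 y0; have := expR_gt0 (alpha * y0 ^+ 2 / 2); have := expR_gt0 (alpha * v s / 2).
  by move=> /lt0r_neq0 h1 /lt0r_neq0 h2 /lt0r_neq0 h3; field; rewrite h1 h2 h3.
have Y_lt0 s : K s -> Y s < 0 by move=> /YE ->; rewrite oppr_lt0 mulr_gt0 ?expR_gt0.
have NE s : K s -> X s ^+ 2 + Y s ^+ 2 = Y s ^+ 2 * N (v s).
  move=> Ks; transitivity (normsq (V s)); first by [].
  rewrite /V /twisted_product normsqM normsq_conj (exp_angle_unit sol Ks) mul1r normsq_prod.
  rewrite (eq_bigr (fun j => (a j)^-1 * (1 + a j * v s))); last first.
    by move=> j _; rewrite -/(rho j s) rhoE //; field; rewrite gt_eqF.
  rewrite big_split /= YE // sqrrN exprMn -mulNr expR_half_sqr /profile_N expRN.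
  have -> : \prod_(j < n) (a j)^-1 = k0 ^+ 2.
    rewrite expr2 -big_split /=; apply: eq_bigr => j _.
    by rewrite -expr2 r_fun_sqr // /rsq expr0n addr0.
  by field; rewrite gt_eqF ?expR_gt0.
have oneav j s : K s -> 0 < 1 + a j * v s.
  move=> Ks; have := rho_gt0 j s Ks; rewrite rhoE // -(pmulr_rgt0 _ (a_gt0 j)).
  by rewrite mulrDr mulfV // gt_eqF.
(* |V|^2 >= (Im V)^2 forces N(v) >= 1 *)
have v_ge0 s : K s -> 0 <= v s.
  move=> Ks; rewrite leNgt; apply/negP => /(profile_N_lt1 (fun j => oneav j s Ks)).
  have Y2 : 0 < Y s ^+ 2 by rewrite exprn_even_gt0 //= lt_eqF // Y_lt0.
  rewrite ltNge => /negP; apply; rewrite -(ler_pM2l Y2) -NE // mulr1.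
  by rewrite lerDr sqr_ge0.
have [g [gK gE]] := slope_inverse.
pose y s := g (- (X s / Y s)); exists y.
have slopeE s : slope (y s) = - (X s / Y s) by have [] := gE (- (X s / Y s)).
have vE s : K s -> v s = y s ^+ 2.
  move=> Ks; apply: profile_N_inj; rewrite ?v_ge0 ?sqr_ge0 //.
  have Y2 : Y s ^+ 2 != 0 by rewrite expf_neq0 // lt_eqF // Y_lt0.
  apply: (mulfI Y2); rewrite -NE // -slope_sqr slopeE.
  by field; rewrite lt_eqF // Y_lt0.
have speedE s : K s -> speed (y s) * p (y s) = - Y s.
  move=> Ks; rewrite YE // opprK vE // /speed -/k0.
  by field; rewrite gt_eqF.
have XE s : K s -> X s = speed (y s) * y s.
  move=> Ks; have YN := lt_eqF (Y_lt0 s Ks); have pN := gt_eqF (p_gt0 (y s)).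
  have -> : X s = - (X s / Y s) * - Y s by field; rewrite YN.
  by rewrite -slopeE -speedE // /slope; field; rewrite pN.
have dy s : K s -> is_derive s 1 y (speed (y s)).
  move=> Ks; have YN0 : Y s != 0 by rewrite lt_eqF // Y_lt0.
  have pN0 := lt0r_neq0 (p_gt0 (y s)).
  have [_ dg] := gE (- (X s / Y s)); rewrite -/(y s) in dg.
  have d := is_deriveNf (is_deriveMf (dX s Ks) (is_deriveVf YN0 (dY s Ks))).
  apply: is_derive_eq (@is_derive_comp1 R R g (fun s => - (X s / Y s)) s 1 _ _ dg d) _.
  have -> : \sum_(j < n) (normsq (z j s))^-1 = Lambda (y s) - alpha.
    rewrite /profile_Lambda [alpha + _]addrC addrK; apply: eq_bigr => j _.
    by rewrite -/(rho j s) rhoE // vE.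
  have -> : normsq (twisted_product z th s) = Y s ^+ 2 * N (y s ^+ 2).
    by rewrite -vE // -NE.
  have LN0 := lt0r_neq0 (profile_Lambda_gt0 (y s)).
  have NN0 : N (y s ^+ 2) != 0 by rewrite -vE // gt_eqF // profile_N_gt0 // => j; exact: oneav.
  have XX : X s ^+ 2 = Y s ^+ 2 * N (y s ^+ 2) - Y s ^+ 2 by rewrite -vE // -NE // addrK.
  rewrite -/(X s) -/(Y s).
  have -> : speed (y s) = - Y s / p (y s) by rewrite -speedE // mulfK.
  transitivity (- ((alpha * (Y s ^+ 2 + X s ^+ 2) + Y s ^+ 2 * N (y s ^+ 2) * (Lambda (y s) - alpha))
     / Y s) / (N (y s ^+ 2) * p (y s) * Lambda (y s))).
    by field; rewrite YN0 LN0 NN0 pN0.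
  by rewrite XX; field; rewrite YN0 LN0 NN0 pN0.
have y_s0 : y s0 = y0.
  rewrite /y X0 Y0 (_ : - _ = slope y0) ?gK // /slope.
  by field; rewrite !gt_eqF ?p_gt0 ?speed_gt0.
have timeE s : K s -> time c (y s) = s.
  move=> Ks; have D t : K t -> is_derive t 1 (fun t => time c (y t) - t) 0.
    move=> Kt; apply: is_derive_eq
      (is_deriveBf (@is_derive_comp1 R R (time c) y t 1 _ _
         (is_derive_time n_gt0 alpha_ge0 a_gt0 c (y t)) (dy t Kt)) (is_derive_id t 1)) _.
    by rewrite mulVf ?subrr // gt_eqF // speed_gt0.
  have := derive0_constant iK Ks Ks0 D; rewrite y_s0 ty0 subrr.
  by move/eqP; rewrite subr_eq0 => /eqP.
(* the difference f of two solutions of one linear equation has constant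
|f|^2 / |z_j|^2 *)
have zE j s : K s -> z j s = w j (y s).
  move=> Ks; apply/eqP; rewrite -subr_eq0; apply/eqP; apply: normsq_eq0.
  pose f t := z j t - w j (y t).
  have kap t : K t -> conjc (V t) / (normsq (z j t))%:C = kappa alpha a j (y t).
    move=> Kt; rewrite -/(rho j t) rhoE // vE // /kappa /c_re /c_im -/(rsq j (y t)).
    rewrite -(fmorphV (real_complex R)); apply: complex_eqP; rewrite ?cReM ?cImM /=.
      rewrite cRe_conj cIm_conj -/(X t) -/(Y t) XE //; ring.
    by rewrite cRe_conj cIm_conj -/(X t) -/(Y t) -speedE //; ring.
  have df t : K t -> is_deriveC t f (f t * kappa alpha a j (y t)).
    move=> Kt; have [f1 f2] := is_deriveC_solution sol j Kt.
    have [g1 g2] := is_deriveC_comp (is_deriveC_w psi n_gt0 alpha_ge0 a_gt0 j (y t)) (dy t Kt).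
    rewrite kap // in f1 f2; split.
      rewrite (_ : (fun _ => _) = fun t => complex.Re (z j t) - complex.Re (w j (y t))).
        apply: is_derive_eq (is_deriveBf f1 g1) _.
        by rewrite /kappa !cReM /f cReB cImB !cImM /=; ring.
      by apply/funext => u; rewrite cReB.
    rewrite (_ : (fun _ => _) = fun t => complex.Im (z j t) - complex.Im (w j (y t))).
      apply: is_derive_eq (is_deriveBf f2 g2) _.
      by rewrite /kappa !cImM /f cReB cImB !cReM /=; ring.
    by apply/funext => u; rewrite cImB.
  have D t : K t -> is_derive t 1 (fun t => normsq (f t) / rho j t) 0.
    move=> Kt; have rN0 : rho j t != 0 by rewrite gt_eqF // rho_gt0.
    apply: is_derive_eq (is_deriveMf (is_derive_normsq (df t Kt))
      (is_deriveVf rN0 (is_derive_modulus sol j Kt))) _.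
    rewrite mulrA [conjc _ * f t]mulrC mulcJ cReM /= mul0r subr0.
    rewrite -/(X t) XE // -/(rho j t) -/(X t).
    have rE : rho j t = rsq j (y t) by rewrite rhoE // vE.
    rewrite /c_re -rE mul0r subr0; by field.
  have := derive0_constant iK Ks Ks0 D.
  have f0 : f s0 = 0 by rewrite /f z0E y_s0 subrr.
  rewrite f0 [X in _ = X](_ : _ = 0).
    by move/eqP; rewrite mulf_eq0 invr_eq0 (gt_eqF (rho_gt0 j s Ks)) orbF => /eqP.
  by rewrite /normsq /= expr0n addr0 mul0r.
move=> s Ks; split; [exact: timeE|by move=> j; exact: zE|].
have pN0 : \prod_(k < n) z k s != 0 by apply/prodf_neq0 => k _; exact: zN0.
(* e^(i theta) is recovered from V and the product of the w_j *)
have conjE : conjc (exp_angle th s) = conjc (cis (theta (y s))).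
  apply: (mulIf pN0); rewrite -/(twisted_product z th s) -/(V s).
  rewrite (eq_bigr (fun k => w k (y s))); last by move=> k _; exact: zE.
  rewrite cis_theta_prod_w //; apply: complex_eqP; rewrite ?cReM ?cImM /= mul0r.
    by rewrite subr0 -cReM; exact: XE.
  by rewrite addr0 mulrN speedE // opprK -cImM.
by rewrite -[LHS]conjc_invol conjE conjc_invol.
Qed.

End classification.

(** * The explicit curve through given initial data *)

Section initial_data.
Variables (R : realType) (n : nat) (alpha : R).
Hypotheses (n_gt0 : (0 < n)%N) (alpha_ge0 : 0 <= alpha).

(** With V = e^(-i theta) w_1 ... w_n, the constants a_j are 1 / (|w_j|^2 - v),
where v >= 0 solves prod (|w_j|^2 - v) e^(- alpha v) = Im(V)^2.  Such a v
exists because the left-hand side is |V|^2 at v = 0 and vanishes at the least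
|w_j|^2.  Then y is the square root of v with the sign of Re V. *)
Lemma explicit_curve_through (r t : 'I_n -> R) (e : R[i]) :
  (forall j, 0 < r j) -> normsq e = 1 ->
  complex.Im (conjc e * \prod_(j < n) ((r j)%:C * cis (t j))) < 0 ->
  exists (a psi : 'I_n -> R) (y : R),
    [/\ forall j, 0 < a j, forall j, (r j)%:C * cis (t j) = w_fun alpha a psi j y &
        e = cis (theta_fun alpha a psi y)].
Proof.
move=> r0 e1; set Pi := \prod_(j < n) _; set V := conjc e * Pi => Y_lt0.
pose X := complex.Re V; pose Y := complex.Im V; rewrite -/Y in Y_lt0.
have VE : \prod_(j < n) r j ^+ 2 = X ^+ 2 + Y ^+ 2.
  transitivity (normsq V); last by [].
  rewrite /V normsqM normsq_conj e1 mul1r /Pi normsq_prod; apply: eq_bigr => j _.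
  by rewrite normsqM normsq_cis mulr1 /normsq /= expr0n addr0.
pose F v := \prod_(j < n) (r j ^+ 2 - v) * expR (- (alpha * v)).
have cF : continuous F.
  have sF : smooth_upto 0 setT F.
    apply: (smooth_uptoM openT).
      apply: (smooth_upto_prod _ _ openT) => j.
      apply: (smooth_uptoB openT); first exact: smooth_upto_cst.
      exact: (smooth_upto_id openT).
    apply: (smooth_upto_line_comp openT); first exact: smooth_upto_exp.
    apply: (smooth_uptoN openT); apply: (smooth_uptoM openT).
      exact: smooth_upto_cst.
    exact: (smooth_upto_id openT).
  by move=> v; apply: differentiable_continuous; exact: smooth_upto_diff sF _.
have [k kmin] : exists k, forall j, r k ^+ 2 <= r j ^+ 2.
  exists [arg min_(k < Ordinal n_gt0) r k ^+ 2]%O.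
  by case: arg_minP => // k _ h j; exact: h.
have Fk : F (r k ^+ 2) = 0.
  by rewrite /F (bigD1 k) //= subrr !mul0r.
have F0 : F 0 = X ^+ 2 + Y ^+ 2.
  by rewrite /F mulr0 oppr0 expR0 mulr1 -VE; apply: eq_bigr => j _; rewrite addr0.
have Y2 : 0 < Y ^+ 2 by rewrite exprn_even_gt0 //= lt_eqF.
have bounds : Num.min (F 0) (F (r k ^+ 2)) <= Y ^+ 2 <= Num.max (F 0) (F (r k ^+ 2)).
  by rewrite Fk F0 ge_min le_max sqr_ge0 orbT /= lerDr sqr_ge0.
have [v vk Fv] := IVT (sqr_ge0 (r k)) (continuous_subspaceT cF) bounds.
have /andP[v0 vk'] : 0 <= v <= r k ^+ 2 by move: vk; rewrite in_itv.
have {vk vk'} vk : v < r k ^+ 2.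
  rewrite lt_neqAle vk' andbT; apply/eqP => vE.
  by move: Y2; rewrite -Fv vE Fk ltxx.
have rv j : 0 < r j ^+ 2 - v by rewrite subr_gt0 (lt_le_trans vk).
pose a j := (r j ^+ 2 - v)^-1.
have a0 j : 0 < a j by rewrite invr_gt0.
pose y := if 0 <= X then Num.sqrt v else - Num.sqrt v.
have y2 : y ^+ 2 = v by rewrite /y; case: ifP => _; rewrite ?sqrrN sqr_sqrtr.
have rsqE j : rsq a j y = r j ^+ 2 by rewrite /rsq y2 invrK subrK.
have rE j : r_fun a j y = r j.
  by rewrite /r_fun -/(rsq a j y) rsqE sqrtr_sqr gtr0_norm.
have sp0 := speed_gt0 n_gt0 alpha_ge0 a0 y.
have p0 := profile_p_gt0 n_gt0 alpha_ge0 a0 y.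
have YE : Y = - (speed alpha a y * profile_p alpha a y).
  have pos : 0 < radius_product a * expR (- (alpha * y ^+ 2 / 2)).
    by rewrite mulr_gt0 ?expR_gt0 // radius_product_gt0.
  rewrite /speed divfK ?gt_eqF // -[LHS]opprK; congr (- _).
  apply/eqP; rewrite -(eqrXn2 (n := 2)) // ?(ltW pos) ?oppr_ge0 ?(ltW Y_lt0) //; apply/eqP.
  rewrite sqrrN -Fv /F exprMn -[in RHS]mulNr expR_half_sqr y2; congr (_ * _).
  rewrite expr2 -big_split /=; apply: eq_bigr => j _.
  by rewrite -expr2 r_fun_sqr // /rsq expr0n addr0 invrK.
have XE : X = speed alpha a y * y.
  have E : X ^+ 2 = (speed alpha a y * y) ^+ 2.
    transitivity (\prod_(j < n) r j ^+ 2 - Y ^+ 2); first by rewrite VE addrK.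
    have -> : \prod_(j < n) r j ^+ 2 = (\prod_(j < n) r_fun a j y) ^+ 2.
      by rewrite expr2 -big_split; apply: eq_bigr => j _; rewrite rE expr2.
    rewrite (prod_r_speed n_gt0 alpha_ge0 a0) YE sqrrN !exprMn profile_m_sqr.
    by ring.
  have [X0|X0] := leP 0 X.
    have y0 : 0 <= y by rewrite /y X0 sqrtr_ge0.
    have s0 : 0 <= speed alpha a y * y by rewrite mulr_ge0 // ltW.
    by apply/eqP; rewrite -(@eqrXn2 _ 2 X) // E.
  have y0 : 0 <= - y by rewrite /y ifN ?opprK ?sqrtr_ge0 // -ltNge.
  have s0 : 0 <= speed alpha a y * - y by rewrite mulr_ge0 // ltW.
  have X1 : 0 <= - X by rewrite oppr_ge0 ltW.
  rewrite -[LHS]opprK -[RHS]opprK -mulrN; congr (- _); apply/eqP.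
  by rewrite -(@eqrXn2 _ 2 (- X)) // mulrN !sqrrN E.
pose psi j := t j - phi_fun alpha a (fun=> 0) j y.
have phiE j : phi_fun alpha a psi j y = t j.
  by rewrite /phi_fun /psi /phi_fun add0r subrK.
have zE j : (r j)%:C * cis (t j) = w_fun alpha a psi j y.
  by rewrite /w_fun phiE rE mulrC.
exists a, psi, y; split=> //.
have wN0 : \prod_(j < n) w_fun alpha a psi j y != 0.
  by apply/prodf_neq0 => j _; exact: w_neq0.
suff E : conjc e = conjc (cis (theta_fun alpha a psi y)).
  by rewrite -[LHS]conjc_invol E conjc_invol.
apply: (mulIf wN0); rewrite cis_theta_prod_w // -(eq_bigr _ (fun j _ => zE j)) -/Pi -/V.
apply: complex_eqP; rewrite -?/X -?/Y ?cReM ?cImM ?XE ?YE /=; ring.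
Qed.

End initial_data.

(** * The explicit solutions with their angle *)

Section largest_solution.
Variables (R : realType) (n : nat) (alpha : R) (a psi : 'I_n -> R).
Hypotheses (n_gt0 : (0 < n)%N) (alpha_ge0 : 0 <= alpha) (a_gt0 : forall j, 0 < a j).
Implicit Types (y s c : R) (j : 'I_n).

Local Notation p := (profile_p alpha a).
Local Notation rsq := (rsq a).
Local Notation phi := (phi_fun alpha a psi).
Local Notation theta := (theta_fun alpha a psi).
Local Notation w := (w_fun alpha a psi).
Local Notation speed := (speed alpha a).

Let p_gt0 := profile_p_gt0 n_gt0 alpha_ge0 a_gt0.

Variables (J : set R) (Y : R -> R).
Hypotheses (J_itv : open_interval J)
  (dY : forall s, J s -> is_derive s 1 Y (speed (Y s)))
  (sY : forall k, smooth_upto k J Y).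

Let oJ : open J. Proof. by have [] := J_itv. Qed.

Lemma smooth_upto_theta k : smooth_upto k setT theta.
Proof.
apply: (smooth_uptoW (leqnSn k)).
apply: (smooth_upto_line openT (fun y _ => is_derive_theta psi n_gt0 alpha_ge0 a_gt0 y)).
apply: (smooth_uptoN openT); apply: (smooth_uptoM openT); first exact: smooth_upto_cst.
exact: smooth_upto_p.
Qed.

Lemma is_derive_theta_Y s : J s ->
  is_derive s 1 (fun s => theta (Y s)) (- (alpha * (speed (Y s) * p (Y s)))).
Proof.
move=> Js; apply: is_derive_eq (@is_derive_comp1 R R theta Y s 1 _ _
  (is_derive_theta psi n_gt0 alpha_ge0 a_gt0 (Y s)) (dY Js)) _.
by ring.
Qed.

Lemma smooth_upto_theta_Y k : smooth_upto k J (fun s => theta (Y s)).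
Proof. by apply: (smooth_upto_line_comp oJ); [exact: smooth_upto_theta|exact: sY]. Qed.

Lemma cisB_eq1 (x y : R) : cis x = cis y -> cis (x - y) = 1.
Proof.
move=> E; rewrite cisD E.
have -> : cis (- y) = conjc (cis y) by rewrite /cis cosN sinN.
by rewrite mulcJ normsq_cis.
Qed.

Lemma explicit_solution (th : angle_fun R) :
  (forall s, J s -> exp_angle th s = cis (theta (Y s))) -> smooth_angle J th ->
  (forall s, J s -> is_derive_angle s th (- (alpha * (speed (Y s) * p (Y s))))) ->
  solution alpha J (fun j s => w j (Y s)) th.
Proof.
move=> thE sth dth; split=> //.
- split=> // j; split; apply/smooth_onP => k.
    apply: (smooth_upto_eq oJ (f := fun s => wre alpha a psi j (Y s))).
      by move=> s _; rewrite w_funE.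
    by apply: (smooth_upto_line_comp oJ); [exact: smooth_upto_wre|exact: sY].
  apply: (smooth_upto_eq oJ (f := fun s => wim alpha a psi j (Y s))).
    by move=> s _; rewrite w_funE.
  by apply: (smooth_upto_line_comp oJ); [exact: smooth_upto_wim|exact: sY].
- by move=> j s _; exact: w_neq0.
- move=> j s Js; rewrite thE // system_rhs_w // /kappa mulrA mulrAC.
  exact: (is_deriveC_comp (is_deriveC_w psi n_gt0 alpha_ge0 a_gt0 j (Y s)) (dY Js)).
- move=> s Js; rewrite thE // unit_inv_conj ?normsq_cis // cis_theta_prod_w // cImM /=.
  by rewrite mul0r addr0 mulrN mulrN; exact: dth.
Qed.

Lemma explicit_solution_real k : cis k = 1 ->
  solution alpha J (fun j s => w j (Y s)) (RealAngle (fun s => theta (Y s) + k)).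
Proof.
move=> k1; apply: explicit_solution => /=.
- by move=> s _; rewrite cisD k1 mulr1.
- apply/smooth_onP => l; apply: (smooth_uptoD oJ); first exact: smooth_upto_theta_Y.
  exact: smooth_upto_cst.
- move=> s Js; apply: is_derive_eq (is_deriveDf (is_derive_theta_Y Js) (is_deriveCf s 1 k)) _.
  by rewrite addr0.
Qed.

Lemma explicit_solution_circle :
  solution alpha J (fun j s => w j (Y s)) (CircleAngle (fun s => cis (theta (Y s)))).
Proof.
apply: explicit_solution => //=.
- split; last by move=> s _; exact: cos2Dsin2.
  split; apply/smooth_onP => k; apply: (smooth_upto_line_comp oJ);
    by [have [] := smooth_upto_cos_sin R k|exact: smooth_upto_theta_Y].
- move=> s Js; split.
    apply: is_derive_eq (is_derive_cosf (is_derive_theta_Y Js)) _.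
    by rewrite cReM /=; ring.
  apply: is_derive_eq (is_derive_sinf (is_derive_theta_Y Js)) _.
  by rewrite cImM /=; ring.
Qed.

Lemma explicit_negative_first_integral s0 : J s0 -> Y s0 = 0 ->
  negative_first_integral alpha J (fun j s => w j (Y s)) (RealAngle (fun s => theta (Y s))).
Proof.
move=> Js0 Y0; exists s0, (- radius_product a); split; last first.
  by rewrite oppr_lt0 radius_product_gt0.
split=> //; exists (fun j s => r_fun a j (Y s)), (fun j s => phi j (Y s)), (fun s => theta (Y s)).
have polar s : [/\ \prod_(j < n) r_fun a j (Y s) * cos (\sum_(j < n) phi j (Y s) - theta (Y s))
      = speed (Y s) * Y s &
    \prod_(j < n) r_fun a j (Y s) * sin (\sum_(j < n) phi j (Y s) - theta (Y s))
      = - (speed (Y s) * p (Y s))].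
  have := cis_theta_prod_w psi n_gt0 alpha_ge0 a_gt0 (Y s).
  rewrite prod_w // -prod_r_speed // mulrA.
  have -> : conjc (cis (theta (Y s))) = cis (- theta (Y s)) by rewrite /cis cosN sinN.
  rewrite -cisD [- _ + _]addrC => /eqP; rewrite eq_complex cReM cImM.
  rewrite [in X in _ && X]cImM cReM /= => /andP[/eqP E1 /eqP E2]; split.
    by rewrite mulrC; move: E1; rewrite mulr0 subr0 mul0r subr0.
  by rewrite mulrC -mulrN; move: E2; rewrite mulr0 add0r mul0r addr0.
split=> //=.
- by move=> j s _; split; [exact: r_fun_gt0|rewrite /w_fun mulrC].
- move=> s Js; set u := 2 * _.
  have uE : u = Y s ^+ 2.
    have dY2 t : J t -> is_derive t 1 (fun t => Y t ^+ 2 / 2) (\prod_(j < n) r_fun a j (Y t) *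
        cos (\sum_(j < n) phi j (Y t) - theta (Y t))).
      move=> Jt; have [-> _] := polar t.
      apply: is_derive_eq (is_deriveMf (@is_derive_comp1 R R (fun z => z ^+ 2) Y t 1 _ _
        (is_derive_sqr (Y t)) (dY Jt)) (is_deriveCf t 1 2^-1)) _.
      by field.
    have [_ iJ _] := J_itv.
    rewrite /u (oriented_integral_primitive iJ Js0 Js dY2); last first.
      move=> t Jt; apply: differentiable_continuous.
      apply: (@smooth_upto_diff R 0%N R R J) => //.
      apply: (smooth_uptoM oJ).
        apply: (smooth_upto_prod _ _ oJ) => j.
        by apply: (smooth_upto_line_comp oJ); [exact: smooth_upto_r|exact: sY].
      apply: (smooth_upto_line_comp oJ); first by have [] := smooth_upto_cos_sin R 0.
      apply: (smooth_uptoB oJ); last exact: smooth_upto_theta_Y.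
      apply: (smooth_upto_sum _ _ oJ) => j.
      by apply: (smooth_upto_line_comp oJ); [exact: smooth_upto_phi|exact: sY].
    by rewrite Y0 expr0n mul0r subr0 mulrC divfK // pnatr_eq0.
  have -> : \prod_(j < n) (r_fun a j (Y s0) ^+ 2 + u) = (\prod_(j < n) r_fun a j (Y s)) ^+ 2.
    rewrite expr2 -big_split /=; apply: eq_bigr => j _.
    by rewrite -expr2 !r_fun_sqr // uE Y0 /rsq expr0n addr0.
  rewrite sqrtr_sqr gtr0_norm; last by apply: prodr_gt0 => j _; exact: r_fun_gt0.
  rewrite mulrAC; have [_ ->] := polar s.
  rewrite uE /speed expRN; field.
  by rewrite !gt_eqF ?expR_gt0 ?p_gt0.
Qed.

End largest_solution.

(** * Largest extensions *)

Section maximality.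
Variables (R : realType) (n : nat) (alpha : R).
Hypotheses (n_gt0 : (0 < n)%N) (alpha_ge0 : 0 <= alpha).

(** By [solution_is_explicit], an extension of the given solution runs along the
explicit one, hence stays in the range of the time function. *)
Lemma largest_explicit (a psi : 'I_n -> R) I (z : 'I_n -> R -> R[i]) th s0 y0 c Y :
  (forall j, 0 < a j) -> solution alpha I z th -> I s0 ->
  (forall j, z j s0 = w_fun alpha a psi j y0) ->
  exp_angle th s0 = cis (theta_fun alpha a psi y0) -> time alpha a c y0 = s0 ->
  open_interval (range (time alpha a c)) ->
  (forall y, Y (time alpha a c y) = y) ->
  (forall s, range (time alpha a c) s -> is_derive s 1 Y (speed alpha a (Y s))) ->
  (forall k, smooth_upto k (range (time alpha a c)) Y) ->
  exists th', largest_extension alpha I z th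
    (range (time alpha a c)) (fun j s => w_fun alpha a psi j (Y s)) th'.
Proof.
set J := range _; move=> a_gt0 sol Is0 zE eE tE oJ YK dY sY.
pose w := w_fun alpha a psi; pose theta := theta_fun alpha a psi.
have Ys0 : Y s0 = y0 by rewrite -tE YK.
have along K z2 th2 : extension alpha I z th K z2 th2 ->
    [/\ K `<=` J, forall j s, K s -> z2 j s = w j (Y s) &
        forall s, K s -> exp_angle th2 s = cis (theta (Y s))].
  move=> [IK sol2 z2E thE]; have Ks0 := IK _ Is0.
  have e2 : exp_angle th2 s0 = cis (theta y0).
    rewrite -eE; move: thE; rewrite /eq_angle_on.
    by case: th th2 {sol sol2 eE} => [t|e] [t2|e2] //= /(_ _ Is0) ->.
  have [|y yE] := solution_is_explicit n_gt0 alpha_ge0 a_gt0 sol2 Ks0 _ e2 tE.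
    by move=> j; rewrite -z2E.
  have yY s : K s -> y s = Y s by move=> /yE[ts _ _]; rewrite -{2}ts YK.
  split.
  - by move=> s /yE[<- _ _]; exists (y s).
  - by move=> j s Ks; have [_ -> _] := yE _ Ks; rewrite yY.
  - by move=> s Ks; have [_ _ ->] := yE _ Ks; rewrite yY.
have refl_ext : extension alpha I z th I z th.
  by split=> //; case: (th).
have [IJ zI eI] := along _ _ _ refl_ext.
(* a real angle differs from the explicit one by a constant multiple of 2 pi *)
have real_angle K z2 t2 : solution alpha K z2 (RealAngle t2) -> K `<=` J -> K s0 ->
    (forall j s, K s -> z2 j s = w j (Y s)) ->
    (forall s, K s -> cis (t2 s) = cis (theta (Y s))) ->
    forall s, K s -> t2 s = theta (Y s) + (t2 s0 - theta (Y s0)).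
  move=> sol2 KJ Ks0 z2E t2E s Ks.
  have [[_ iK _] _ _ _ dt2] := sol2.
  have D u : K u -> is_derive u 1 (fun u => t2 u - theta (Y u)) 0.
    move=> Ku; have := dt2 u Ku => /= d2.
    apply: is_derive_eq (is_deriveBf d2
      (is_derive_theta_Y psi n_gt0 alpha_ge0 a_gt0 dY (KJ _ Ku))) _.
    rewrite (eq_bigr (fun k => w k (Y u))); last by move=> k _; exact: z2E.
    rewrite t2E // unit_inv_conj ?normsq_cis // cis_theta_prod_w // cImM /=.
    by ring.
  by rewrite -(derive0_constant iK Ks Ks0 D); ring.
pose lift th := match th with
  | RealAngle t => RealAngle (fun s => theta (Y s) + (t s0 - theta (Y s0)))
  | CircleAngle _ => CircleAngle (fun s => cis (theta (Y s))) end.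
have sol' : solution alpha J (fun j s => w j (Y s)) (lift th).
  rewrite /lift; case: th eE {sol along refl_ext eI} => [t|e] /= eE.
    apply: explicit_solution_real => //; apply: cisB_eq1.
    by rewrite Ys0.
  exact: explicit_solution_circle.
have eq_th' K z2 th2 : extension alpha I z th K z2 th2 -> eq_angle_on K th2 (lift th).
  move=> ext; have [KJ z2E eE2] := along _ _ _ ext.
  have [IK sol2 _ thE] := ext; have Ks0 := IK _ Is0.
  rewrite /lift; case: th thE {sol eE ext along refl_ext eI sol'} => [t|e];
    case: th2 sol2 eE2 => [t2|e2] //= sol2 eE2 thE s Ks.
    by rewrite thE // (real_angle K z2 t2).
exists (lift th); split.
  by split=> //; exact: eq_th' refl_ext.
move=> K z2 th2 ext; have [KJ z2E _] := along _ _ _ ext.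
by split=> //; exact: eq_th' ext.
Qed.

Lemma sweep_reparametrization (J : set R) (z z' : 'I_n -> R -> R[i]) (Y : R -> R) :
  set_bij J setT Y -> (forall j s, J s -> z j s = z' j (Y s)) ->
  sweep J z = sweep setT z'.
Proof.
move=> [_ _ Ysurj] zE; have swE x s : J s -> sweep_point z x s = sweep_point z' x (Y s).
  by move=> Js; congr realify; apply/rowP => j; rewrite !mxE zE.
apply/seteqP; split=> q [x [s [ux Js ->]]].
  by exists x, (Y s); split=> //; rewrite swE.
have [t Jt <-] := Ysurj s Logic.I.
by exists x, t; split=> //; rewrite swE.
Qed.

Lemma change_of_variables_speed (a psi : 'I_n -> R) (J : set R) z (Y : R -> R) :
  (forall j, 0 < a j) -> set_bij J setT Y ->
  (forall s, J s -> is_derive s 1 Y (speed alpha a (Y s))) ->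
  (forall k, smooth_upto k J Y) ->
  (forall j s, J s -> z j s = w_fun alpha a psi j (Y s)) ->
  change_of_variables alpha a psi J z Y.
Proof.
move=> a_gt0 bY dY sY zE; split=> //; first exact/smooth_onP.
move=> s Js; rewrite derive1E; have [_ ->] := dY s Js.
by rewrite gt_eqF // speed_gt0.
Qed.

(** At s0, the first integral A has the sign of Im V, so that the initial data lie
on an explicit curve; the origin c of time is chosen to match s0. *)
Lemma negative_solution_extends I (z : 'I_n -> R -> R[i]) th :
  solution alpha I z th -> negative_first_integral alpha I z th ->
  exists (a psi : 'I_n -> R) (J : set R) (Y : R -> R) th',
    [/\ forall j, 0 < a j, set_bij J setT Y,
      forall s, J s -> is_derive s 1 Y (speed alpha a (Y s)),
      forall k, smooth_upto k J Y &
      largest_extension alpha I z th J (fun j s => w_fun alpha a psi j (Y s)) th'].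
Proof.
move=> sol [s0 [A [[Is0 [r [phi [t [rE tE AE]]]] A_lt0]]]].
have r0 j : 0 < r j s0 by have [] := rE j s0 Is0.
have ImV : complex.Im (conjc (exp_angle th s0) *
    \prod_(j < n) ((r j s0)%:C * cis (phi j s0))) < 0.
  have -> : conjc (exp_angle th s0) * \prod_(j < n) ((r j s0)%:C * cis (phi j s0)) =
      (\prod_(j < n) r j s0)%:C * cis (\sum_(j < n) phi j s0 - t s0).
    rewrite tE // big_split /= rmorph_prod cisD cis_sum mulrCA; congr (_ * _).
    by rewrite mulrC; congr (_ * _); rewrite /cis cosN sinN.
  rewrite cImM /= mul0r addr0 pmulr_rlt0; last by apply: prodr_gt0.
  have /= := AE s0 Is0; rewrite oriented_integral_id mulr0 mulr0 mul0r expR0 mulr1 => E.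
  move: A_lt0; rewrite -E pmulr_rlt0 // sqrtr_gt0; apply: prodr_gt0 => j _.
  by rewrite addr0 exprn_gt0.
have [a [psi [y0 [a_gt0 zE eE]]]] :=
  explicit_curve_through n_gt0 alpha_ge0 r0 (exp_angle_unit sol Is0) ImV.
pose c := s0 - time alpha a 0 y0.
have tc : time alpha a c y0 = s0 by rewrite /time /c /time; ring.
have [Y [oJ bY YK dY sY]] := time_inverse n_gt0 alpha_ge0 a_gt0 c.
have [|th' ext] := largest_explicit (th := th) a_gt0 sol Is0 _ eE tc oJ YK dY sY.
  by move=> j; have [_ ->] := rE j s0 Is0.
by exists a, psi, (range (time alpha a c)), Y, th'.
Qed.

Lemma largest_extension_unique I (z : 'I_n -> R -> R[i]) th J w th' J2 w2 th2 :
  largest_extension alpha I z th J w th' -> largest_extension alpha I z th J2 w2 th2 ->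
  J = J2 /\ forall j s, J s -> w j s = w2 j s.
Proof.
move=> [e1 l1] [e2 l2]; have [J21 _ _] := l1 _ _ _ e2; have [J12 wE _] := l2 _ _ _ e1.
by split=> //; apply/seteqP.
Qed.

End maximality.

(** * Solutions and explicit curves *)

Section theorem_parts.
Variables (R : realType) (n : nat) (alpha : R).
Hypotheses (n_gt0 : (0 < n)%N) (alpha_ge0 : 0 <= alpha).

Lemma solutions_are_explicit I (w : 'I_n -> R -> R[i]) (th : angle_fun R) :
  solution alpha I w th -> negative_first_integral alpha I w th ->
  (exists! J : set R, exists w' th', largest_extension alpha I w th J w' th') /\
  (forall J w' th', largest_extension alpha I w th J w' th' ->
    exists (a psi : 'I_n -> R) (y : R -> R),
      [/\ forall j, 0 < a j, change_of_variables alpha a psi J w' y &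
          sweep J w' = L_fun alpha a psi]).
Proof.
move=> sol neg.
have [a [psi [J [Y [th' [a_gt0 bY dY sY ext]]]]]] :=
  negative_solution_extends n_gt0 alpha_ge0 sol neg.
split.
  exists J; split; first by exists (fun j s => w_fun alpha a psi j (Y s)), th'.
  by move=> J2 [w2 [th2 ext2]]; have [] := largest_extension_unique ext ext2.
move=> J2 w2 th2 ext2; have [JE wE] := largest_extension_unique ext ext2.
rewrite -JE; exists a, psi, Y; split=> //.
  by apply: change_of_variables_speed => // j s Js; rewrite wE.
by apply: sweep_reparametrization bY _ => j s Js; rewrite wE.
Qed.

Lemma explicit_curves_arise (a psi : 'I_n -> R) : (forall j, 0 < a j) ->
  exists (I : set R) (w : 'I_n -> R -> R[i]) (th : angle_fun R) (y : R -> R),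
    [/\ solution alpha I w th, negative_first_integral alpha I w th,
        largest_extension alpha I w th I w th,
        change_of_variables alpha a psi I w y &
        sweep I w = L_fun alpha a psi].
Proof.
move=> a_gt0; have [Y [oJ bY YK dY sY]] := time_inverse n_gt0 alpha_ge0 a_gt0 0.
set J := range _ in oJ bY dY sY.
pose w j s := w_fun alpha a psi j (Y s).
pose th := RealAngle (fun s => theta_fun alpha a psi (Y s)).
have sol : solution alpha J w th.
  have := explicit_solution_real psi n_gt0 alpha_ge0 a_gt0 oJ dY sY (k := 0).
  rewrite /th (_ : (fun s => _ + 0) = fun s => theta_fun alpha a psi (Y s)).
    by apply; rewrite /cis cos0 sin0.
  by apply/funext => s; rewrite addr0.
have J0 : J (time alpha a 0 0) by exists 0.
have Y0 : Y (time alpha a 0 0) = 0 by rewrite YK.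
exists J, w, th, Y; split.
- exact: sol.
- exact: explicit_negative_first_integral oJ dY sY _ J0 Y0.
- have [||th' [[_ _ _ eJ] l]] := largest_explicit (th := th) (y0 := 0) (psi := psi)
      n_gt0 alpha_ge0 a_gt0 sol J0 _ _ erefl oJ YK dY sY.
  + by move=> j; rewrite /w Y0.
  + by rewrite /= Y0.
  split=> [|K z2 th2 /l[KJ zE eE]]; first by split.
  split=> //; move: eE eJ; rewrite /th.
  by case: th2 th' {l} => [t2|e2] [t'|e'] //= t2E eJ s Ks; rewrite t2E // eJ //; exact: KJ.
- exact: change_of_variables_speed.
- exact: sweep_reparametrization bY _.
Qed.

End theorem_parts.

(** * Recovering the sphere and line coordinates of a point of L *)

Section embedding.
Variables (R : realType) (n : nat) (alpha : R) (a psi : 'I_n -> R).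
Hypotheses (n_gt0 : (0 < n)%N) (alpha_ge0 : 0 <= alpha) (a_gt0 : forall j, 0 < a j).
Implicit Types (y : R) (x : 'rV[R]_n) (q : 'rV[R]_(n + n)) (j k : 'I_n).

Local Notation rsq := (rsq a).
Local Notation phi := (phi_fun alpha a psi).
Local Notation wre := (wre alpha a psi).
Local Notation wim := (wim alpha a psi).
Local Notation Psi := (sweep_point (w_fun alpha a psi)).
Local Notation L := (L_fun alpha a psi).

Let rsq_gt0 := rsq_gt0 a_gt0.
Let rsq_neq0 := rsq_neq0 a_gt0.

Lemma sweep_point_re x y j : Psi x y 0 (lshift n j) = x 0 j * wre j y.
Proof. by rewrite /sweep_point /realify row_mxEl !mxE w_funE cReM /= mul0r subr0. Qed.

Lemma sweep_point_im x y j : Psi x y 0 (rshift n j) = x 0 j * wim j y.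
Proof. by rewrite /sweep_point /realify row_mxEr !mxE w_funE cImM /= mul0r addr0. Qed.

Lemma unit_sphere_coord x : unit_sphere x -> exists k, x 0 k != 0.
Proof.
move=> ux; apply/existsP; apply: contrapT => /negP; rewrite negb_exists => /forallP h.
move: ux; rewrite /unit_sphere /= big1 => [/esym/eqP|j _]; first by rewrite oner_eq0.
by have := h j; rewrite negbK => /eqP ->; rewrite expr0n.
Qed.

(** The coordinate z_k = x_k w_k of a point of L, divided by e^(i psi_k), has an
argument in ]-pi/2, pi/2[ up to the sign of x_k (see [phi_range]).  Its tangent
determines phi_k(y), hence y, and does so smoothly in the ambient space. *)
Definition rotated_re k q := cos (psi k) * q 0 (lshift n k) + sin (psi k) * q 0 (rshift n k).
Definition rotated_im k q := cos (psi k) * q 0 (rshift n k) - sin (psi k) * q 0 (lshift n k).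
Definition phase k q := psi k + atan (rotated_im k q / rotated_re k q).
(** The second condition lets [phase] be inverted off L as well, so that chart
inverses are defined on an open set of the ambient space. *)
Definition chart_domain k : set 'rV[R]_(n + n) :=
  [set q | rotated_re k q != 0 /\ range (phi k) (phase k q)].

Lemma rotated_re_sweep k x y :
  rotated_re k (Psi x y) = x 0 k * (r_fun a k y * cos (phi k y - psi k)).
Proof.
rewrite /rotated_re sweep_point_re sweep_point_im /wre /wim cosB; ring.
Qed.

Lemma rotated_im_sweep k x y :
  rotated_im k (Psi x y) = x 0 k * (r_fun a k y * sin (phi k y - psi k)).
Proof.
rewrite /rotated_im sweep_point_re sweep_point_im /wre /wim sinB; ring.
Qed.

Lemma rotated_radius_gt0 k y : 0 < r_fun a k y * cos (phi k y - psi k).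
Proof.
by rewrite mulr_gt0 ?r_fun_gt0 // cos_gt0_pihalf // phi_range.
Qed.

Lemma rotated_re_sweep_eq0 k x y : (rotated_re k (Psi x y) == 0) = (x 0 k == 0).
Proof. by rewrite rotated_re_sweep mulf_eq0 (gt_eqF (rotated_radius_gt0 k y)) orbF. Qed.

Lemma phase_sweep k x y : x 0 k != 0 -> phase k (Psi x y) = phi k y.
Proof.
move=> xk; have c0 : cos (phi k y - psi k) != 0.
  by rewrite gt_eqF // cos_gt0_pihalf // phi_range.
rewrite /phase rotated_re_sweep rotated_im_sweep.
have -> : x 0 k * (r_fun a k y * sin (phi k y - psi k)) /
    (x 0 k * (r_fun a k y * cos (phi k y - psi k))) = tan (phi k y - psi k).
  by rewrite /tan; field; rewrite c0 xk gt_eqF // r_fun_gt0.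
rewrite tanK; first by rewrite addrC subrK.
by rewrite in_itv /=; exact: phi_range.
Qed.

Lemma chart_domain_sweep k x y : x 0 k != 0 -> chart_domain k (Psi x y).
Proof.
move=> xk; split; first by rewrite rotated_re_sweep_eq0.
by rewrite phase_sweep //; exists y.
Qed.

Lemma phi_inverse k : exists g : R -> R, [/\ forall y, g (phi k y) = y,
  open (range (phi k)) & forall l, smooth_upto l (range (phi k)) g].
Proof.
have h0 y : 0 < profile_p alpha a y / rsq k y by rewrite divr_gt0 // profile_p_gt0.
have [g [gK oP _ _ sg]] := smooth_inverse
  (fun y => is_derive_phi psi n_gt0 alpha_ge0 a_gt0 k y) h0
  (fun l => @smooth_upto_dphi _ _ _ _ n_gt0 alpha_ge0 a_gt0 l k).
by exists g.
Qed.

Definition phi_inv k : R -> R := projT1 (cid (phi_inverse k)).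

Lemma phi_invK k y : phi_inv k (phi k y) = y.
Proof. by rewrite /phi_inv; case: cid => g /= []. Qed.

Lemma open_range_phi k : open (range (phi k)).
Proof. by have [g []] := phi_inverse k. Qed.

Lemma smooth_upto_phi_inv l k : smooth_upto l (range (phi k)) (phi_inv k).
Proof. by rewrite /phi_inv; case: cid => g /= []. Qed.

Definition height k q := phi_inv k (phase k q).

(** The sphere coordinate x_j is Re (z_j conj(w_j)) / |w_j|^2. *)
Definition sphere_coord q y j :=
  (q 0 (lshift n j) * wre j y + q 0 (rshift n j) * wim j y) / rsq j y.

Lemma height_sweep k x y : x 0 k != 0 -> height k (Psi x y) = y.
Proof. by move=> xk; rewrite /height phase_sweep // phi_invK. Qed.

Lemma sphere_coord_sweep x y j : sphere_coord (Psi x y) y j = x 0 j.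
Proof.
rewrite /sphere_coord sweep_point_re sweep_point_im.
rewrite (_ : _ + _ = x 0 j * (wre j y ^+ 2 + wim j y ^+ 2)); last by ring.
by rewrite w_normsq // mulfK.
Qed.

Lemma sweep_point_inj x y x' y' : unit_sphere x ->
  Psi x y = Psi x' y' -> x = x' /\ y = y'.
Proof.
move=> ux E; have [k xk] := unit_sphere_coord ux.
have xk' : x' 0 k != 0 by rewrite -(rotated_re_sweep_eq0 k x' y') -E rotated_re_sweep_eq0.
have yE : y = y' by rewrite -(height_sweep y xk) E height_sweep.
split; last exact: yE.
by apply/rowP => j; rewrite -(sphere_coord_sweep x y j) E -yE yE sphere_coord_sweep.
Qed.

Section smooth_along.
Variables (V : normedModType R) (U : set V) (Z : V -> 'rV[R]_(n + n)) (l : nat).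
Hypotheses (oU : open U) (sZ : smooth_upto l U Z).

Let sZc i : smooth_upto l U (fun v => Z v 0 i).
Proof. exact: smooth_upto_coord. Qed.

Lemma smooth_upto_rotated_re k : smooth_upto l U (fun v => rotated_re k (Z v)).
Proof.
by apply: (smooth_uptoD oU); apply: (smooth_uptoM oU) => //; exact: smooth_upto_cst.
Qed.

Lemma smooth_upto_rotated_im k : smooth_upto l U (fun v => rotated_im k (Z v)).
Proof.
by apply: (smooth_uptoB oU); apply: (smooth_uptoM oU) => //; exact: smooth_upto_cst.
Qed.

Lemma smooth_upto_atan : smooth_upto l setT (@atan R).
Proof.
apply: (smooth_uptoW (leqnSn l)).
apply: (smooth_upto_line openT (g := fun t : R => (1 + t ^+ 2)^-1)).
apply: (smooth_uptoV openT) => [x _|]; first by rewrite gt_eqF // ltr_wpDr ?sqr_ge0.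
apply: (smooth_uptoD openT); first exact: smooth_upto_cst.
by apply: (smooth_uptoX openT); exact: (smooth_upto_id openT).
Qed.

Lemma smooth_upto_phase k : (forall v, U v -> rotated_re k (Z v) != 0) ->
  smooth_upto l U (fun v => phase k (Z v)).
Proof.
move=> h; apply: (smooth_uptoD oU); first exact: smooth_upto_cst.
apply: (smooth_upto_line_comp oU); first exact: smooth_upto_atan.
apply: (smooth_upto_div oU) => //.
  exact: smooth_upto_rotated_im.
exact: smooth_upto_rotated_re.
Qed.

Lemma smooth_upto_height k : (forall v, U v -> chart_domain k (Z v)) ->
  smooth_upto l U (fun v => height k (Z v)).
Proof.
move=> h; apply: (smooth_upto_comp (f := phi_inv k) oU (@open_range_phi k)).
- by move=> v /h[].
- exact: smooth_upto_phi_inv.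
- by apply: smooth_upto_phase => v /h[].
Qed.

Lemma smooth_upto_sphere_coord (y : V -> R) j : smooth_upto l U y ->
  smooth_upto l U (fun v => sphere_coord (Z v) (y v) j).
Proof.
move=> sy; apply: (smooth_upto_div oU) => [v _||]; first exact: rsq_neq0.
- apply: (smooth_uptoD oU); apply: (smooth_uptoM oU); try exact: sZc.
    by apply: (smooth_upto_line_comp oU) sy; exact: smooth_upto_wre.
  by apply: (smooth_upto_line_comp oU) sy; exact: smooth_upto_wim.
- by apply: (smooth_upto_line_comp oU) sy; exact: smooth_upto_rsq.
Qed.

End smooth_along.

Lemma smooth_upto_idV (V : normedModType R) l (U : set V) : open U -> smooth_upto l U id.
Proof.
move=> oU; case: l => [|l].
  by case=> [|//] x _ _; exact: ex_diff.
apply: (@smooth_uptoS_is_derive R l V V U id (fun v _ => v) oU).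
- by move=> x _; exact: ex_diff.
- by move=> v; exact: smooth_upto_cst.
Qed.

Lemma open_chart_domain k : open (chart_domain k).
Proof.
have sR : continuous (rotated_re k).
  move=> q; apply: differentiable_continuous.
  apply: (@smooth_upto_diff R 0%N _ _ setT) => //.
  exact: (@smooth_upto_rotated_re _ setT id 0%N openT (@smooth_upto_idV _ 0 _ openT) k).
have oA : open [set q | rotated_re k q != 0].
  by apply: (open_comp (f := rotated_re k)) (@open_neq0 R) => q _; exact: sR.
rewrite openE => q [qa qr]; rewrite /interior.
have cph : {for q, continuous (phase k)}.
  apply: differentiable_continuous.
  apply: (@smooth_upto_diff R 0%N _ _ [set q | rotated_re k q != 0]) => //.
  apply: (@smooth_upto_phase _ _ id 0%N oA (@smooth_upto_idV _ 0 _ oA) k).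
  by move=> v.
have n1 : nbhs q [set q | rotated_re k q != 0] by exact: open_nbhs_nbhs.
have n2 : nbhs q (phase k @^-1` range (phi k)).
  by apply: cph; apply: open_nbhs_nbhs; split => //; exact: open_range_phi.
by apply: filterS (filterI n1 n2) => z [].
Qed.

End embedding.

(** * Charts of L *)

Section charts.
Variables (R : realType) (n : nat) (alpha : R) (a psi : 'I_n -> R).
Hypotheses (n_gt0 : (0 < n)%N) (alpha_ge0 : 0 <= alpha) (a_gt0 : forall j, 0 < a j).
Implicit Types (y : R) (x u : 'rV[R]_n) (q : 'rV[R]_(n + n)) (j k : 'I_n).

Local Notation rsq := (rsq a).
Local Notation wre := (wre alpha a psi).
Local Notation wim := (wim alpha a psi).
Local Notation Psi := (sweep_point (w_fun alpha a psi)).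
Local Notation L := (L_fun alpha a psi).
Local Notation height := (height psi n_gt0 alpha_ge0 a_gt0).
Local Notation sphere_coord := (sphere_coord alpha a psi).
Local Notation chart_domain := (chart_domain alpha a psi).

Lemma smooth_upto_sweep (V : normedModType R) l (U : set V) (xi : V -> 'rV[R]_n) (eta : V -> R) :
  open U -> (forall j, smooth_upto l U (fun v => xi v 0 j)) -> smooth_upto l U eta ->
  smooth_upto l U (fun v => Psi (xi v) (eta v)).
Proof.
move=> oU sxi seta; apply: (smooth_upto_mx oU) => i j; rewrite (ord1 i).
case: (split_ordP j) => k ->.
  apply: (smooth_upto_eq oU (f := fun v => xi v 0 k * wre k (eta v))).
    by move=> v _; rewrite sweep_point_re.
  apply: (smooth_uptoM oU) => //; apply: (smooth_upto_line_comp oU) seta.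
  exact: smooth_upto_wre.
apply: (smooth_upto_eq oU (f := fun v => xi v 0 k * wim k (eta v))).
  by move=> v _; rewrite sweep_point_im.
apply: (smooth_uptoM oU) => //; apply: (smooth_upto_line_comp oU) seta.
exact: smooth_upto_wim.
Qed.

(** Charts of the sphere as graphs over a coordinate hyperplane, with the height
y in place of the missing coordinate k; the sign [eps] of x_k multiplies
the height, so that all these charts have the same orientation. *)
Definition hemisphere k (eps : R) u : 'rV[R]_n :=
  \row_j (if j == k then eps * Num.sqrt (1 - \sum_(i < n | i != k) u 0 i ^+ 2) else u 0 j).

Definition graph_chart k (eps : R) u := Psi (hemisphere k eps u) (eps * u 0 k).

Definition graph_chart_source k : set 'rV[R]_n :=
  [set u | 0 < 1 - \sum_(i < n | i != k) u 0 i ^+ 2].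

Definition graph_chart_target k (eps : R) : set 'rV[R]_(n + n) :=
  chart_domain k `&` [set q | 0 < eps * rotated_re psi k q].

Definition graph_chart_inv k (eps : R) q : 'rV[R]_n :=
  \row_j (if j == k then eps * height k q else sphere_coord q (height k q) j).

Let smooth_radius l k : smooth_upto l setT
  (fun u : 'rV[R]_n => 1 - \sum_(i < n | i != k) u 0 i ^+ 2).
Proof.
apply: (smooth_uptoB openT); first exact: smooth_upto_cst.
apply: (smooth_upto_sum _ _ openT) => i; apply: (smooth_uptoX openT).
exact: smooth_upto_proj openT.
Qed.

Lemma open_graph_chart_source k : open (graph_chart_source k).
Proof.
apply: (open_comp (f := fun u : 'rV[R]_n => 1 - \sum_(i < n | i != k) u 0 i ^+ 2))
  (@open_gt0 R) => u _.
apply: differentiable_continuous.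
exact: (@smooth_upto_diff R 0%N _ _ setT _ _ (@smooth_radius 0%N k)).
Qed.

Lemma open_graph_chart_target k eps : open (graph_chart_target k eps).
Proof.
apply: openI; first exact: open_chart_domain.
apply: (open_comp (f := fun q => eps * rotated_re psi k q)) (@open_gt0 R) => q _.
apply: differentiable_continuous.
apply: (@smooth_upto_diff R 0%N _ _ setT) => //.
apply: (smooth_uptoM openT); first exact: smooth_upto_cst.
exact: (@smooth_upto_rotated_re _ _ psi _ setT id 0%N openT (@smooth_upto_idV _ _ 0%N _ openT) k).
Qed.

Lemma smooth_upto_hemisphere l k eps j :
  smooth_upto l (graph_chart_source k) (fun u => hemisphere k eps u 0 j).
Proof.
have oU := @open_graph_chart_source k.
have [->|jk] := eqVneq j k.
  apply: (smooth_upto_eq oU (f := fun u => eps * Num.sqrt (1 - \sum_(i < n | i != k) u 0 i ^+ 2))).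
    by move=> u _; rewrite mxE eqxx.
  apply: (smooth_uptoM oU); first exact: smooth_upto_cst.
  apply: (smooth_upto_sqrt oU) => [u //|].
  by apply: smooth_upto_sub (@smooth_radius l k).
apply: (smooth_upto_eq oU (f := fun u => u 0 j)).
  by move=> u _; rewrite mxE (negbTE jk).
exact: smooth_upto_proj oU.
Qed.

Lemma smooth_upto_graph_height l k eps (U : set 'rV[R]_n) : open U ->
  smooth_upto l U (fun u : 'rV[R]_n => eps * u 0 k).
Proof.
move=> oU; apply: (smooth_uptoM oU); first exact: smooth_upto_cst.
exact: smooth_upto_proj oU.
Qed.

Lemma smooth_upto_graph_chart l k eps :
  smooth_upto l (graph_chart_source k) (graph_chart k eps).
Proof.
have oU := @open_graph_chart_source k.
apply: (smooth_upto_sweep oU).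
  by move=> j; exact: smooth_upto_hemisphere.
exact: smooth_upto_graph_height.
Qed.

Lemma smooth_upto_graph_chart_inv l k eps :
  smooth_upto l (graph_chart_target k eps) (graph_chart_inv k eps).
Proof.
have oW := @open_graph_chart_target k eps.
have sid := @smooth_upto_idV R 'rV[R]_(n + n) l _ oW.
have sh : smooth_upto l (graph_chart_target k eps) (height k).
  by apply: (smooth_upto_height n_gt0 alpha_ge0 a_gt0 oW sid) => q [].
apply: (smooth_upto_mx oW) => i j; rewrite (ord1 i).
have [->|jk] := eqVneq j k.
  apply: (smooth_upto_eq oW (f := fun q => eps * height k q)).
    by move=> u _; rewrite mxE eqxx.
  by apply: (smooth_uptoM oW) sh; exact: smooth_upto_cst.
apply: (smooth_upto_eq oW (f := fun q => sphere_coord q (height k q) j)).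
  by move=> u _; rewrite mxE (negbTE jk).
exact: (smooth_upto_sphere_coord psi n_gt0 alpha_ge0 a_gt0 oW sid).
Qed.

Lemma sum_sqr_hemisphere k (eps : R) u : eps ^+ 2 = 1 -> graph_chart_source k u ->
  unit_sphere (hemisphere k eps u).
Proof.
move=> e1 uV; rewrite /unit_sphere /= (bigD1 k) //= mxE eqxx exprMn e1 mul1r.
rewrite sqr_sqrtr ?ltW // [X in _ + X](eq_bigr (fun i => u 0 i ^+ 2)).
  exact: subrK.
by move=> i ik; rewrite mxE (negbTE ik).
Qed.

Lemma sweep_in_L x y : unit_sphere x -> L (Psi x y).
Proof. by move=> ux; exists x, y. Qed.

Lemma local_param_graph_chart k (eps : R) : eps ^+ 2 = 1 ->
  local_param L (graph_chart_source k) (graph_chart k eps).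
Proof.
move=> e1; have ee : eps * eps = 1 by rewrite -expr2.
split; first exact: open_graph_chart_source.
exists (graph_chart_target k eps), (graph_chart_inv k eps).
split; first exact: open_graph_chart_target.
split.
- move=> u uV; exists (graph_chart_source k), (graph_chart k eps); split=> //.
    exact: open_graph_chart_source.
  by apply/smooth_onP => l; exact: smooth_upto_graph_chart.
- move=> q [_ qW]; exists (graph_chart_target k eps), (graph_chart_inv k eps); split=> //.
    exact: open_graph_chart_target.
  by apply/smooth_onP => l; exact: smooth_upto_graph_chart_inv.
- move=> u uV; have hk : hemisphere k eps u 0 k =
      eps * Num.sqrt (1 - \sum_(i < n | i != k) u 0 i ^+ 2) by rewrite mxE eqxx.
  have s0 : 0 < Num.sqrt (1 - \sum_(i < n | i != k) u 0 i ^+ 2) by rewrite sqrtr_gt0.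
  have e0 : eps != 0 by apply/eqP => e0; move: ee; rewrite e0 mul0r => /esym/eqP; rewrite oner_eq0.
  have hk0 : hemisphere k eps u 0 k != 0 by rewrite hk mulf_neq0 // gt_eqF.
  split; first split.
  + by apply: sweep_in_L; exact: sum_sqr_hemisphere.
  + split; first exact: chart_domain_sweep.
    rewrite /= rotated_re_sweep hk !mulrA ee mul1r -mulrA mulr_gt0 //.
    exact: rotated_radius_gt0.
  + apply/rowP => j; rewrite mxE /graph_chart height_sweep //.
    case: eqP => [->|/eqP jk]; first by rewrite mulrA ee mul1r.
    by rewrite sphere_coord_sweep // mxE (negbTE jk).
- move=> q [[x [y [ux _ ->]]] [[rk0 _] /= re]].
  have xk0 : x 0 k != 0.
    by rewrite -(rotated_re_sweep_eq0 psi n_gt0 alpha_ge0 a_gt0 k x y).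
  have exk : 0 < eps * x 0 k.
    move: re; rewrite rotated_re_sweep mulrA pmulr_lgt0 //.
    exact: rotated_radius_gt0.
  have inv_E j : graph_chart_inv k eps (Psi x y) 0 j = if j == k then eps * y else x 0 j.
    by rewrite mxE height_sweep // sphere_coord_sweep.
  have sE : 1 - \sum_(i < n | i != k) graph_chart_inv k eps (Psi x y) 0 i ^+ 2 = x 0 k ^+ 2.
    rewrite -ux (bigD1 k) //= [X in _ - X](eq_bigr (fun i => x 0 i ^+ 2)).
      exact: addrK.
    by move=> i ik; rewrite inv_E (negbTE ik).
  split; first by rewrite /graph_chart_source /= sE exprn_even_gt0.
  rewrite /graph_chart inv_E eqxx mulrA ee mul1r; congr Psi.
  apply/rowP => j; rewrite mxE; case: eqP => [->|/eqP jk].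
    rewrite sE -[x 0 k ^+ 2]mul1r -e1 -exprMn sqrtr_sqr gtr0_norm //.
    by rewrite mulrA ee mul1r.
  by rewrite inv_E (negbTE jk).
Qed.

(** A coordinate with x_k nonzero gives the chart, and its sign gives [eps]. *)
Lemma graph_chart_covers q : L q -> exists k eps u,
  [/\ eps ^+ 2 = 1 :> R, graph_chart_source k u & graph_chart k eps u = q].
Proof.
move=> [x [y [ux _ ->]]]; have [k xk] := unit_sphere_coord ux.
pose eps : R := Num.sg (x 0 k).
have e1 : eps ^+ 2 = 1 by rewrite /eps sqr_sg xk.
have ee : eps * eps = 1 by rewrite -expr2.
pose u : 'rV[R]_n := \row_j (if j == k then eps * y else x 0 j).
have sE : 1 - \sum_(i < n | i != k) u 0 i ^+ 2 = x 0 k ^+ 2.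
  rewrite -ux (bigD1 k) //= [X in _ - X](eq_bigr (fun i => x 0 i ^+ 2)).
    exact: addrK.
  by move=> i ik; rewrite mxE (negbTE ik).
exists k, eps, u; split; first exact: e1.
  by rewrite /graph_chart_source /= sE exprn_even_gt0.
rewrite /graph_chart [u 0 k]mxE eqxx mulrA ee mul1r; congr Psi.
apply/rowP => j; rewrite mxE; case: eqP => [->|/eqP jk].
  by rewrite sE sqrtr_sqr /eps -numEsg.
by rewrite mxE (negbTE jk).
Qed.

Lemma embedded_L : embedded_submanifold n L.
Proof.
move=> q /graph_chart_covers[k [eps [u [e1 uV uq]]]].
exists (graph_chart_source k), (graph_chart k eps), u; split=> //.
exact: local_param_graph_chart.
Qed.

(** * Global coordinates on L *)

(** By [sweep_point_inj] the height does not depend on the choice of a coordinate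
with x_k nonzero. *)
Definition L_height q : R := xget 0 [set y | exists x, unit_sphere x /\ q = Psi x y].

Definition L_sphere q : 'rV[R]_n := \row_j sphere_coord q (L_height q) j.

Lemma L_height_sweep x y : unit_sphere x -> L_height (Psi x y) = y.
Proof.
move=> ux; rewrite /L_height; case: xgetP => [y' _ [x' [ux' E]]|/(_ y) nE].
  by have [] := sweep_point_inj n_gt0 alpha_ge0 a_gt0 ux E.
by case: nE; exists x.
Qed.

Lemma L_sphere_sweep x y : unit_sphere x -> L_sphere (Psi x y) = x.
Proof.
by move=> ux; apply/rowP => j; rewrite mxE L_height_sweep // sphere_coord_sweep.
Qed.

Lemma height_chart_domain k x y : chart_domain k (Psi x y) -> height k (Psi x y) = y.
Proof.
move=> [rk _]; apply: height_sweep.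
by rewrite -(rotated_re_sweep_eq0 psi n_gt0 alpha_ge0 a_gt0 k x y).
Qed.

(** The parametrization of L by the sphere times the line, as a map on the whole of
the ambient space of the cylinder. *)
Definition cylinder_map (u : 'rV[R]_(n + 1)) := Psi (lsubmx u) (u 0 (rshift n ord0)).

Lemma smooth_upto_cylinder_map l : smooth_upto l setT cylinder_map.
Proof.
apply: (smooth_upto_sweep openT); last exact: smooth_upto_proj openT.
move=> j; apply: (smooth_upto_eq openT (f := fun u : 'rV[R]_(n + 1) => u 0 (lshift 1 j))).
  by move=> u _; rewrite mxE.
exact: smooth_upto_proj openT.
Qed.

Lemma diffeomorphic_L : diffeomorphic (@sphere_line R n) L.
Proof.
pose g q : 'rV[R]_(n + 1) := row_mx (L_sphere q) (L_height q)%:M.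
exists cylinder_map, g; split.
- move=> u _; exists setT, cylinder_map; split=> //; first exact: openT.
  by apply/smooth_onP => l; exact: smooth_upto_cylinder_map.
- move=> q [x [y [ux _ ->]]]; have [k xk] := unit_sphere_coord ux.
  exists (chart_domain k), (fun q => row_mx (\row_j sphere_coord q (height k q) j) (height k q)%:M).
  have oW : open (chart_domain k) by exact: open_chart_domain.
  split=> //; first exact: chart_domain_sweep.
    apply/smooth_onP => l; have sid := @smooth_upto_idV R 'rV[R]_(n + n) l _ oW.
    have sh : smooth_upto l (chart_domain k) (height k).
      by apply: (smooth_upto_height n_gt0 alpha_ge0 a_gt0 oW sid).
    apply: (smooth_upto_mx oW) => i j; rewrite (ord1 i).
    case: (split_ordP j) => j' ->.
      apply: (smooth_upto_eq oW (f := fun q => sphere_coord q (height k q) j')).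
        by move=> u _; rewrite row_mxEl mxE.
      exact: (smooth_upto_sphere_coord psi n_gt0 alpha_ge0 a_gt0 oW sid).
    apply: (smooth_upto_eq oW) sh => u _.
    by rewrite row_mxEr (ord1 j') mxE mulr1n.
  move=> _ [[x' [y' [ux' _ ->]]] inW].
  rewrite /g (L_height_sweep _ ux') (L_sphere_sweep _ ux') (height_chart_domain inW).
  by congr row_mx; apply/rowP => j; rewrite mxE sphere_coord_sweep.
- move=> u uS; split; first exact: sweep_in_L.
  rewrite /g /cylinder_map (L_height_sweep _ uS) (L_sphere_sweep _ uS).
  rewrite -[RHS]hsubmxK; congr row_mx; apply/rowP => j.
  by rewrite (ord1 j) !mxE mulr1n.
- move=> _ [x [y [ux _ ->]]]; rewrite /g (L_height_sweep _ ux) (L_sphere_sweep _ ux).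
  rewrite /sphere_line /= row_mxKl; split; first exact: ux.
  by rewrite /cylinder_map row_mxKl row_mxEr mxE mulr1n.
Qed.

(** * L is closed *)

Let bounded_cylinder (M : R) : set 'rV[R]_(n + 1) :=
  [set u | unit_sphere (lsubmx u) /\ u 0 (rshift n ord0) ^+ 2 <= M].

Let compact_bounded_cylinder M : compact (bounded_cylinder M).
Proof.
apply: bounded_closed_compact.
  exists (1 + `|M|); split; first exact: num_real.
  move=> b bM u [uS uM] /=.
  have b0 : 0 <= b by rewrite ltW // (le_lt_trans _ bM) // addr_ge0.
  rewrite [leLHS]/Num.Def.normr /= mx_normrE.
  apply: bigmax_le => // -[i j] _ /=; rewrite (ord1 i).
  have sq (c : R) : c ^+ 2 <= 1 + `|M| -> `|c| <= b.
    move=> c2; have b1 : 1 <= b by rewrite ltW // (le_lt_trans _ bM) // lerDl.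
    rewrite -(@ler_pXn2r _ 2) ?nnegrE // real_normK ?num_real //.
    rewrite (le_trans c2) // (le_trans (ltW bM)) // expr2 ler_peMl //.
  case: (split_ordP j) => j' ->; apply: sq.
    have : \sum_(i < n) lsubmx u 0 i ^+ 2 = 1 by [].
    rewrite (bigD1 j') //= mxE => uE.
    rewrite (@le_trans _ _ 1) ?lerDl // -uE lerDl sumr_ge0 // => *.
    exact: sqr_ge0.
  rewrite (ord1 j') (le_trans uM) // (le_trans (ler_norm M)) // lerDr.
  exact: ler01.
have cl (f : 'rV[R]_(n + 1) -> R) (D : set R) : smooth_upto 0 setT f -> closed D ->
    closed (f @^-1` D).
  move=> sf; apply: (proj1 (continuous_closedP _)) => u.
  by apply: differentiable_continuous; exact: smooth_upto_diff sf _.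
have -> : bounded_cylinder M =
    (fun u : 'rV[R]_(n + 1) => \sum_(j < n) u 0 (lshift 1 j) ^+ 2) @^-1` [set 1] `&`
    (fun u : 'rV[R]_(n + 1) => u 0 (rshift n ord0) ^+ 2) @^-1` [set c | c <= M].
  rewrite /bounded_cylinder /unit_sphere; apply/seteqP; split=> u [/= u1 u2]; split=> //.
    by rewrite -u1; apply: eq_bigr => j _; rewrite mxE.
  by rewrite -u1; apply: eq_bigr => j _; rewrite mxE.
apply: closedI; apply: cl.
- apply: (smooth_upto_sum _ _ openT) => j; apply: (smooth_uptoX openT).
  exact: smooth_upto_proj openT.
- exact: closed_eq.
- by apply: (smooth_uptoX openT); exact: smooth_upto_proj openT.
- exact: closed_le.
Qed.

Lemma height_sqr_le x y : unit_sphere x ->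
  y ^+ 2 <= \sum_(i < n + n) Psi x y 0 i ^+ 2.
Proof.
move=> ux; rewrite big_split_ord /= -big_split /=.
rewrite -[leLHS]mul1r -[in leLHS]ux mulr_suml ler_sum // => j _.
rewrite sweep_point_re sweep_point_im.
rewrite (_ : _ + _ = x 0 j ^+ 2 * (wre j y ^+ 2 + wim j y ^+ 2)); last by ring.
rewrite w_normsq //.
by rewrite ler_wpM2l ?sqr_ge0 // /rsq lerDr invr_ge0 ltW.
Qed.

(** Since y^2 is at most the square of the norm, the part of L in a ball is covered
by the image of a compact cylinder. *)
Lemma closed_L : closed L.
Proof.
move=> q clq; pose M := \sum_(i < n + n) (`|q 0 i| + 1) ^+ 2.
suff : (cylinder_map @` bounded_cylinder M) q.
  by move=> [u [uS _] <-]; exact: sweep_in_L.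
have cK : closed (cylinder_map @` bounded_cylinder M).
  apply: compact_closed; first exact: norm_hausdorff.
  apply: continuous_compact; last exact: compact_bounded_cylinder.
  apply: continuous_subspaceT => u; apply: differentiable_continuous.
  exact: (@smooth_upto_diff R 0%N _ _ setT _ _ (@smooth_upto_cylinder_map 0%N)).
apply: cK => B nB; have nq : nbhs q (ball q 1) by exact: nbhsx_ballx.
have [_ [[x [y [ux _ ->]]] [qB qball]]] := clq _ (filterI nB nq).
exists (Psi x y); split=> //; exists (row_mx x y%:M); last first.
  by rewrite /cylinder_map row_mxKl row_mxEr mxE mulr1n.
rewrite /bounded_cylinder /= row_mxKl row_mxEr mxE mulr1n; split=> //.
apply: le_trans (height_sqr_le y ux) _; apply: ler_sum => i _.
have qi : `|q 0 i - Psi x y 0 i| < 1 by have [_ /(_ 0 i)] := qball.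
have qi' : `|Psi x y 0 i| <= `|q 0 i| + 1.
  rewrite -[Psi x y 0 i](subKr (q 0 i)) (le_trans (ler_normB _ _)) // lerD2l.
  exact: ltW.
by rewrite -[leLHS]real_normK ?num_real // ler_pXn2r ?nnegrE // addr_ge0.
Qed.

End charts.

(** * Linear algebra of Lagrangian frames *)

Section lagrangian_frame.
Variables (R : realType) (n : nat).
Implicit Types A B : 'M[R]_n.

Lemma mulmx_tr_unit (k l : nat) (J : 'M[R]_(k, l)) (F : 'M[R]_(l, k)) :
  J *m F = 1%:M -> J *m J^T \in unitmx.
Proof.
move=> JF; rewrite -row_free_unit -kermx_eq0; apply/rowV0P => v /sub_kermxP vg.
have vJ : v *m J = 0.
  have : (v *m J) *m (v *m J)^T = 0 by rewrite trmx_mul mulmxA -(mulmxA v) vg mul0mx.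
  move: (v *m J) => u /matrixP/(_ 0 0); rewrite !mxE => /eqP.
  rewrite psumr_eq0 => [/allP h|i _]; last by rewrite mxE -expr2 sqr_ge0.
  apply/rowP => i; have := h i (mem_index_enum i).
  by rewrite !mxE -expr2 sqrf_eq0 => /eqP.
by rewrite -[v]mulmx1 -JF mulmxA vJ mul0mx.
Qed.

(** For n vectors (A, B) spanning a Lagrangian subspace, the rows of (-B, A)
span its orthogonal complement.  The inverse of the square matrix with rows
(A, B) and (-B, A) is thus explicit, and being a left inverse as well gives the
relations. *)
Lemma lagrangian_frame_relations A B (g := A *m A^T + B *m B^T) :
  g \in unitmx -> A *m B^T = B *m A^T ->
  A^T *m invmx g *m A + B^T *m invmx g *m B = 1%:M /\
  A^T *m invmx g *m B = B^T *m invmx g *m A.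
Proof.
move=> gu AB; pose h := invmx g.
pose M := block_mx A B (- B) A; pose M' := block_mx (A^T *m h) (- (B^T *m h)) (B^T *m h) (A^T *m h).
have MM' : M *m M' = 1%:M.
  rewrite /M /M' mulmx_block scalar_mx_block; congr block_mx.
  - by rewrite !mulmxA -mulmxDl mulmxV.
  - by rewrite mulmxN !mulmxA AB addNr.
  - by rewrite mulNmx !mulmxA AB addNr.
  - by rewrite mulNmx mulmxN opprK !mulmxA -mulmxDl addrC mulmxV.
have := mulmx1C MM'; rewrite /M /M' mulmx_block scalar_mx_block => /eq_block_mx[E1 E2 _ _].
split; first by rewrite -E1 mulNmx mulmxN opprK.
by move/eqP: E2; rewrite mulNmx subr_eq0 => /eqP.
Qed.

(** The left-hand side is the orthogonal projection to the span of the frame; the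
relations above reduce it to the identity. *)
Lemma lagrangian_frame_tangent A B (v1 v2 : 'rV[R]_n) (J := row_mx A B)
    (g := A *m A^T + B *m B^T) :
  g \in unitmx -> A *m B^T = B *m A^T -> A *m v2^T = B *m v1^T ->
  row_mx v1 v2 *m J^T *m invmx g *m J = row_mx v1 v2.
Proof.
move=> gu AB v12; have [E1 E2] := lagrangian_frame_relations gu AB.
have v21 : v2 *m A^T = v1 *m B^T.
  by apply: trmx_inj; rewrite !trmx_mul !trmxK.
rewrite /J tr_row_mx mul_row_col mul_mx_row; congr row_mx.
  rewrite !mulmxDl -!mulmxA (mulmxA B^T) -E2 -!mulmxA !(mulmxA v2) v21.
  rewrite -!mulmxA -mulmxDr.
  by rewrite !mulmxA in E1 *; rewrite -!mulmxA in E1 *; rewrite E1 mulmx1.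
rewrite !mulmxDl -!mulmxA.
have -> : v1 *m (A^T *m (invmx g *m B)) = v2 *m (A^T *m (invmx g *m A)).
  by rewrite (mulmxA A^T) E2 -!mulmxA !(mulmxA v1) -v21 -!mulmxA.
by rewrite -mulmxDr !mulmxA in E1 *; rewrite -!mulmxA in E1 *; rewrite E1 mulmx1.
Qed.

End lagrangian_frame.

(** * The trace of the second fundamental form *)

Section trace_identity.
Variables (R : realType) (n : nat) (h : 'M[R]_n).
Hypothesis h_sym : h^T = h.

(** The inverse metric, on pairs of differentials in a chart. *)
Definition hform (u v : 'I_n -> R) := \sum_i \sum_j h i j * (u i * v j).

Lemma hform_linear_l a b u u' v :
  hform (fun i => a * u i + b * u' i) v = a * hform u v + b * hform u' v.
Proof.
rewrite /hform !mulr_sumr -big_split; apply: eq_bigr => i _.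
by rewrite !mulr_sumr -big_split; apply: eq_bigr => j _ /=; ring.
Qed.

Lemma hform_sym u v : hform u v = hform v u.
Proof.
rewrite /hform exchange_big; apply: eq_bigr => i _; apply: eq_bigr => j _.
by rewrite -[in LHS]h_sym mxE [u j * _]mulrC.
Qed.

Lemma hform_linear_r a b u v v' :
  hform u (fun i => a * v i + b * v' i) = a * hform u v + b * hform u v'.
Proof. by rewrite hform_sym hform_linear_l !(hform_sym u). Qed.

Lemma hform_sum_r u (c : 'I_n -> R) (v : 'I_n -> 'I_n -> R) :
  \sum_m c m * hform u (v m) = hform u (fun i => \sum_m c m * v m i).
Proof.
rewrite /hform; under eq_bigr do rewrite mulr_sumr.
rewrite exchange_big; apply: eq_bigr => i _.
under eq_bigr do rewrite mulr_sumr.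
rewrite exchange_big; apply: eq_bigr => j _.
rewrite !mulr_sumr; apply: eq_bigr => m _; ring.
Qed.

Variables (x rho : 'I_n -> R) (xi : 'I_n -> 'I_n -> R) (eta : 'I_n -> R) (y p : R).
Hypotheses (x_unit : \sum_m x m ^+ 2 = 1) (x_xi : forall i, \sum_m x m * xi m i = 0).
Hypotheses (rho_gt0 : forall m, 0 < rho m) (p_gt0 : 0 < p).

Let r m := Num.sqrt (rho m).
(* the frame in the unitary coordinates z_m |w_m| / w_m; the summand with factor
0 gives both families the shape of [hform_linear_l] *)
Let fre m i := r m * xi m i + r m * (x m * (y / rho m)) * eta i.
Let fim m i := r m * 0 + r m * (x m * (p / rho m)) * eta i.

Hypothesis rel1 : forall m m', hform (fre m) (fre m') + hform (fim m) (fim m') = (m == m')%:R.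
Hypothesis rel2 : forall m m', hform (fre m) (fim m') = hform (fim m) (fre m').

Let rr m : r m ^+ 2 = rho m. Proof. by rewrite sqr_sqrtr // ltW. Qed.
Let r_gt0 m : 0 < r m. Proof. by rewrite sqrtr_gt0. Qed.
Let z0 : 'I_n -> R := fun=> 0.

Let hform0 u : hform u z0 = 0.
Proof. by rewrite /hform big1 // => i _; rewrite big1 // => j _; rewrite !mulr0. Qed.

Let hform0l u : hform z0 u = 0.
Proof. by rewrite hform_sym hform0. Qed.

Let E1 m m' : hform (xi m) (xi m') + x m' * (y / rho m') * hform (xi m) eta
  + x m * (y / rho m) * hform (xi m') eta
  + x m * x m' * ((y ^+ 2 + p ^+ 2) / (rho m * rho m')) * hform eta eta
  = (m == m')%:R / rho m.
Proof.
have := rel1 m m'; rewrite /fre /fim (hform_linear_l _ _ (xi m)) (hform_linear_l _ _ z0).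
rewrite !(hform_linear_r _ _ _ (xi m')) !(hform_linear_r _ _ _ z0) !hform0 ?hform0l.
rewrite (hform_sym eta (xi m')) => E.
have rm := r_gt0 m; have rm' := r_gt0 m'.
have q1 := gt_eqF (rho_gt0 m); have q2 := gt_eqF (rho_gt0 m').
apply: (mulfI (_ : r m * r m' != 0)); first by rewrite mulf_neq0 // gt_eqF.
transitivity ((m == m')%:R : R).
  by rewrite -E; field; rewrite q1 q2.
case: (eqVneq m m') => [->|_]; last by rewrite mul0r mulr0.
by rewrite -expr2 rr mulrCA mulfV ?q2 // mulr1.
Qed.

Let E2 m m' : x m' / rho m' * hform (xi m) eta = x m / rho m * hform (xi m') eta.
Proof.
have := rel2 m m'; rewrite /fre /fim (hform_linear_l _ _ (xi m)) (hform_linear_l _ _ z0).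
rewrite !(hform_linear_r _ _ _ (xi m')) !(hform_linear_r _ _ _ z0) !hform0 ?hform0l.
rewrite (hform_sym eta (xi m')) => E.
have rm := r_gt0 m; have rm' := r_gt0 m'.
have q1 := gt_eqF (rho_gt0 m); have q2 := gt_eqF (rho_gt0 m').
apply: (mulfI (_ : r m * r m' * p != 0)); first by rewrite !mulf_neq0 // gt_eqF.
move: E; rewrite !(mulr0, add0r, mulr0, addr0) => E.
apply/eqP; rewrite -subr_eq0; apply/eqP; move/eqP: E; rewrite -subr_eq0 => /eqP <-.
by field; rewrite q1 q2.
Qed.

Let vr := \sum_m x m ^+ 2 / rho m.

Let vr_gt0 : 0 < vr.
Proof.
have [m xm] : exists m, x m != 0.
  apply/existsP; apply: contrapT => /negP; rewrite negb_exists => /forallP h0.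
  move: x_unit; rewrite big1 => [/esym/eqP|m _]; first by rewrite oner_eq0.
  by have := h0 m; rewrite negbK => /eqP ->; rewrite expr0n.
rewrite /vr (bigD1 m) //= ltr_pwDl ?divr_gt0 ?exprn_even_gt0 // sumr_ge0 // => i _.
by rewrite divr_ge0 ?sqr_ge0 // ltW.
Qed.

Let sum_xT : \sum_m x m * hform (xi m) eta = 0.
Proof.
under eq_bigr do rewrite hform_sym.
rewrite hform_sum_r (_ : (fun i => _) = z0) ?hform0 //.
by apply/funext => i; exact: x_xi.
Qed.

(** Contracting the second relation with x leaves only this product. *)
Lemma hform_xi_eta m : hform (xi m) eta = 0.
Proof.
have : vr * hform (xi m) eta = 0.
  rewrite /vr mulr_suml (eq_bigr (fun m' => x m / rho m * (x m' * hform (xi m') eta))).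
    by rewrite -mulr_sumr sum_xT mulr0.
  move=> m' _; transitivity (x m' * (x m' / rho m' * hform (xi m) eta)); first by ring.
  by rewrite E2; ring.
by move/eqP; rewrite mulf_eq0 gt_eqF // => /eqP.
Qed.

(** Contracting the first relation with x. *)
Lemma hform_eta_eta : (y ^+ 2 + p ^+ 2) * vr * hform eta eta = 1.
Proof.
have key m : x m / rho m * ((y ^+ 2 + p ^+ 2) * vr * hform eta eta) = x m / rho m.
  transitivity (\sum_m' x m' * ((m == m')%:R / rho m)); last first.
    rewrite (bigD1 m) //= eqxx mul1r big1 ?addr0 // => m' /negbTE.
    by rewrite eq_sym => ->; rewrite mul0r mulr0.
  under [RHS]eq_bigr => m' _ do rewrite -E1 !hform_xi_eta !mulr0 !addr0 mulrDr.
  rewrite big_split /= hform_sum_r (_ : (fun i => _) = z0) ?hform0 ?add0r; last first.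
    by apply/funext => i; exact: x_xi.
  rewrite /vr mulr_sumr mulr_suml mulr_sumr; apply: eq_bigr => m' _.
  by field; rewrite !gt_eqF.
have vr0 : vr * ((y ^+ 2 + p ^+ 2) * vr * hform eta eta) = vr.
  rewrite {1}/vr mulr_suml; apply: eq_bigr => m _.
  transitivity (x m * (x m / rho m * ((y ^+ 2 + p ^+ 2) * vr * hform eta eta))).
    by rewrite expr2 -!mulrA.
  by rewrite key expr2 mulrA.
by apply: (mulfI (lt0r_neq0 vr_gt0)); rewrite vr0 mulr1.
Qed.

Lemma hform_xi_xi m : hform (xi m) (xi m) = (rho m)^-1 -
  x m ^+ 2 * ((y ^+ 2 + p ^+ 2) / rho m ^+ 2) * hform eta eta.
Proof.
have := E1 m m; rewrite !hform_xi_eta !mulr0 !addr0 eqxx mul1r => <-.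
by rewrite expr2 [rho m ^+ 2]expr2 addrK.
Qed.

(** The cubic form is the second fundamental form of L, see
[symplectic_first_second].  Its trace involves only the three products above,
and the terms in x_m^2 / rho_m^2 cancel. *)
Lemma cubic_trace (dp k : R) (kk : 'I_n) :
  p - y * dp = (y ^+ 2 + p ^+ 2) * p * (k + \sum_m (rho m)^-1) ->
  \sum_i \sum_j h i j *
    (p * (eta i * (\sum_m xi m kk * xi m j) + eta j * (\sum_m xi m kk * xi m i)
        + eta kk * (\sum_m xi m i * xi m j))
     + eta i * eta j * eta kk *
       \sum_m x m ^+ 2 * ((y * dp - p) / rho m + (y ^+ 2 + p ^+ 2) * p / rho m ^+ 2))
  = - (k * p * eta kk).
Proof.
move=> key; set Q := \sum_m x m ^+ 2 * _.
pose sg := \sum_m x m ^+ 2 / rho m ^+ 2.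
have QE : Q = (y * dp - p) * vr + (y ^+ 2 + p ^+ 2) * p * sg.
  rewrite /Q /vr /sg !mulr_sumr -big_split; apply: eq_bigr => m _ /=.
  by field; rewrite gt_eqF.
clearbody Q.
have term1 : \sum_i \sum_j h i j * (eta i * (\sum_m xi m kk * xi m j)) = 0.
  rewrite -[LHS]/(hform eta (fun j => \sum_m xi m kk * xi m j)) -hform_sum_r big1 // => m _.
  by rewrite hform_sym hform_xi_eta mulr0.
have term2 : \sum_i \sum_j h i j * (eta j * (\sum_m xi m kk * xi m i)) = 0.
  rewrite -[RHS]term1 exchange_big; apply: eq_bigr => i _; apply: eq_bigr => j _.
  by rewrite -[in LHS]h_sym mxE.
have term3 : \sum_i \sum_j h i j * (\sum_m xi m i * xi m j) = \sum_m hform (xi m) (xi m).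
  rewrite /hform exchange_big; rewrite [RHS]exchange_big [LHS]exchange_big.
  apply: eq_bigr => i _; rewrite [RHS]exchange_big; apply: eq_bigr => j _.
  by rewrite mulr_sumr.
transitivity (p * (\sum_i \sum_j h i j * (eta i * (\sum_m xi m kk * xi m j))
  + \sum_i \sum_j h i j * (eta j * (\sum_m xi m kk * xi m i))
  + eta kk * \sum_i \sum_j h i j * (\sum_m xi m i * xi m j))
  + eta kk * Q * hform eta eta).
  rewrite /hform mulr_sumr -!big_split /= !mulr_sumr -big_split; apply: eq_bigr => i _ /=.
  rewrite !mulr_sumr -!big_split /= !mulr_sumr -big_split; apply: eq_bigr => j _ /=.
  by ring.
rewrite term1 term2 term3 !add0r.
have -> : \sum_m hform (xi m) (xi m) =
    \sum_m (rho m)^-1 - (y ^+ 2 + p ^+ 2) * sg * hform eta eta.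
  rewrite /sg mulr_sumr mulr_suml -sumrB; apply: eq_bigr => m _.
  by rewrite hform_xi_xi; ring.
have U := hform_eta_eta; set H := hform eta eta in U *.
have m0 : y ^+ 2 + p ^+ 2 != 0 by rewrite gt_eqF // ltr_wpDl ?sqr_ge0 // exprn_gt0.
have vr0 := lt0r_neq0 vr_gt0.
have HE : H = ((y ^+ 2 + p ^+ 2) * vr)^-1.
  by apply: (mulfI (mulf_neq0 m0 vr0)); rewrite U mulfV // mulf_neq0.
have dpE : y * dp - p = - ((y ^+ 2 + p ^+ 2) * p * (k + \sum_m (rho m)^-1)).
  by rewrite -key opprB.
rewrite QE dpE HE; field.
by rewrite m0 vr0.
Qed.

End trace_identity.

Lemma sum_orthogonal (R : realType) (n : nat) (x u v : 'I_n -> R) (c d : R) :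
  \sum_m x m * u m = 0 -> \sum_m x m * v m = 0 ->
  \sum_m (c * (x m * u m) - d * (x m * v m)) = 0.
Proof. by move=> xu xv; rewrite sumrB -!mulr_sumr xu xv !mulr0 subrr. Qed.

Section cubic_form.
Variables (R : realType) (n : nat).
(* z, z1, z2 stand for a curve and its first two derivatives, in real and
imaginary parts *)
Variables (zr zi z1r z1i z2r z2i K : 'I_n -> R) (p dp : R).
Hypotheses (w01 : forall m, zr m * z1i m - zi m * z1r m = p)
  (w02 : forall m, zr m * z2i m - zi m * z2r m = dp)
  (w12 : forall m, z1r m * z2i m - z1i m * z2r m = K m).
Variables (x xi xj xk xij : 'I_n -> R) (yi yj yk yij : R).
Hypotheses (x_xk : \sum_m x m * xk m = 0) (x_xi : \sum_m x m * xi m = 0)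
  (x_xj : \sum_m x m * xj m = 0) (x_xij : \sum_m x m * xij m = - \sum_m xi m * xj m).

Lemma symplectic_first_first :
  \sum_m ((xi m * zr m + x m * (z1r m * yi)) * (xj m * zi m + x m * (z1i m * yj))
    - (xi m * zi m + x m * (z1i m * yi)) * (xj m * zr m + x m * (z1r m * yj))) = 0.
Proof.
rewrite (eq_bigr (fun m => p * yj * (x m * xi m) - p * yi * (x m * xj m))).
  by rewrite sumrB -!mulr_sumr x_xi x_xj !mulr0 subrr.
by move=> m _; rewrite -(w01 m); ring.
Qed.

(** The second fundamental form of a Lagrangian submanifold is totally symmetric.
Here the terms with x_ij and y_ij, which could break the symmetry, are reduced by
the derivatives of the equation of the sphere. *)
Lemma symplectic_first_second :
  \sum_m ((xk m * zr m + x m * (z1r m * yk)) *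
      (xij m * zi m + (xj m * yi + xi m * yj) * z1i m + x m * (yj * yi) * z2i m + x m * yij * z1i m)
    - (xk m * zi m + x m * (z1i m * yk)) *
      (xij m * zr m + (xj m * yi + xi m * yj) * z1r m + x m * (yj * yi) * z2r m + x m * yij * z1r m))
  = p * (yi * (\sum_m xk m * xj m) + yj * (\sum_m xk m * xi m) + yk * (\sum_m xi m * xj m))
    + yi * yj * yk * \sum_m x m ^+ 2 * K m.
Proof.
rewrite (eq_bigr (fun m => p * yi * (xk m * xj m) + p * yj * (xk m * xi m)
  + (dp * yi * yj + p * yij) * (x m * xk m) - p * yk * (x m * xij m)
  + yi * yj * yk * (x m ^+ 2 * K m))).
  rewrite 3!big_split /= sumrN -!mulr_sumr x_xk x_xij big_split /= -!mulr_sumr.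
  by ring.
by move=> m _; rewrite -(w12 m) -(w02 m) -(w01 m); ring.
Qed.

End cubic_form.

(** * Determinants of complex frames *)

Section complex_frames.
Variables (R : realType) (n : nat).
Implicit Types (J : 'M[R]_(n, n + n)).

Definition complex_frame J : 'M[R[i]]_n :=
  \matrix_(i < n, j < n) (J i (lshift n j) +i* J i (rshift n j)).

Lemma Re_sum (F : 'I_n -> R[i]) :
  complex.Re (\sum_i F i) = \sum_i complex.Re (F i).
Proof. exact: (big_morph _ (@cReD R) (erefl : complex.Re (0 : R[i]) = 0)). Qed.

Lemma Im_sum (F : 'I_n -> R[i]) :
  complex.Im (\sum_i F i) = \sum_i complex.Im (F i).
Proof. exact: (big_morph _ (@cImD R) (erefl : complex.Im (0 : R[i]) = 0)). Qed.

Lemma dz_formM (M : 'M[R]_n) J : dz_form (M *m J) = (\det M)%:C * dz_form J.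
Proof.
rewrite -det_map_mx /dz_form -det_mulmx; congr (\det _); apply/matrixP => i j.
rewrite !mxE; apply: complex_eqP.
  by rewrite Re_sum; apply: eq_bigr => m _; rewrite !mxE cReM /= mul0r subr0.
by rewrite Im_sum; apply: eq_bigr => m _; rewrite !mxE cImM /= mul0r addr0.
Qed.

(** For a Lagrangian frame, the complex matrix Z of the frame satisfies
Z Z^* = g. *)
Lemma normsq_dz_form J : (forall i j, omega (row i J) (row j J) = 0) ->
  normsq (dz_form J) = \det (J *m J^T).
Proof.
move=> lag; suff E : dz_form J * conjc (dz_form J) = (\det (J *m J^T))%:C.
  by move: E; rewrite mulcJ => -[].
rewrite (_ : dz_form J = \det (complex_frame J)) // -[RHS]det_map_mx.
rewrite -[conjc _]det_map_mx -[X in _ * X]det_tr -det_mulmx -[RHS]det_tr; congr (\det _).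
apply/matrixP => i j; rewrite !mxE big_split_ord /=; apply: complex_eqP.
  rewrite Re_sum /= -big_split; apply: eq_bigr => m _ /=.
  by rewrite !mxE cReM /=; ring.
rewrite Im_sum /= -[RHS](lag j i) /omega; apply: eq_bigr => m _.
by rewrite !mxE cImM /=; ring.
Qed.

Lemma det_single_row (K : comNzRingType) (M : 'M[K]_n) k :
  (forall i j, i != k -> M i j = (i == j)%:R) -> \det M = M k k.
Proof.
move=> h; rewrite (expand_det_col _ k) (bigD1 k) //= big1 => [|i ik].
  rewrite addr0 /cofactor -signr_odd addnn odd_double mul1r.
  rewrite (_ : row' k (col' k M) = 1%:M) ?det1 ?mulr1 //.
  apply/matrixP => i j; rewrite !mxE h; last by rewrite eq_sym neq_lift.
  by rewrite (inj_eq (@lift_inj _ k)).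
by rewrite h // (negbTE ik) mul0r.
Qed.

Lemma det_single_col (K : comNzRingType) (M : 'M[K]_n) k :
  (forall i j, j != k -> M i j = (i == j)%:R) -> \det M = M k k.
Proof.
move=> h; rewrite -det_tr (det_single_row (k := k)) ?mxE // => i j ik.
by rewrite mxE h // eq_sym.
Qed.

(** Without the factors w_m, the frame of a graph chart is a matrix T whose rows,
except the k-th, are those of the sphere.  Replacing the k-th column of T by
its product with x makes these rows trivial, since x is orthogonal to the sphere. *)
Lemma det_graph_frame (x : 'I_n -> R) (xd : 'I_n -> 'I_n -> R) (yd : 'I_n -> R)
    (c w : 'I_n -> R[i]) (eps : R) k :
  x k != 0 -> (forall i, \sum_m x m * xd m i = 0) ->
  (forall m i, m != k -> xd m i = (m == i)%:R * (i != k)%:R) ->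
  (forall i, yd i = eps * (i == k)%:R) ->
  \det (\matrix_(i, m) (((xd m i)%:C + (x m * yd i)%:C * c m) * w m)) =
  (eps / x k)%:C * (\sum_m (x m ^+ 2)%:C * c m) * \prod_m w m.
Proof.
move=> xk x_xd xdE ydE; set Z := \matrix_(i, m) _.
pose T : 'M[R[i]]_n := \matrix_(i, m) ((xd m i)%:C + (x m * yd i)%:C * c m).
pose C : 'M[R[i]]_n := \matrix_(i, m) (if m == k then (x i)%:C else (i == m)%:R).
have ZE : Z = T *m diag_mx (\row_m w m).
  by apply/matrixP => i m; rewrite mul_mx_diag !mxE.
have xkC : (x k)%:C != 0 by apply/eqP => -[] /eqP; rewrite (negbTE xk).
have detC : \det C = (x k)%:C.
  by rewrite (det_single_col (k := k)) ?mxE ?eqxx // => i j /negbTE jk; rewrite mxE jk.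
have TC i j : (T *m C) i j = if j == k then (yd i)%:C * \sum_m (x m ^+ 2)%:C * c m else T i j.
  rewrite mxE; case: (eqVneq j k) => [->|jk].
    rewrite (eq_bigr (fun m => (x m * xd m i)%:C + (yd i)%:C * ((x m ^+ 2)%:C * c m))).
      rewrite big_split /= -mulr_sumr -(rmorph_sum (real_complex R)) x_xd.
      by rewrite rmorph0 add0r.
    move=> m _; rewrite !mxE eqxx !(rmorphM (real_complex R)) /=; ring.
  rewrite (bigD1 j) //= big1 => [|m mj]; last by rewrite [C m j]mxE (negbTE jk) (negbTE mj) mulr0.
  by rewrite [C j j]mxE (negbTE jk) eqxx mulr1 addr0.
have detTC : \det (T *m C) = eps%:C * \sum_m (x m ^+ 2)%:C * c m.
  rewrite (det_single_row (k := k)) ?TC ?eqxx ?ydE ?eqxx ?mulr1 // => i j ik.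
  rewrite TC ydE (negbTE ik) mulr0 rmorph0 mul0r.
  case: (eqVneq j k) => [->|jk]; first by rewrite (negbTE ik).
  rewrite mxE xdE // ik mulr1 ydE (negbTE ik) !mulr0 rmorph0 mul0r addr0.
  by rewrite eq_sym (rmorph_nat (real_complex R)).
rewrite ZE det_mulmx det_diag.
have -> : \det T = (eps / x k)%:C * \sum_m (x m ^+ 2)%:C * c m.
  apply: (mulIf xkC); rewrite -[X in _ * X = _]detC -det_mulmx detTC.
  by rewrite mulrAC -(rmorphM (real_complex R)) divfK.
by congr (_ * _); apply: eq_bigr => m _; rewrite mxE.
Qed.

End complex_frames.

(** * Derivatives in charts *)

Section chart_calculus.
Variable R : realType.

Lemma smooth_map_open (V W : normedModType R) (U : set V) (f : V -> W) l :
  open U -> smooth_map U f -> smooth_upto l U f.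
Proof.
move=> oU sf vs x vl Ux; have [U' [F [oU' U'x sF fF]]] := sf x Ux.
have oI : open (U `&` U') by exact: openI.
have sF' : smooth_upto l (U `&` U') F.
  by move=> vs' z _ [_ U'z]; exact: sF.
apply: (smooth_upto_eq oI (fun z (Iz : (U `&` U') z) => esym (fF z Iz)) sF') => //.
Qed.

Lemma jacobianE (m N : nat) (X : 'rV[R]_m -> 'rV[R]_N) q i c : differentiable X q ->
  jacobian X q i c = 'D_(delta_mx 0 i) (fun u => X u 0 c) q.
Proof.
move=> dX; have dXi : derivable X q (delta_mx 0 i) by exact: diff_derivable.
have := deriveEjacobian (delta_mx 0 i) dX; rewrite (derive_mx dXi) -rowE => /matrixP/(_ 0 c).
by rewrite !mxE.
Qed.

(** The chain rule for F o X; it makes charts with a smooth inverse immersions. *)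
Lemma jacobian_left_inverse (m N : nat) (X : 'rV[R]_m -> 'rV[R]_N) (F : 'rV[R]_N -> 'rV[R]_m) q :
  differentiable X q -> differentiable F (X q) -> (\forall u \near q, F (X u) = u) ->
  jacobian X q *m jacobian F (X q) = 1%:M.
Proof.
move=> dX dF FX; apply/row_matrixP => i; rewrite rowE mulmxA row1 -!deriveEjacobian //.
rewrite (deriveE _ dF) (deriveE _ dX) -['d F _ _]/(('d F (X q) \o 'd X q) (delta_mx 0 i)).
rewrite -diff_comp // -deriveE; last exact: differentiable_comp.
rewrite (near_eq_derive (g := id)); last exact: FX.
exact: derive_id.
Qed.

Lemma derive_product_chain (V : normedModType R) (U : set V) (f eta : V -> R) (W W1 : R -> R) u e :
  U u -> smooth_upto 0 U f -> smooth_upto 0 U eta ->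
  (forall y : R, is_derive y 1 W (W1 y)) ->
  'D_e (fun u => f u * W (eta u)) u =
  'D_e f u * W (eta u) + f u * (W1 (eta u) * 'D_e eta u).
Proof.
move=> Uu sf se dW.
have df : is_derive u e f ('D_e f u) by apply: derivableP; exact: smooth_upto_derivable sf Uu.
have de : is_derive u e eta ('D_e eta u) by apply: derivableP; exact: smooth_upto_derivable se Uu.
by have [_ ->] := is_deriveMf df (is_derive_comp1 (dW (eta u)) de).
Qed.

Lemma derive2_product_chain (V : normedModType R) (U : set V) (f eta : V -> R)
    (W W1 W2 : R -> R) u e e' :
  open U -> U u -> smooth_upto 1 U f -> smooth_upto 1 U eta ->
  (forall y : R, is_derive y 1 W (W1 y)) -> (forall y : R, is_derive y 1 W1 (W2 y)) ->
  'D_e' (fun u => 'D_e (fun u => f u * W (eta u)) u) u =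
  'D_e' (fun u => 'D_e f u) u * W (eta u)
  + ('D_e f u * 'D_e' eta u + 'D_e' f u * 'D_e eta u) * W1 (eta u)
  + f u * ('D_e eta u * 'D_e' eta u) * W2 (eta u)
  + f u * 'D_e' (fun u => 'D_e eta u) u * W1 (eta u).
Proof.
move=> oU Uu sf se dW dW1.
have near_eq : \forall v \near u, 'D_e (fun u => f u * W (eta u)) v =
    'D_e f v * W (eta v) + f v * (W1 (eta v) * 'D_e eta v).
  have : nbhs u U by exact: open_nbhs_nbhs.
  apply: filterS => v Uv; apply: (derive_product_chain e Uv) => //.
    exact: smooth_uptoW sf.
  exact: smooth_uptoW se.
rewrite (near_eq_derive _ near_eq).
have der (g : V -> R) v : smooth_upto 0 U g -> is_derive u v g ('D_v g u).
  by move=> sg; apply: derivableP; exact: smooth_upto_derivable sg Uu.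
have f0 := smooth_uptoW (leqnSn 0) sf; have e0 := smooth_uptoW (leqnSn 0) se.
have d := is_deriveDf
  (is_deriveMf (der (fun u => 'D_e f u) e' (smooth_upto_derive e sf))
     (is_derive_comp1 (dW (eta u)) (der eta e' e0)))
  (is_deriveMf (der f e' f0) (is_deriveMf (is_derive_comp1 (dW1 (eta u)) (der eta e' e0))
     (der (fun u => 'D_e eta u) e' (smooth_upto_derive e se)))).
have [_ dE] := d; apply: (etrans dE).
move: ('D_e' (fun u => 'D_e f u) u) ('D_e' (fun u => 'D_e eta u) u) => A B.
move: ('D_e f u) ('D_e' f u) ('D_e eta u) ('D_e' eta u) (f u) (W (eta u)) (W1 (eta u))
  (W2 (eta u)) => C1 C2 D1 D2 f0' W0 W10 W20.
by ring.
Qed.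

End chart_calculus.

(** * The symplectic form in coordinates *)

Section symplectic_matrix.
Variables (R : realType) (n : nat).
Implicit Types (u v : 'rV[R]_(n + n)) (J : 'M[R]_(n, n + n)).

Lemma omega_mx u v : omega u v =
  (v *m col_mx (- (rsubmx u)^T) (lsubmx u)^T) 0 0.
Proof.
rewrite -[v in RHS]hsubmxK mul_row_col !mxE -big_split /omega /=.
by apply: eq_bigr => m _; rewrite !mxE; ring.
Qed.

Lemma omega_sum u (h : 'I_n -> 'I_n -> R) (v : 'I_n -> 'I_n -> 'rV[R]_(n + n)) :
  omega u (\sum_i \sum_j h i j *: v i j) = \sum_i \sum_j h i j * omega u (v i j).
Proof.
rewrite omega_mx mulmx_suml summxE; apply: eq_bigr => i _.
rewrite mulmx_suml summxE; apply: eq_bigr => j _.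
by rewrite -scalemxAl mxE omega_mx.
Qed.

Lemma omegaBZ u v v' (c : R) : omega u (v - c *: v') = omega u v - c * omega u v'.
Proof. by rewrite !omega_mx mulmxBl -scalemxAl !mxE. Qed.

Lemma mulmx_trE (k l : nat) (A B : 'M[R]_(k, l)) i j :
  (A *m B^T) i j = \sum_m A i m * B j m.
Proof. by rewrite mxE; apply: eq_bigr => m _; rewrite mxE. Qed.

Lemma omega_row_eq0 J v : (forall k, omega (row k J) v = 0) ->
  lsubmx J *m (rsubmx v)^T = rsubmx J *m (lsubmx v)^T.
Proof.
move=> h; apply/colP => k; apply/eqP; rewrite -subr_eq0; apply/eqP.
by rewrite -[RHS](h k) /omega !mxE -sumrB; apply: eq_bigr => m _; rewrite !mxE.
Qed.

Lemma omega_rows_eq0 J : (forall i j, omega (row i J) (row j J) = 0) ->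
  lsubmx J *m (rsubmx J)^T = rsubmx J *m (lsubmx J)^T.
Proof.
move=> h; apply/matrixP => i j; apply/eqP; rewrite -subr_eq0; apply/eqP.
by rewrite -[RHS](h i j) /omega !mxE -sumrB; apply: eq_bigr => m _; rewrite !mxE.
Qed.

End symplectic_matrix.

(** * Tangent spaces and mean curvature of L *)

Section lagrangian_geometry.
Variables (R : realType) (n : nat) (alpha : R) (a psi : 'I_n -> R).
Hypotheses (n_gt0 : (0 < n)%N) (alpha_ge0 : 0 <= alpha) (a_gt0 : forall j, 0 < a j).
Implicit Types (t : R) (j k m : 'I_n).

Local Notation rsq := (rsq a).
Local Notation p := (profile_p alpha a).
Local Notation dp := (profile_dp alpha a).
Local Notation wre := (wre alpha a psi).
Local Notation wim := (wim alpha a psi).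
Local Notation c_re := (c_re a).
Local Notation c_im := (c_im alpha a).
Local Notation Psi := (sweep_point (w_fun alpha a psi)).
Local Notation L := (L_fun alpha a psi).

Let rsq_gt0 := rsq_gt0 a_gt0.
Let rsq_neq0 := rsq_neq0 a_gt0.

Definition dwre m t := c_re m t * wre m t - c_im m t * wim m t.
Definition dwim m t := c_re m t * wim m t + c_im m t * wre m t.

Definition dc_re m t := (rsq m t - 2 * t ^+ 2) / rsq m t ^+ 2.
Definition dc_im m t := (dp t * rsq m t - 2 * t * p t) / rsq m t ^+ 2.

Definition ddwre m t := dc_re m t * wre m t + c_re m t * dwre m t
  - (dc_im m t * wim m t + c_im m t * dwim m t).
Definition ddwim m t := dc_re m t * wim m t + c_re m t * dwim m t
  + (dc_im m t * wre m t + c_im m t * dwre m t).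

Let d_wre m t : is_derive t 1 (wre m) (dwre m t).
Proof. exact: is_derive_wre. Qed.

Let d_wim m t : is_derive t 1 (wim m) (dwim m t).
Proof. exact: is_derive_wim. Qed.

Let d_cre m t : is_derive t 1 (c_re m) (dc_re m t).
Proof.
apply: is_derive_eq (is_deriveMf (is_derive_id t 1)
  (is_deriveVf (rsq_neq0 m t) (is_derive_rsq a m t))) _.
by rewrite /dc_re; field; exact: rsq_neq0.
Qed.

Let d_cim m t : is_derive t 1 (c_im m) (dc_im m t).
Proof.
apply: is_derive_eq (is_deriveMf (is_derive_p n_gt0 alpha_ge0 a_gt0 t)
  (is_deriveVf (rsq_neq0 m t) (is_derive_rsq a m t))) _.
by rewrite /dc_im; field; exact: rsq_neq0.
Qed.

Let d_dwre m t : is_derive t 1 (dwre m) (ddwre m t).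
Proof.
exact: (is_deriveBf (is_deriveMf (d_cre m t) (d_wre m t)) (is_deriveMf (d_cim m t) (d_wim m t))).
Qed.

Let d_dwim m t : is_derive t 1 (dwim m) (ddwim m t).
Proof.
exact: (is_deriveDf (is_deriveMf (d_cre m t) (d_wim m t)) (is_deriveMf (d_cim m t) (d_wre m t))).
Qed.

(** The symplectic products of w, w' and w''.  That the first two do not depend on
the index m is what makes L Lagrangian and its second fundamental form simple. *)
Lemma wronskian01 m t : wre m t * dwim m t - wim m t * dwre m t = p t.
Proof.
rewrite /dwre /dwim; transitivity (c_im m t * (wre m t ^+ 2 + wim m t ^+ 2)); first by ring.
by rewrite w_normsq // /c_im divfK.
Qed.

Lemma wronskian02 m t : wre m t * ddwim m t - wim m t * ddwre m t = dp t.
Proof.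
rewrite /ddwre /ddwim /dwre /dwim.
transitivity ((dc_im m t + 2 * c_re m t * c_im m t) * (wre m t ^+ 2 + wim m t ^+ 2)); first by ring.
by rewrite w_normsq // /c_im /c_re /dc_im; field.
Qed.

Lemma wronskian12 m t : dwre m t * ddwim m t - dwim m t * ddwre m t =
  (t * dp t - p t) / rsq m t + (t ^+ 2 + p t ^+ 2) * p t / rsq m t ^+ 2.
Proof.
rewrite /ddwre /ddwim /dwre /dwim.
transitivity ((c_re m t * dc_im m t - c_im m t * dc_re m t
    + (c_re m t ^+ 2 + c_im m t ^+ 2) * c_im m t) * (wre m t ^+ 2 + wim m t ^+ 2)); first by ring.
by rewrite w_normsq // /c_im /c_re /dc_im /dc_re; field.
Qed.

(** Near each point of L, the sphere and line coordinates are smooth functions on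
the ambient space, which can be composed with any chart. *)
Lemma chart_factors V X q : local_param L V X -> V q ->
  exists (U : set 'rV[R]_n) (xi : 'rV[R]_n -> 'rV[R]_n) (eta : 'rV[R]_n -> R),
  [/\ open U, U q, forall l j, smooth_upto l U (fun u => xi u 0 j),
      forall l, smooth_upto l U eta &
      forall u, U u -> unit_sphere (xi u) /\ X u = Psi (xi u) (eta u)].
Proof.
move=> [oV [W [Y [oW [sX _ XW _]]]]] Vq.
have sX' l : smooth_upto l V X by exact: smooth_map_open.
have cX u : V u -> {for u, continuous X}.
  by move=> Vu; apply: differentiable_continuous; exact: smooth_upto_diff (sX' 0%N) Vu.
have [[[x [y [ux _ Xq]]] _] _] := XW _ Vq.
have [k xk] := unit_sphere_coord ux.
pose D := chart_domain alpha a psi k.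
have oD : open D by exact: open_chart_domain.
pose U := V `&` X @^-1` D.
have oU : open U.
  rewrite openE => u [Vu Du]; rewrite /interior; apply: filterI.
    exact: open_nbhs_nbhs.
  by apply: (cX u Vu); exact: open_nbhs_nbhs.
pose eta u := height psi n_gt0 alpha_ge0 a_gt0 k (X u).
pose xi u : 'rV[R]_n := \row_j sphere_coord alpha a psi (X u) (eta u) j.
have sXU l : smooth_upto l U X by apply: smooth_upto_sub (sX' l) => u [].
have seta l : smooth_upto l U eta.
  by apply: (smooth_upto_height n_gt0 alpha_ge0 a_gt0 oU (sXU l)) => u [].
exists U, xi, eta; split.
- exact: oU.
- by split; [exact: Vq|rewrite /= Xq; exact: chart_domain_sweep].
- move=> l j; apply: (smooth_upto_eq oU (f := fun u => sphere_coord alpha a psi (X u) (eta u) j)).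
    by move=> u _; rewrite mxE.
  exact: (smooth_upto_sphere_coord psi n_gt0 alpha_ge0 a_gt0 oU (sXU l)).
- exact: seta.
- move=> u [Vu Du]; have [[[x' [y' [ux' _ Xu]]] _] _] := XW _ Vu.
  rewrite /= Xu in Du.
  have etaE : eta u = y' by rewrite /eta Xu; apply: height_chart_domain.
  have xiE : xi u = x'.
    by apply/rowP => j; rewrite mxE etaE Xu sphere_coord_sweep.
  by rewrite xiE etaE.
Qed.

Section at_a_point.
Variables (V : set 'rV[R]_n) (X : 'rV[R]_n -> 'rV[R]_(n + n)) (q : 'rV[R]_n).
Hypotheses (XV : local_param L V X) (Vq : V q).

Lemma chart_smooth l : smooth_upto l V X.
Proof. by have [oV [W [Y [_ [sX _ _ _]]]]] := XV; apply: smooth_map_open. Qed.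

Lemma chart_differentiable : differentiable X q.
Proof. exact: smooth_upto_diff (@chart_smooth 0%N) Vq. Qed.

Lemma gram_unit : gram X q \in unitmx.
Proof.
have [oV [W [Y [oW [_ sY XW _]]]]] := XV.
have cX : {for q, continuous X} := differentiable_continuous chart_differentiable.
have [LW YX] := XW _ Vq; have [U [F [oU Uq sF YF]]] := sY _ LW.
apply: (@mulmx_tr_unit _ _ _ _ (jacobian F (X q))).
apply: jacobian_left_inverse chart_differentiable _ _.
  exact: (sF [::]).
have nV : nbhs q V by exact: open_nbhs_nbhs.
have nU : nbhs q (X @^-1` U) by apply: cX; exact: open_nbhs_nbhs.
apply: filterS (filterI nV nU) => u [Vu Uu].
by have [LWu YXu] := XW _ Vu; rewrite -YF.
Qed.

Variables (U : set 'rV[R]_n) (xi : 'rV[R]_n -> 'rV[R]_n) (eta : 'rV[R]_n -> R).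
Hypotheses (oU : open U) (Uq : U q).
Hypotheses (sxi : forall l j, smooth_upto l U (fun u => xi u 0 j)).
Hypotheses (seta : forall l, smooth_upto l U eta).
Hypothesis XE : forall u, U u -> unit_sphere (xi u) /\ X u = Psi (xi u) (eta u).

Let e i : 'rV[R]_n := delta_mx 0 i.
Let x m := xi q 0 m.
Let y := eta q.
Let xd m i := 'D_(e i) (fun u => xi u 0 m) q.
Let yd i := 'D_(e i) eta q.
Let xdd m i j := 'D_(e i) (fun u => 'D_(e j) (fun u => xi u 0 m) u) q.
Let ydd i j := 'D_(e i) (fun u => 'D_(e j) eta u) q.

Let x_unit : \sum_m x m ^+ 2 = 1.
Proof. by have [] := XE Uq. Qed.

Let near_U : nbhs q U. Proof. exact: open_nbhs_nbhs. Qed.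

Let XE_re m : \forall u \near q, X u 0 (lshift n m) = xi u 0 m * wre m (eta u).
Proof. by apply: filterS near_U => u /XE[_ ->]; rewrite sweep_point_re. Qed.

Let XE_im m : \forall u \near q, X u 0 (rshift n m) = xi u 0 m * wim m (eta u).
Proof. by apply: filterS near_U => u /XE[_ ->]; rewrite sweep_point_im. Qed.

Let jac_re i m : jacobian X q i (lshift n m) = xd m i * wre m y + x m * (dwre m y * yd i).
Proof.
rewrite (jacobianE _ _ chart_differentiable) (near_eq_derive _ (XE_re m)).
exact: (derive_product_chain (e i) Uq (@sxi 0%N m) (@seta 0%N) (d_wre m)).
Qed.

Let jac_im i m : jacobian X q i (rshift n m) = xd m i * wim m y + x m * (dwim m y * yd i).
Proof.
rewrite (jacobianE _ _ chart_differentiable) (near_eq_derive _ (XE_im m)).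
exact: (derive_product_chain (e i) Uq (@sxi 0%N m) (@seta 0%N) (d_wim m)).
Qed.

Let second_coord c (f : 'rV[R]_n -> R) i j :
  (forall u, U u -> X u 0 c = f u) ->
  second_partial X q i j 0 c = 'D_(e i) (fun u => 'D_(e j) f u) q.
Proof.
move=> Xf; have oV : open V by have [] := XV.
have sD : smooth_upto 0 V (fun u => 'D_(e j) X u).
  exact: smooth_upto_derive (@chart_smooth 1%N).
have dD : derivable (fun u => 'D_(e j) X u) q (e i).
  exact: smooth_upto_derivable sD Vq.
rewrite /second_partial (derive_mx dD) mxE; apply: near_eq_derive.
have nV : nbhs q V by exact: open_nbhs_nbhs.
apply: filterS (filterI nV near_U) => u [Vu Uu].
have dX : derivable X u (e j) by exact: smooth_upto_derivable (@chart_smooth 0%N) Vu.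
rewrite (derive_mx dX) mxE; apply: near_eq_derive.
have nU : nbhs u U by exact: open_nbhs_nbhs.
by apply: filterS nU => z Uz; exact: Xf.
Qed.

Let sp_re i j m : second_partial X q i j 0 (lshift n m) =
  xdd m i j * wre m y + (xd m j * yd i + xd m i * yd j) * dwre m y
  + x m * (yd j * yd i) * ddwre m y + x m * ydd i j * dwre m y.
Proof.
rewrite (second_coord i j (f := fun u => xi u 0 m * wre m (eta u))).
  exact: (derive2_product_chain (e j) (e i) oU Uq (@sxi 1%N m) (@seta 1%N) (d_wre m) (d_dwre m)).
by move=> u /XE[_ ->]; rewrite sweep_point_re.
Qed.

Let sp_im i j m : second_partial X q i j 0 (rshift n m) =
  xdd m i j * wim m y + (xd m j * yd i + xd m i * yd j) * dwim m y
  + x m * (yd j * yd i) * ddwim m y + x m * ydd i j * dwim m y.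
Proof.
rewrite (second_coord i j (f := fun u => xi u 0 m * wim m (eta u))).
  exact: (derive2_product_chain (e j) (e i) oU Uq (@sxi 1%N m) (@seta 1%N) (d_wim m) (d_dwim m)).
by move=> u /XE[_ ->]; rewrite sweep_point_im.
Qed.

Let sphere_tangent u j : U u ->
  \sum_m xi u 0 m * 'D_(e j) (fun u => xi u 0 m) u = 0.
Proof.
move=> Uu; have nU : nbhs u U by exact: open_nbhs_nbhs.
have D : is_derive u (e j) (fun u => \sum_m xi u 0 m * xi u 0 m)
    (\sum_m ('D_(e j) (fun u => xi u 0 m) u * xi u 0 m + xi u 0 m * 'D_(e j) (fun u => xi u 0 m) u)).
  apply: is_derive_sumf => m.
  have d : is_derive u (e j) (fun u => xi u 0 m) ('D_(e j) (fun u => xi u 0 m) u).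
    by apply: derivableP; exact: smooth_upto_derivable (@sxi 0%N m) Uu.
  exact: is_deriveMf.
have near1 : \forall z \near u, \sum_m xi z 0 m * xi z 0 m = 1.
  apply: filterS nU => z /XE[<- _]; apply: eq_bigr => m _; by rewrite expr2.
have := is_derive_unique (near_eq_is_derive near1 D) (is_deriveCf u (e j) 1).
move=> E; apply: (mulfI (_ : 2 != 0 :> R)); first by rewrite pnatr_eq0.
rewrite mulr0 -[RHS]E mulr_sumr; apply: eq_bigr => m _.
by move: (xi u 0 m) ('D_(e j) _ u) => X1 X2; ring.
Qed.

Let x_xd i : \sum_m x m * xd m i = 0.
Proof. exact: sphere_tangent. Qed.

Let x_xdd i j : \sum_m x m * xdd m i j = - \sum_m xd m i * xd m j.
Proof.
have D : is_derive q (e i) (fun u => \sum_m xi u 0 m * 'D_(e j) (fun u => xi u 0 m) u)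
    (\sum_m (xd m i * xd m j + x m * xdd m i j)).
  apply: is_derive_sumf => m; apply: is_deriveMf; apply: derivableP.
    exact: smooth_upto_derivable (@sxi 0%N m) Uq.
  exact: smooth_upto_derivable (smooth_upto_derive (e j) (@sxi 1%N m)) Uq.
have near0 : \forall z \near q, \sum_m xi z 0 m * 'D_(e j) (fun u => xi u 0 m) z = 0.
  by apply: filterS near_U => z Uz; exact: sphere_tangent.
have := is_derive_unique (near_eq_is_derive near0 D) (is_deriveCf q (e i) 0).
by rewrite big_split /= => /eqP; rewrite addrC addr_eq0 => /eqP.
Qed.

Let rowE' i c : row i (jacobian X q) 0 c = jacobian X q i c.
Proof. by rewrite mxE. Qed.

Lemma omega_tangent i j : omega (row i (jacobian X q)) (row j (jacobian X q)) = 0.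
Proof.
rewrite -[RHS](symplectic_first_first (fun m => wronskian01 m y) (yd i) (yd j) (x_xd i) (x_xd j)).
by apply: eq_bigr => m _; rewrite !rowE' !jac_re !jac_im.
Qed.

Let omega_second i j k : omega (row k (jacobian X q)) (second_partial X q i j) =
  p y * (yd i * (\sum_m xd m k * xd m j) + yd j * (\sum_m xd m k * xd m i)
        + yd k * (\sum_m xd m i * xd m j))
  + yd i * yd j * yd k *
    \sum_m x m ^+ 2 * ((y * dp y - p y) / rsq m y + (y ^+ 2 + p y ^+ 2) * p y / rsq m y ^+ 2).
Proof.
rewrite -(symplectic_first_second (fun m => wronskian01 m y) (fun m => wronskian02 m y)
  (fun m => wronskian12 m y) (yd i) (yd j) (yd k) (ydd i j) (x_xd k) (x_xdd i j)).
by apply: eq_bigr => m _; rewrite !rowE' jac_re jac_im sp_re sp_im.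
Qed.

Let omega_position k : omega (row k (jacobian X q)) (X q) = - (p y * yd k).
Proof.
rewrite /omega (eq_bigr (fun m => - (p y * yd k) * x m ^+ 2)).
  by rewrite -mulr_sumr x_unit mulr1.
move=> m _; rewrite !rowE' jac_re jac_im.
rewrite (nbhs_singleton (XE_re m)) (nbhs_singleton (XE_im m)) -/(x m) -/y -(wronskian01 m y).
move: (xd m k) (yd k) (x m) (wre m y) (wim m y) (dwre m y) (dwim m y).
by move=> *; ring.
Qed.

Let J := jacobian X q.
Let h := invmx (gram X q).

Let gramE : gram X q = lsubmx J *m (lsubmx J)^T + rsubmx J *m (rsubmx J)^T.
Proof. by rewrite /gram -/J -{1 2}(hsubmxK J) tr_row_mx mul_row_col. Qed.

Let frame_lagrangian : lsubmx J *m (rsubmx J)^T = rsubmx J *m (lsubmx J)^T.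
Proof. by apply: omega_rows_eq0 => i j; exact: omega_tangent. Qed.

(** The normal space of a Lagrangian submanifold is the image of the tangent space
by the complex structure, so that omega detects the normal part of v. *)
Let normal_proj_eq0 v : (forall k, omega (row k J) v = 0) -> normal_proj X q v = 0.
Proof.
move=> v0; rewrite /normal_proj -/J -/h; apply/eqP; rewrite subr_eq0; apply/eqP.
have gu := gram_unit; rewrite gramE in gu.
have := lagrangian_frame_tangent gu frame_lagrangian (omega_row_eq0 v0).
by rewrite !hsubmxK -gramE.
Qed.

Let h_sym : h^T = h.
Proof. by rewrite /h trmx_inv /gram trmx_mul trmxK. Qed.

Let rho m := rsq m y.
Let r m := Num.sqrt (rho m).
Let fre m i := r m * xd m i + r m * (x m * (y / rho m)) * yd i.
Let fim m i := r m * 0 + r m * (x m * (p y / rho m)) * yd i.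

Let r_sqr m : r m ^+ 2 = rho m. Proof. by rewrite sqr_sqrtr // ltW // rsq_gt0. Qed.

Let lsub_jac i m : lsubmx J i m = xd m i * wre m y + x m * (dwre m y * yd i).
Proof. by rewrite -jac_re mxE. Qed.

Let rsub_jac i m : rsubmx J i m = xd m i * wim m y + x m * (dwim m y * yd i).
Proof. by rewrite -jac_im mxE. Qed.

(** Rotating each coordinate z_m by the phase of w_m preserves the metric and the
symplectic form, and removes the phases from the frame. *)
Let frame_rotated : let A := \matrix_(i, m) fre m i in let B := \matrix_(i, m) fim m i in
  A *m A^T + B *m B^T = gram X q /\ A *m B^T = B *m A^T.
Proof.
move=> A B.
have AE i m : A i m = fre m i by rewrite mxE.
have BE i m : B i m = fim m i by rewrite mxE.
split; apply/matrixP => i j.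
  rewrite gramE [LHS]mxE [RHS]mxE !mulmx_trE -!big_split /=; apply: eq_bigr => m _.
  rewrite !AE !BE !lsub_jac !rsub_jac /dwre /dwim /fre /fim.
  have rN := rsq_neq0 m y; have rE := r_sqr m.
  have wE := w_normsq alpha psi a_gt0 m y.
  rewrite /c_re /c_im -/(rho m) in rE wE *.
  move: (rho m)^-1 => iv.
  transitivity (rho m * ((xd m i + x m * (y * iv) * yd i) * (xd m j + x m * (y * iv) * yd j)
     + x m ^+ 2 * (p y * iv) ^+ 2 * yd i * yd j)).
    rewrite -rE; move: (xd m i) (xd m j) (yd i) (yd j) (x m) => *; by ring.
  rewrite -wE; move: (xd m i) (xd m j) (yd i) (yd j) (x m) => *; by ring.
rewrite !mulmx_trE; apply/eqP; rewrite -subr_eq0 -sumrB; apply/eqP.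
rewrite (eq_bigr (fun m => p y * yd j * (x m * xd m i) - p y * yd i * (x m * xd m j))).
  exact: sum_orthogonal (x_xd i) (x_xd j).
move=> m _; rewrite !AE !BE /fre /fim.
have rN : rho m != 0 by exact: rsq_neq0.
transitivity (r m ^+ 2 * (p y / rho m) * (yd j * (x m * xd m i) - yd i * (x m * xd m j))).
  by move: (xd m i) (xd m j) (yd i) (yd j) (x m) => *; ring.
by rewrite r_sqr; move: (xd m i) (xd m j) (yd i) (yd j) (x m) => *; field.
Qed.

Let hform_mx (A B : 'M[R]_n) m m' :
  hform h (fun i => A i m) (fun i => B i m') = (A^T *m h *m B) m m'.
Proof.
rewrite /hform !mxE exchange_big; apply: eq_bigr => j _.
rewrite !mxE mulr_suml; apply: eq_bigr => i _; rewrite !mxE.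
by rewrite mulrCA mulrA.
Qed.

Let frame_relations : (forall m m',
    hform h (fre m) (fre m') + hform h (fim m) (fim m') = (m == m')%:R) /\
  (forall m m', hform h (fre m) (fim m') = hform h (fim m) (fre m')).
Proof.
have [gE AB] := frame_rotated.
set A := \matrix_(i, m) fre m i in gE AB; set B := \matrix_(i, m) fim m i in gE AB.
have gu := gram_unit; rewrite -gE in gu.
have [E1 E2] := lagrangian_frame_relations gu AB; rewrite gE -/h in E1 E2.
have AE m : fre m = fun i => A i m by apply/funext => i; rewrite mxE.
have BE m : fim m = fun i => B i m by apply/funext => i; rewrite mxE.
split=> m m'; rewrite !AE !BE !hform_mx; last by rewrite E2.
by have /matrixP/(_ m m') := E1; rewrite mxE [RHS]mxE => <-.
Qed.

(** Contracting the cubic form with the metric, [profile_identity] turns the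
trace into that of the position vector. *)
Lemma mean_curvature_position : mean_curvature X q = alpha *: normal_proj X q (X q).
Proof.
pose M := 1%:M - J^T *m h *m J.
have npE v : normal_proj X q v = v *m M.
  by rewrite /normal_proj /M mulmxBr mulmx1 !mulmxA.
rewrite /mean_curvature.
pose H := \sum_i \sum_j h i j *: second_partial X q i j.
have -> : \sum_i \sum_j invmx (gram X q) i j *: normal_proj X q (second_partial X q i j) = H *m M.
  rewrite /H mulmx_suml; apply: eq_bigr => i _; rewrite mulmx_suml; apply: eq_bigr => j _.
  by rewrite npE scalemxAl.
apply/eqP; rewrite npE scalemxAl -subr_eq0 -mulmxBl -npE; apply/eqP.
apply: normal_proj_eq0 => k; rewrite omegaBZ omega_sum omega_position.
have [rel1 rel2] := frame_relations.
have p0 := profile_p_gt0 n_gt0 alpha_ge0 a_gt0 y.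
have key := profile_identity n_gt0 alpha_ge0 a_gt0 y.
rewrite (eq_bigr _ (fun i _ => eq_bigr _ (fun j _ => congr1 (fun z => h i j * z)
  (omega_second i j k)))).
rewrite (cubic_trace h_sym x_unit x_xd (fun m => rsq_gt0 m y) p0 rel1 rel2 k key).
by rewrite mulrN opprK mulrA addNr.
Qed.

Lemma det_gram : \det (gram X q) = normsq (dz_form (jacobian X q)).
Proof. by rewrite normsq_dz_form // => i j; exact: omega_tangent. Qed.

Lemma det_gram_gt0 : 0 < \det (gram X q).
Proof.
rewrite lt_neqAle det_gram addr_ge0 ?sqr_ge0 // andbT eq_sym -det_gram.
by have := gram_unit; rewrite unitmxE unitfE.
Qed.

Let complex_jac i m : complex_frame J i m =
  ((xd m i)%:C + (x m * yd i)%:C * (c_re m y +i* c_im m y)) * w_fun alpha a psi m y.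
Proof.
rewrite w_funE mxE jac_re jac_im /dwre /dwim; apply: complex_eqP.
  rewrite cReM /=; move: (xd m i) (yd i) (x m) => *; by ring.
rewrite cImM /=; move: (xd m i) (yd i) (x m) => *; by ring.
Qed.

(** By [det_graph_frame], dz_1 ... dz_n of the frame is a real multiple of
(y + i p) w_1 ... w_n, the argument of which is theta; the sign [eps] cancels
against that of x_k. *)
Lemma graph_frame_angle k (eps s : R) : eps ^+ 2 = 1 -> 0 < s -> x k = eps * s ->
  (forall m i, m != k -> xd m i = (m == i)%:R * (i != k)%:R) ->
  (forall i, yd i = eps * (i == k)%:R) ->
  dz_form (jacobian X q) =
  cis (theta_fun alpha a psi y) * (Num.sqrt (\det (gram X q)))%:C.
Proof.
move=> e1 s0 xkE xdE ydE.
have e0 : eps != 0 by apply/eqP => e0; move: e1; rewrite e0 expr0n /= => /esym/eqP; rewrite oner_eq0.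
have xk : x k != 0 by rewrite xkE mulf_neq0 // gt_eqF.
pose vr := \sum_m x m ^+ 2 / rsq m y.
have vr0 : 0 < vr.
  rewrite /vr (bigD1 k) //= ltr_pwDl ?divr_gt0 ?exprn_even_gt0 // sumr_ge0 // => m _.
  by rewrite divr_ge0 ?sqr_ge0 // ltW.
have vrE : \sum_m (x m ^+ 2)%:C * (c_re m y +i* c_im m y) = vr%:C * (y +i* p y).
  rewrite /vr (rmorph_sum (real_complex R)) mulr_suml; apply: eq_bigr => m _.
  rewrite /c_re /c_im; apply: complex_eqP; rewrite ?cReM ?cImM /=.
    by move: (x m) => *; ring.
  by move: (x m) => *; ring.
pose lam := vr / s * (speed alpha a y * profile_m alpha a y ^+ 2).
have m0 := profile_m_gt0 n_gt0 alpha_ge0 a_gt0 y.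
have lam0 : 0 < lam.
  by rewrite /lam mulr_gt0 ?divr_gt0 // mulr_gt0 ?exprn_gt0 // speed_gt0.
have dzE : dz_form (jacobian X q) = cis (theta_fun alpha a psi y) * lam%:C.
  have -> : dz_form (jacobian X q) = \det (\matrix_(i, m)
    (((xd m i)%:C + (x m * yd i)%:C * (c_re m y +i* c_im m y)) * w_fun alpha a psi m y)).
    rewrite /dz_form; congr (\det _); apply/matrixP => i m; rewrite [RHS]mxE.
    exact: complex_jac.
  rewrite (det_graph_frame _ _ xk x_xd xdE ydE) vrE prod_w //.
  have -> : eps / x k = s^-1 by rewrite xkE; field; rewrite e0 gt_eqF.
  have T := cis_theta psi n_gt0 alpha_ge0 a_gt0 y.
  rewrite /lam; move: T; move: (speed alpha a y) (profile_m alpha a y)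
    (cis (theta_fun alpha a psi y)) (cis (\sum_(k < n) phi_fun alpha a psi k y)) (y +i* p y)
    => sp pm ct cs z T.
  rewrite !(rmorphM (real_complex R)) /=.
  transitivity ((s^-1)%:C * vr%:C * sp%:C * pm%:C * (cs * z)); first by move: vr%:C => *; ring.
  by rewrite -T; move: vr%:C => *; ring.
rewrite det_gram dzE normsqM normsq_cis mul1r [normsq _%:C]/normsq /= expr0n addr0.
by rewrite sqrtr_sqr gtr0_norm.
Qed.

End at_a_point.

Lemma lagrangian_L : lagrangian L.
Proof.
split; first exact: embedded_L.
move=> V X q XV Vq i j.
have [U [xi [eta [oU Uq sxi seta XE]]]] := chart_factors XV Vq.
exact: (omega_tangent XV Vq oU Uq sxi seta XE).
Qed.

Lemma mean_curvature_L : mean_curvature_eq n L alpha.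
Proof.
move=> V X q XV Vq.
have [U [xi [eta [oU Uq sxi seta XE]]]] := chart_factors XV Vq.
exact: (mean_curvature_position XV Vq oU Uq sxi seta XE).
Qed.

Lemma chart_det_gram_gt0 (V : set 'rV[R]_n) (X : 'rV[R]_n -> 'rV[R]_(n + n)) q :
  local_param L V X -> V q -> 0 < \det (gram X q).
Proof.
move=> XV Vq.
have [U [xi [eta [oU Uq sxi seta XE]]]] := chart_factors XV Vq.
exact: (det_gram_gt0 XV Vq oU Uq sxi seta XE).
Qed.

(** * The Lagrangian angle of L *)

Definition L_angle v := theta_fun alpha a psi (L_height alpha a psi v).

(** The charts oriented so that theta is the angle itself, rather than theta + pi. *)
Definition positive_chart (V : set 'rV[R]_n) (X : 'rV[R]_n -> 'rV[R]_(n + n)) :=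
  local_param L V X /\ forall q, V q ->
    dz_form (jacobian X q) = cis (L_angle (X q)) * (Num.sqrt (\det (gram X q)))%:C.

Lemma positive_graph_chart k (eps : R) : eps ^+ 2 = 1 ->
  positive_chart (graph_chart_source k) (graph_chart alpha a psi k eps).
Proof.
move=> e1; have loc := local_param_graph_chart psi n_gt0 alpha_ge0 a_gt0 k e1.
split=> // q Vq; set V := graph_chart_source k in loc Vq *.
have oV : open V by exact: open_graph_chart_source.
have XE u : V u -> unit_sphere (hemisphere k eps u) /\
    graph_chart alpha a psi k eps u = Psi (hemisphere k eps u) (eps * u 0 k).
  by move=> Vu; split=> //; exact: sum_sqr_hemisphere.
have -> : L_angle (graph_chart alpha a psi k eps q) = theta_fun alpha a psi (eps * q 0 k).
  by rewrite /L_angle /graph_chart L_height_sweep //; exact: sum_sqr_hemisphere.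
have dproj i j : 'D_(delta_mx 0 i) (fun u : 'rV[R]_n => u 0 j) q = (j == i)%:R.
  have dI : derivable (id : 'rV[R]_n -> 'rV[R]_n) q (delta_mx 0 i) by exact: derivable_id.
  have := derive_mx dI; rewrite derive_id => /matrixP/(_ 0 j); rewrite [in RHS]mxE => <-.
  by rewrite mxE eqxx.
have dprojP i j : is_derive q (delta_mx 0 i) (fun u : 'rV[R]_n => u 0 j) (j == i)%:R.
  rewrite -dproj; apply: derivableP.
  exact: smooth_upto_derivable (smooth_upto_proj _ _ openT : smooth_upto 0 _ _) _.
apply: (graph_frame_angle loc Vq oV Vq (fun l => @smooth_upto_hemisphere _ _ l k eps)
  (fun l => @smooth_upto_graph_height _ _ l k eps V oV) XE (k := k) (eps := eps)
  (s := Num.sqrt (1 - \sum_(i < n | i != k) q 0 i ^+ 2)) e1).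
- by rewrite sqrtr_gt0.
- by rewrite mxE eqxx.
- move=> m i mk; rewrite (_ : (fun u => _) = fun u : 'rV[R]_n => u 0 m).
    rewrite dproj; case: (eqVneq m i) => [<-|_]; last by rewrite mul0r.
    by rewrite mk mulr1.
  by apply/funext => u; rewrite mxE (negbTE mk).
- move=> i; have [_ ->] := is_deriveMf (is_deriveCf q (delta_mx 0 i) eps) (dprojP i k).
  by rewrite mul0r add0r eq_sym.
Qed.

Lemma same_phase_ratio (d t s s' : R) :
  d%:C * (cis t * s'%:C) = cis t * s%:C -> 0 < s -> 0 < s' -> 0 < d.
Proof.
move=> E s0 s'0; have ct0 : cis t != 0.
  apply/eqP => ct0; have := normsq_cis t; rewrite ct0 /normsq /= expr0n addr0 => /esym/eqP.
  by rewrite oner_eq0.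
have [ds] : (d * s')%:C = s%:C.
  by apply: (mulfI ct0); rewrite -E (rmorphM (real_complex R)) mulrCA.
by move: s0; rewrite -ds pmulr_lgt0.
Qed.

(** The transition matrix multiplies dz_1 ... dz_n by its determinant, which is
positive as the phases agree. *)
Lemma positive_charts_compatible (V V' : set 'rV[R]_n)
    (X X' : 'rV[R]_n -> 'rV[R]_(n + n)) q q' :
  positive_chart V X -> positive_chart V' X' -> V q -> V' q' -> X q = X' q' ->
  exists M : 'M[R]_n, 0 < \det M /\ jacobian X q = M *m jacobian X' q'.
Proof.
move=> [XV ang] [XV' ang'] Vq Vq' E.
have dX := chart_differentiable XV Vq; have dX' := chart_differentiable XV' Vq'.
have [oV' [W' [Y' [oW' [_ sY' X'W' Y'W']]]]] := XV'.
have [LW YX] := X'W' _ Vq'; have [U [F [oU Uq sF YF]]] := sY' _ LW.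
have FX' : F (X' q') = q' by rewrite -YF ?YX.
have dF : differentiable F (X q) by rewrite E; exact: (sF [::]).
have dX'F : differentiable X' (F (X q)) by rewrite E FX'.
have [oV [W [Y [oW [_ _ XW _]]]]] := XV.
have XE : \forall u \near q, X u = X' (F (X u)).
  have cX : {for q, continuous X} := differentiable_continuous dX.
  have nV : nbhs q V by exact: open_nbhs_nbhs.
  have nU : nbhs q (X @^-1` (U `&` W')).
    apply: cX; apply: open_nbhs_nbhs; split; first exact: openI.
    by rewrite E; split=> //; case: LW.
  apply: filterS (filterI nV nU) => u [Vu [Uu W'u]].
  have [[Lu _] _] := XW _ Vu.
  by have [_] := Y'W' _ (conj Lu W'u); rewrite YF.
pose M := jacobian X q *m jacobian F (X q).
have JM : jacobian X q = M *m jacobian X' q'.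
  have -> : jacobian X' q' = jacobian X' (F (X q)) by rewrite E FX'.
  apply/row_matrixP => i; rewrite !rowE !mulmxA -(deriveEjacobian _ dX).
  rewrite -(deriveEjacobian _ dF) -(deriveEjacobian _ dX'F).
  rewrite (deriveE _ dX'F) (deriveE _ dF) [in RHS](deriveE _ dX).
  have -> : 'd X' (F (X q)) ('d F (X q) ('d X q (delta_mx 0 i))) =
      ('d X' (F (X q)) \o ('d F (X q) \o 'd X q)) (delta_mx 0 i) by [].
  have dFX : differentiable (F \o X) q by exact: differentiable_comp.
  rewrite -diff_comp // -(diff_comp (f := F \o X)) // -!deriveE //; last exact: differentiable_comp.
  exact: near_eq_derive.
exists M; split=> //.
have eq1 := ang q Vq; rewrite {1}JM dz_formM ang' // E in eq1.
have s0 : 0 < Num.sqrt (\det (gram X q)) by rewrite sqrtr_gt0 (chart_det_gram_gt0 XV Vq).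
have s'0 : 0 < Num.sqrt (\det (gram X' q')).
  by rewrite sqrtr_gt0 (chart_det_gram_gt0 XV' Vq').
exact: same_phase_ratio eq1 s0 s'0.
Qed.

(** The graph charts are all positive, so positive charts cover L. *)
Lemma lagrangian_angle_L : lagrangian_angle L L_angle.
Proof.
exists positive_chart; split; last by move=> V X q [_ ang]; exact: ang.
split.
- by move=> V X [].
- move=> v /graph_chart_covers[k [eps [u [e1 uV uq]]]].
  exists (graph_chart_source k), (graph_chart alpha a psi k eps), u; split=> //.
  exact: positive_graph_chart.
- move=> V X V' X' q q' pX pX' Vq V'q' E.
  exact: positive_charts_compatible pX pX' Vq V'q' E.
Qed.

Lemma L_angle_sweep x t : unit_sphere x ->
  L_angle (Psi x t) = theta_fun alpha a psi t.
Proof. by move=> ux; rewrite /L_angle L_height_sweep. Qed.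

(** The derivative of theta is - alpha p. *)
Lemma special_lagrangian_L : alpha = 0 -> special_lagrangian L.
Proof.
move=> alpha0; split; first exact: lagrangian_L.
have thE t : theta_fun alpha a psi t = theta_fun alpha a psi 0.
  have iT : is_interval (@setT R) by [].
  apply: (derive0_constant iT) => // z _.
  apply: is_derive_eq (is_derive_theta psi n_gt0 alpha_ge0 a_gt0 z) _.
  by rewrite alpha0 mul0r oppr0.
exists (theta_fun alpha a psi 0).
have [orient [oO ang]] := lagrangian_angle_L; exists orient; split=> // V X q OX Vq.
by rewrite (ang V X q OX Vq) /L_angle thE.
Qed.

End lagrangian_geometry.

Theorem theoremC (R : realType) (n : nat) (alpha : R)
  (hn : (0 < n)%N) (halpha : 0 <= alpha) :
  (forall (I : set R) (w : 'I_n -> R -> R[i]) (th : angle_fun R),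
     solution alpha I w th -> negative_first_integral alpha I w th ->
     (exists! J : set R, exists w' th', largest_extension alpha I w th J w' th')
     /\
     (forall J w' th', largest_extension alpha I w th J w' th' ->
        exists (a psi : 'I_n -> R) (y : R -> R),
          [/\ forall j, 0 < a j,
              change_of_variables alpha a psi J w' y &
              sweep J w' = L_fun alpha a psi]))
  /\
  (forall a psi : 'I_n -> R, (forall j, 0 < a j) ->
     exists (I : set R) (w : 'I_n -> R -> R[i]) (th : angle_fun R) (y : R -> R),
       [/\ solution alpha I w th,
           negative_first_integral alpha I w th,
           largest_extension alpha I w th I w th,
           change_of_variables alpha a psi I w y &
           sweep I w = L_fun alpha a psi])
  /\
  (forall a psi : 'I_n -> R, (forall j, 0 < a j) ->
     let L := L_fun alpha a psi in
     [/\ closed L,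
         lagrangian L,
         diffeomorphic (@sphere_line R n) L &
         mean_curvature_eq n L alpha]
     /\
     [/\ 0 < alpha -> self_expander n L,
         alpha = 0 -> special_lagrangian L &
         exists theta : 'rV[R]_(n + n) -> R,
           lagrangian_angle L theta /\
           forall (x : 'rV[R]_n) (y : R), unit_sphere x ->
             theta (sweep_point (w_fun alpha a psi) x y)
             = theta_fun alpha a psi y]).
Proof.
split; first by move=> I w th; exact: solutions_are_explicit.
split; first by move=> a psi a_gt0; exact: explicit_curves_arise.
move=> a psi a_gt0 L; split.
  split.
  - exact: closed_L.
  - exact: lagrangian_L.
  - exact: diffeomorphic_L.
  - exact: mean_curvature_L.
split.
- by move=> alpha_gt0; exists alpha; split; last exact: mean_curvature_L.
- exact: special_lagrangian_L.
- exists (L_angle alpha a psi); split; first exact: lagrangian_angle_L.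
  by move=> x y ux; exact: L_angle_sweep.
Qed.
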